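(* Let $V$ be a finite dimensional real inner product space and let $\mu$ be a quasi-decomposable probability measure on $V$ with Lévy spectral measure $M$. (1) Discrete case. Suppose there is $c\in(0,1)$ such that $\{a>0: G_a(\mu)\neq\emptyset\}=\{c^n:n\in\mathbb{Z}\}$. Let $a<1$ be one of these numbers and let $A\in G_a(\mu)$ satisfy $\|A\|<1$. Put $Z_A=\{v\in V:\|v\|\le 1,\ \|A^{-1}v\|>1\}$. Then there is a universal quasi-decomposability centering for $\mu$ if and only if \[ \int_{Z_A}(u,w)\,M(du)=0\qquad\text{for all } w\in\mathcal{N}(A^*-aI). \] (2) Continuous case. Suppose that $G_a(\mu)\neq\emptyset$ for every $a>0$ and that $B\in\operatorname{End}V$ is such that for every $t>0$ there is $h_{t,B}\in V$ with $\mu^t=t^B\mu*\delta(h_{t,B})$. Put $L_B=\{v\in V:\|v\|=1,\ \|t^Bv\|>1 \text{ for all } t>1\}$ and, for Borel $E\subset L_B$, $K_B(E)=M(\{t^Bv: v\in E,\ t\ge 1\})$. Then there is a universal quasi-decomposability centering for $\mu$ if and only if \[ \int_{L_B}(u,w)\,K_B(du)=0\qquad\text{for all } w\in\mathcal{N}(B^*-I). \]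
   Context: For a linear operator $A$ and a probability measure $\mu$ on $V$, $A\mu(E)=\mu(A^{-1}(E))$ is the image measure; $*$ between measures is convolution; $\delta(h)$ is the point mass at $h$; $A^*$ is the adjoint of an operator; $\mathcal{N}(T)=\{v:Tv=0\}$; $\|A\|$ is the operator norm; $t^B=e^{(\log t)B}$. An infinitely divisible measure $\mu=[m,D,M]$ has characteristic function \[ \hat\mu(u)=\exp\Big\{i(m,u)-\tfrac12(Du,u)+\int_{V_0}\Big(e^{i(v,u)}-1-\frac{i(v,u)}{1+\|v\|^2}\Big)M(dv)\Big\}, \] with $m\in V$, $D$ a non-negative linear operator, $V_0=V\setminus\{0\}$, and $M$ the Lévy spectral measure, a Borel measure on $V_0$ with $\int_{V_0}\|v\|^2/(1+\|v\|^2)\,M(dv)<\infty$. For $a>0$, $\mu^a=[am,aD,aM]$ is the $a$-th convolution power. For infinitely divisible $\mu$ and $a>0$, $G_a(\mu)=\{A\in\operatorname{End}V:\mu^a=A\mu*\delta(h)\text{ for some }h\in V\}$. $\mu$ is quasi-decomposable if it is infinitely divisible and $G_a(\mu)\neq\emptyset$ for some $a>0$, $a\neq1$. A universal quasi-decomposability centering for $\mu$ is a vector $\hat h\in V$ such that $(\mu*\delta(\hat h))^a=A(\mu*\delta(\hat h))$ for every $a>0$ with $G_a(\mu)\neq\emptyset$ and every $A\in G_a(\mu)$. The two cases (discrete, continuous) are the two possibilities for a quasi-decomposable measure. The set $Z_A$ is written with $A^{-1}$, so $A$ is taken to be invertible there; this is automatic when $\mu$ is full, i.e. not concentrated on any proper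 affine subspace of $V$.
   Formalization: In both cases the implication from the integral condition to the existence of a universal centering is stated only for full μ (not concentrated on a proper affine subspace), since it fails for some non-full μ; the converse is stated for all μ. *)

(* Defs.v *)
(* The space V is 'cV[R]_n with its standard inner product,
   i.e. coordinates with respect to an orthonormal basis; End V is 'M[R]_n, an
   operator acting by v |-> A *m v, so that the adjoint of A is A^T. *)
From HB Require Import structures.
From mathcomp Require Import all_boot all_order all_algebra.
From mathcomp Require Import complex.
From mathcomp Require Import all_classical all_reals all_analysis.
From mathcomp Require Import measurable_realfun.

Set Implicit Arguments.
Unset Strict Implicit.
Unset Printing Implicit Defensive.

Import Order.TTheory GRing.Theory Num.Theory.
Import numFieldNormedType.Exports.

Local Open Scope classical_set_scope.
Local Open Scope ring_scope.

(* Matrices carry the Borel sigma-algebra of their usual topology. *)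
HB.instance Definition _ (R : realType) (m n : nat) :=
  Measurable.copy 'M[R]_(m, n) (g_sigma_algebraType (@open 'M[R]_(m, n))).

Section borel_matrix.
Context {R : realType}.

Lemma open_measurable_mx (m n : nat) (U : set 'M[R]_(m, n)) :
  open U -> measurable U.
Proof. by move=> oU; exact: sub_sigma_algebra. Qed.

Lemma measurable_coord (m n : nat) (i : 'I_m) (j : 'I_n) :
  measurable_fun [set: 'M[R]_(m, n)] (fun A : 'M[R]_(m, n) => A i j).
Proof.
apply: (measurability _ (RGenOpens.measurableE R)) => _ [_ [a [b ->]] <-].
rewrite setTI; apply: open_measurable_mx.
move/continuousP: (@coord_continuous R m n i j); apply.
exact: interval_open.
Qed.

Lemma measurable_mxP d (T : measurableType d) (m n : nat)
    (f : T -> 'M[R]_(m, n)) :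
  (forall i j, measurable_fun setT (fun t => f t i j)) ->
  measurable_fun setT f.
Proof.
move=> mf; apply: (@measurability _ _ T 'M[R]_(m, n) setT f (@open 'M[R]_(m, n)) erefl) => _ [U oU <-]; rewrite setTI.
pose box (p : 'M[rat]_(m, n) * rat) : set 'M[R]_(m, n) :=
  [set A | forall i j, `|ratr (p.1 i j) - A i j| < ratr p.2].
pose F p : set T := if `[< box p `<=` U >] then f @^-1` box p else set0.
have -> : f @^-1` U = \bigcup_p F p.
  apply/seteqP; split => [t Ut|t [p _]]; last first.
    by rewrite /F; case: asboolP => // pU /pU.
  have /nbhs_ballP[e /= e0 eU] : nbhs (f t) U by exact: open_nbhs_nbhs.
  have /rat_in_itvoo[r] : 0 < e / 2 by rewrite divr_gt0.
  rewrite in_itv/= => /andP[r0 re].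
  have q_ i j : exists q : rat, `|ratr q - f t i j| < ratr r.
    have /rat_in_itvoo[q] : f t i j - ratr r < f t i j + ratr r.
      by rewrite ltrD2l gtrN.
    by rewrite in_itv/= => qr; exists q; rewrite ltr_distl.
  pose q : 'M[rat]_(m, n) := \matrix_(i, j) sval (cid (q_ i j)).
  exists (q, r) => //; rewrite /F; case: asboolP => /= [_ i j|[]].
    by rewrite mxE; case: cid.
  move=> A boxA; apply: eU; split => // i j; rewrite /ball/= distrC.
  rewrite (splitr e) -(subrKA (ratr (q i j))).
  rewrite (le_lt_trans (ler_normD _ _))// ltrD//.
  - by rewrite distrC (lt_trans (boxA i j)).
  - by rewrite mxE; case: cid => /= x xr; rewrite (lt_trans xr).
apply: countable_bigcupT_measurable => [|p]; first exact: countableP.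
rewrite /F; case: ifP => // _.
have -> : f @^-1` box p = \bigcap_(ij : 'I_m * 'I_n)
    ((fun t => f t ij.1 ij.2) @^-1`
      [set x | `|ratr (p.1 ij.1 ij.2) - x| < ratr p.2]).
  apply/seteqP; split => t tp => [ij _|i j]; first exact: tp.
  exact: (tp (i, j) I).
apply: fin_bigcap_measurable => // -[i j] _ /=.
rewrite -[X in measurable X]setTI; apply: mf => //.
rewrite (_ : [set x | _] = ball (ratr (p.1 i j) : R) (ratr p.2)) //.
by rewrite ball_itv; exact: measurable_itv.
Qed.
End borel_matrix.

Section euclidean.
Context {R : realType} {n : nat}.
Implicit Types (u v : 'cV[R]_n) (A B : 'M[R]_n).

Definition dot u v : R := \sum_i u i 0 * v i 0.

(* The library norm `|v| is the sup norm. *)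
Definition enorm v : R := Num.sqrt (dot v v).

Definition opnorm A : R := sup [set enorm (A *m v) | v in [set v | enorm v <= 1]].

Definition nullspace A : set 'cV[R]_n := [set v | A *m v = 0].

Definition expmx A : 'M[R]_n := limn (series (fun k => k`!%:R^-1 *: A ^+ k)).

Definition powmx (t : R) B : 'M[R]_n := expmx (ln t *: B).

End euclidean.

Section measures.
Context {R : realType} {n : nat}.
Notation V := 'cV[R]_n.
Implicit Types (mu nu : probability V R) (A : 'M[R]_n).

Lemma measurable_mulmx A : measurable_fun [set: V] (mulmx A : V -> V).
Proof.
apply: measurable_mxP => i j.
rewrite (_ : (fun _ => _) = (fun v : V => \sum_k A i k * v k j)).
  apply: measurable_sum => k; apply: measurable_funM => //.
  exact: measurable_coord.
by apply/funext => v; rewrite mxE.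
Qed.

HB.instance Definition _ A :=
  isMeasurableFun.Build _ _ V V (mulmx A : V -> V) (measurable_mulmx A).

Definition image_measure A mu : probability V R :=
  distribution mu (mulmx A : V -> V).

Definition vadd (p : V * V) : V := p.1 + p.2.

Lemma measurable_vadd : measurable_fun setT vadd.
Proof.
apply: measurable_mxP => i j.
rewrite (_ : (fun _ => _) = (fun p : V * V => p.1 i j + p.2 i j)).
  by apply: measurable_funD; apply: (measurableT_comp (measurable_coord i j)).
by apply/funext => p; rewrite /vadd mxE.
Qed.

HB.instance Definition _ := isMeasurableFun.Build _ _ _ _ vadd measurable_vadd.

Definition convolution mu nu : set V -> \bar R := pushforward (mu \x nu)%E vadd.

Section convolution_probability.
Variables mu nu : probability V R.

Let conv0 : convolution mu nu set0 = 0%E.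
Proof. exact: measure0. Qed.

Let conv_ge0 E : (0 <= convolution mu nu E)%E.
Proof. exact: measure_ge0. Qed.

Let conv_sigma_additive : semi_sigma_additive (convolution mu nu).
Proof. exact: measure_semi_sigma_additive. Qed.

HB.instance Definition _ := isMeasure.Build _ _ _ (convolution mu nu)
  conv0 conv_ge0 conv_sigma_additive.

Let conv_setT : convolution mu nu setT = 1%E.
Proof.
rewrite /convolution /pushforward preimage_setT -setXTT.
rewrite [LHS](product_measure1E _ _ measurableT measurableT).
by rewrite [X in (X * _)%E]probability_setT [X in (_ * X)%E]probability_setT mule1.
Qed.

HB.instance Definition _ :=
  Measure_isProbability.Build _ _ _ (convolution mu nu) conv_setT.

End convolution_probability.

Definition conv mu nu : probability V R := convolution mu nu.

Definition pmass (h : V) : probability V R := dirac h.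

Fixpoint conv_iter mu (k : nat) : probability V R :=
  if k is k'.+1 then conv mu (conv_iter mu k') else pmass 0.

Definition infinitely_divisible mu : Prop :=
  forall k : nat, (0 < k)%N -> exists nu : probability V R,
    forall E, measurable E -> mu E = conv_iter nu k E.

Definition full mu : Prop :=
  forall (x : V) (U : {vspace V}), U != fullv ->
    mu [set v | v - x \in U] != 1%E.

End measures.

Section levy_khintchine.
Context {R : realType} {n : nat}.
Notation V := 'cV[R]_n.
Local Open Scope complex_scope.

Definition cexp (z : R[i]) : R[i] :=
  (expR (complex.Re z))%:C * (cos (complex.Im z) +i* sin (complex.Im z)).

Definition cintegral (mu : {measure set V -> \bar R}) (E : set V)
    (f : V -> R[i]) : R[i] :=
  (\int[mu]_(v in E) complex.Re (f v)) +i* (\int[mu]_(v in E) complex.Im (f v)).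

Definition charfun (mu : probability V R) (u : V) : R[i] :=
  cintegral mu setT (fun v => cexp ('i * (dot v u)%:C)).

Definition V0 : set V := ~` [set 0].

(* A Borel measure on V0 is a Borel measure on V without mass at 0. *)
Definition levy_measure (M : {measure set V -> \bar R}) : Prop :=
  M [set 0] = 0%E /\
  (\int[M]_(v in V0) (enorm v ^+ 2 / (1 + enorm v ^+ 2))%:E < +oo)%E.

Definition nonneg_operator (D : 'M[R]_n) : Prop :=
  D^T = D /\ forall u : V, 0 <= dot (D *m u) u.

(* mu = [m, D, M] *)
Definition levy_khintchine (mu : probability V R) (m : V) (D : 'M[R]_n)
    (M : {measure set V -> \bar R}) : Prop :=
  [/\ nonneg_operator D, levy_measure M &
   forall u : V, charfun mu u =
     cexp ('i * (dot m u)%:C - (2^-1 * dot (D *m u) u)%:C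
           + cintegral M V0 (fun v => cexp ('i * (dot v u)%:C) - 1
                - 'i * (dot v u)%:C / (1 + enorm v ^+ 2)%:C))].

End levy_khintchine.

Section quasi_decomposability.
Context {R : realType} {n : nat}.
Notation V := 'cV[R]_n.
Implicit Types (mu nu : probability V R) (a : R) (A B : 'M[R]_n).

(* nu = mu^a, i.e. mu = [m, D, M] and nu = [am, aD, aM] *)
Definition is_conv_power a mu nu : Prop :=
  exists (m : V) (D : 'M[R]_n) (M : {measure set V -> \bar R}) (a0 : 0 <= a),
    levy_khintchine mu m D M /\
    levy_khintchine nu (a *: m) (a *: D) (mscale (NngNum a0) M).

Definition Gset a mu : set 'M[R]_n :=
  [set A | exists h, is_conv_power a mu (conv (image_measure A mu) (pmass h))].

Definition quasi_decomposable mu : Prop :=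
  infinitely_divisible mu /\ exists a, [/\ 0 < a, a != 1 & Gset a mu !=set0].

Definition universal_centering mu (h : V) : Prop :=
  forall a A, 0 < a -> Gset a mu A ->
    is_conv_power a (conv mu (pmass h)) (image_measure A (conv mu (pmass h))).

Definition Z_set A : set V :=
  [set v | enorm v <= 1 /\ 1 < enorm (invmx A *m v)].

Definition L_set B : set V :=
  [set v | enorm v = 1 /\ forall t : R, 1 < t -> 1 < enorm (powmx t B *m v)].

(* The measure K_B on L_B, extended by 0 to V; cutting down to L_B keeps it
   countably additive, since v, t |-> t^B v is injective on L_B x ]0, +oo[. *)
Definition K_meas (M : {measure set V -> \bar R}) B (E : set V) : \bar R :=
  M [set x | exists v t, [/\ (E `&` L_set B) v, 1 <= t & x = powmx t B *m v]].

End quasi_decomposability.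

(* Main.v *)
(* For invertible A, uniqueness of the triple [m, D, M] turns A in G_a(mu) into
   A D A^T = a D and M o A^-1 = a M.  Replacing 1 / (1 + |v|^2) by another
   truncation psi only shifts m, and in terms of the shifted vector x centering
   at A becomes A x + beta = a x, with beta the M-integral of
   (psi (A v) - psi v) A v.

   Discrete case: with psi the indicator of the unit ball, beta is a times the
   integral of v over Z_A, so the equation for this one A is solvable exactly
   when that integral is orthogonal to the kernel of A^T - a.

   Continuous case: by Borel-Cantelli, M-almost every v satisfies t^B v -> 0 as
   t -> 0, and such an orbit (v <> 0) leaves the unit ball a last time, at a point
   of L_B.  With psi the indicator of not having left the ball yet, beta at t^B
   is a cocycle in s = ln t, and its derivative at s = 0 is the integral of u
   against K_B, up to sign.  A differentiable cocycle is determined by that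
   derivative, so it is a coboundary exactly when the integral lies in the range
   of B - 1.

   From one solution to all of them: if mu is full, then G_1 is bounded and
   preserves a positive definite form.  With a G_1-invariant truncation, the
   projection of a solution to the fixed vectors of G_1 is a solution for the
   whole coset; in the discrete case one moreover averages over the orbit of a
   generator of the scaling group. *)

From HB Require Import structures.
Require Import Defs.
From mathcomp Require Import all_boot all_order all_algebra.
From mathcomp Require Import complex.
From mathcomp Require Import all_classical all_reals all_analysis.
From mathcomp Require Import measurable_realfun.
From mathcomp Require Import ring lra.

Set Implicit Arguments.
Unset Strict Implicit.
Unset Printing Implicit Defensive.

Import Order.TTheory GRing.Theory Num.Theory.
Import numFieldNormedType.Exports.

Local Open Scope classical_set_scope.
Local Open Scope ring_scope.

(** [is_conv_power] quantifies existentially over the triple, so nothing about [A] can be read off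
    until the triple is known to be unique. The Fourier transform determines the exponent only
    modulo 2 pi i; continuity along rays replaces a complex logarithm there.

    No Haar measure on [G_1] is used. An infimum over the group makes the truncation invariant, an
    algebraic projection makes vectors invariant, and boundedness of the group is the only analytic
    input. The projection commutes with every [A] in [G_a] because conjugation by [A] preserves
    [G_1].

    The implication from a centering to the vanishing integral uses one operator, or one flow, whose
    invertibility is at hand. The converse must treat all of [G_a]; there fullness makes every such
    [A] invertible, and it prevents a direction from being invisible to both [D] and [M], which is
    what makes the invariant form definite. *)

Section euclidean_facts.
Context {R : realType} {n : nat}.
Notation V := 'cV[R]_n.
Implicit Types (u v w : V) (A B : 'M[R]_n).

Lemma dotC u v : dot u v = dot v u.
Proof. by apply: eq_bigr => i _; rewrite mulrC. Qed.

Lemma dotDl u v w : dot (u + v) w = dot u w + dot v w.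
Proof. by rewrite -big_split; apply: eq_bigr => i _; rewrite mxE mulrDl. Qed.

Lemma dotDr u v w : dot w (u + v) = dot w u + dot w v.
Proof. by rewrite dotC dotDl !(dotC w). Qed.

Lemma dotZl a u v : dot (a *: u) v = a * dot u v.
Proof. by rewrite mulr_sumr; apply: eq_bigr => i _; rewrite mxE mulrA. Qed.

Lemma dotZr a u v : dot u (a *: v) = a * dot u v.
Proof. by rewrite dotC dotZl dotC. Qed.

Lemma dotNl u v : dot (- u) v = - dot u v.
Proof. by rewrite -scaleN1r dotZl mulN1r. Qed.

Lemma dotNr u v : dot u (- v) = - dot u v.
Proof. by rewrite dotC dotNl dotC. Qed.

Lemma dotBl u v w : dot (u - v) w = dot u w - dot v w.
Proof. by rewrite dotDl dotNl. Qed.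

Lemma dotBr u v w : dot w (u - v) = dot w u - dot w v.
Proof. by rewrite dotDr dotNr. Qed.

Lemma dot0l u : dot 0 u = 0.
Proof. by rewrite -(scale0r 0) dotZl mul0r. Qed.

Lemma dot0r u : dot u 0 = 0.
Proof. by rewrite dotC dot0l. Qed.

Lemma dotE u v : dot u v = (u^T *m v) 0 0.
Proof. by rewrite mxE; apply: eq_bigr => i _; rewrite mxE. Qed.

Lemma dot_mulmxl A u v : dot (A *m u) v = dot u (A^T *m v).
Proof. by rewrite !dotE trmx_mul mulmxA. Qed.

Lemma dot_delta v (i : 'I_n) : dot v (delta_mx i 0) = v i 0.
Proof.
rewrite /dot (bigD1 i)//= mxE !eqxx mulr1 big1 ?addr0// => j ji.
by rewrite mxE (negbTE ji) mulr0.
Qed.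

Lemma dot_inj u v : (forall w, dot u w = dot v w) -> u = v.
Proof. by move=> uv; apply/matrixP => i j; rewrite ord1 -!dot_delta uv. Qed.

Lemma dot_ge0 v : 0 <= dot v v.
Proof. by apply: sumr_ge0 => i _; rewrite -expr2 sqr_ge0. Qed.

Lemma dot_eq0 v : (dot v v == 0) = (v == 0).
Proof.
apply/eqP/eqP => [|->]; last by rewrite dot0l.
move=> /eqP; rewrite psumr_eq0; last by move=> i _; rewrite -expr2 sqr_ge0.
move=> /allP v0; apply/matrixP => i j; rewrite ord1 mxE.
by have /(_ (mem_index_enum i)) := v0 i; rewrite mulf_eq0 orbb => /eqP.
Qed.

Lemma enorm_ge0 v : 0 <= enorm v. Proof. exact: sqrtr_ge0. Qed.

Lemma enorm_sq v : enorm v ^+ 2 = dot v v.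
Proof. by rewrite sqr_sqrtr// dot_ge0. Qed.

Lemma enorm_eq0 v : (enorm v == 0) = (v == 0).
Proof. by rewrite -sqrf_eq0 enorm_sq dot_eq0. Qed.

Lemma enorm0 : enorm (0 : V) = 0.
Proof. by apply/eqP; rewrite enorm_eq0. Qed.

Lemma enorm_gt0 v : (0 < enorm v) = (v != 0).
Proof. by rewrite lt_def enorm_eq0 enorm_ge0 andbT. Qed.

Lemma enormZ a v : enorm (a *: v) = `|a| * enorm v.
Proof. by rewrite /enorm dotZl dotZr mulrA -expr2 sqrtrM ?sqr_ge0// sqrtr_sqr. Qed.

Lemma dot_sqr_le u v : dot u v ^+ 2 <= dot u u * dot v v.
Proof.
have [->|v0] := eqVneq v 0; first by rewrite !dot0r expr0n mulr0.
have vv : 0 < dot v v by rewrite lt_def dot_eq0 v0 dot_ge0.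
have := dot_ge0 (dot v v *: u - dot u v *: v).
rewrite dotBl !dotBr !dotZl !dotZr (dotC v u).
set x := dot u u; set y := dot u v; set z := dot v v => h.
have : 0 <= z * (x * z - y ^+ 2) by apply: le_trans h _; rewrite le_eqVlt; apply/orP; left; apply/eqP; ring.
by rewrite pmulr_rge0// subr_ge0.
Qed.

Lemma cauchy_schwarz u v : `|dot u v| <= enorm u * enorm v.
Proof.
rewrite -(@ler_pXn2r _ 2)// ?nnegrE ?mulr_ge0 ?enorm_ge0//.
by rewrite exprMn !enorm_sq real_normK ?num_real// dot_sqr_le.
Qed.

Lemma enormD u v : enorm (u + v) <= enorm u + enorm v.
Proof.
rewrite -(@ler_pXn2r _ 2)// ?nnegrE ?addr_ge0 ?enorm_ge0//.
rewrite enorm_sq dotDl !dotDr (dotC v u) sqrrD !enorm_sq.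
have := le_trans (ler_norm _) (cauchy_schwarz u v); lra.
Qed.

Lemma enorm_sum I (r : seq I) (P : pred I) (F : I -> V) :
  enorm (\sum_(i <- r | P i) F i) <= \sum_(i <- r | P i) enorm (F i).
Proof.
elim/big_ind2 : _ => //; first by rewrite enorm0.
by move=> x1 x2 y1 y2 h1 h2; rewrite (le_trans (enormD _ _))// lerD.
Qed.

Lemma coord_le_enorm v i : `|v i 0| <= enorm v.
Proof.
rewrite -dot_delta (le_trans (cauchy_schwarz _ _))//.
suff -> : enorm (delta_mx i 0 : V) = 1 by rewrite mulr1.
by rewrite /enorm dot_delta mxE !eqxx sqrtr1.
Qed.

Lemma enorm_le_coord v : enorm v <= \sum_i `|v i 0|.
Proof.
have {1}-> : v = \sum_i v i 0 *: delta_mx i 0.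
  rewrite {1}[v]matrix_sum_delta; apply: eq_bigr => i _.
  by rewrite big_ord1.
rewrite (le_trans (enorm_sum _ _ _))// ler_sum// => i _.
by rewrite enormZ /enorm dot_delta mxE !eqxx sqrtr1 mulr1.
Qed.

(** An operator-norm bound that does not pass through a supremum, so it is available for every
    matrix without a boundedness argument. *)
Definition mxbound A : R := \sum_i enorm (row i A)^T.

Lemma mxbound_ge0 A : 0 <= mxbound A.
Proof. by apply: sumr_ge0 => i _; exact: enorm_ge0. Qed.

Lemma enorm_mulmx A v : enorm (A *m v) <= mxbound A * enorm v.
Proof.
rewrite (le_trans (enorm_le_coord _))// mulr_suml ler_sum// => i _.
suff -> : (A *m v) i 0 = dot (row i A)^T v by exact: cauchy_schwarz.
by rewrite mxE; apply: eq_bigr => j _; rewrite !mxE.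
Qed.

Lemma opnorm_ub A v : enorm (A *m v) <= opnorm A * enorm v.
Proof.
(* [sup] carries information only on a bounded set, and [mxbound] bounds this one. *)
have ubA : has_ubound [set enorm (A *m v) | v in [set v : V | enorm v <= 1]].
  exists (mxbound A) => _ [w /= w1 <-]; rewrite (le_trans (enorm_mulmx _ _))//.
  by rewrite -[leRHS]mulr1 ler_wpM2l// mxbound_ge0.
have [->|v0] := eqVneq v 0; first by rewrite mulmx0 enorm0 mulr0.
have v0' : 0 < enorm v by rewrite enorm_gt0.
rewrite -ler_pdivrMr// mulrC.
have -> : (enorm v)^-1 * enorm (A *m v) = enorm (A *m ((enorm v)^-1 *: v)).
  by rewrite -scalemxAr enormZ gtr0_norm// invr_gt0.
apply: ub_le_sup => //; exists ((enorm v)^-1 *: v) => //=.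
by rewrite enormZ gtr0_norm ?invr_gt0// mulVf// gt_eqF.
Qed.

Lemma measurable_dot u : measurable_fun [set: V] (fun v => dot v u).
Proof.
apply: measurable_sum => i; apply: measurable_funM => //; exact: measurable_coord.
Qed.

Lemma measurable_enorm : measurable_fun [set: V] (@enorm R n).
Proof.
apply: measurableT_comp; first by apply: continuous_measurable_fun; exact: sqrt_continuous.
by apply: measurable_sum => i; apply: measurable_funM; exact: measurable_coord.
Qed.

Lemma measurable_enorm_ge (c : R) : measurable [set v : V | c <= enorm v].
Proof.
rewrite (_ : [set v | _] = [set v : V | [set` `[c, +oo[] (enorm v)]).
  rewrite -[X in measurable X]setTI; exact: (measurable_enorm measurableT (measurable_itv _)).
by apply/seteqP; split=> v /=; rewrite in_itv /= andbT.
Qed.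

Lemma measurable_set1V v : measurable [set v : V].
Proof.
have -> : [set v] = [set w | enorm (w - v) <= 0].
  apply/seteqP; split => w /=; first by move=> ->; rewrite subrr enorm0.
  move=> h; apply/eqP; rewrite -subr_eq0 -enorm_eq0.
  by rewrite eq_le h enorm_ge0.
rewrite -[X in measurable X]setTI.
rewrite (_ : [set w | _] = (fun w => enorm (w - v)) @^-1` `]-oo, 0]); last first.
  by apply/seteqP; split => w /=; rewrite in_itv.
apply: (measurableT_comp measurable_enorm) => //.
by apply: measurable_mxP => i j; under eq_fun do rewrite !mxE; apply: measurable_funB => //; exact: measurable_coord.
Qed.

End euclidean_facts.

(** * A polynomial approximation of a step function *)

Section real_lemmas.
Context {R : realType}.

Lemma bernoulli_ineq (y : R) k : y <= 1 -> 1 - k%:R * y <= (1 - y) ^+ k.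
Proof.
move=> y1; elim: k => [|k IH]; first by rewrite mul0r subr0 expr0.
have [k0|k0] := lerP (k%:R * y) 1.
  rewrite exprS; apply: le_trans (ler_wpM2l _ IH); last by rewrite subr_ge0.
  rewrite -subr_ge0 (_ : _ - _ = k%:R * y ^+ 2); last by rewrite -natr1; ring.
  by rewrite mulr_ge0// sqr_ge0.
rewrite (@le_trans _ _ 0)// ?exprn_ge0 ?subr_ge0//.
rewrite subr_le0 -natr1 mulrDl mul1r (le_trans (ltW k0))// lerDl.
rewrite leNgt; apply/negP => y0; have := mulr_ge0_le0 (ler0n R k) (ltW y0); lra.
Qed.

(* Tends to the indicator of [x > 1/2] on [0, 1] and is a polynomial in [x]. *)
Definition soft_step (m : nat) (x : R) : R := (1 - (1 - x ^+ m) ^+ (2 ^ m)) ^+ m.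

Lemma soft_step_itv m (x : R) : 0 <= x <= 1 -> 0 <= soft_step m x <= 1.
Proof.
move=> /andP[x0 x1]; rewrite /soft_step.
have h : 0 <= 1 - x ^+ m <= 1.
  by rewrite subr_ge0 exprn_ile1//= gerBl exprn_ge0.
have {}h : 0 <= 1 - (1 - x ^+ m) ^+ (2 ^ m) <= 1.
  move: h => /andP[h0 h1]; by rewrite subr_ge0 exprn_ile1//= gerBl exprn_ge0.
by move: h => /andP[h0 h1]; rewrite exprn_ge0// exprn_ile1.
Qed.

(** The inner function (1 - x^m)^(2^m) is the one of the elementary proof of the Stone-Weierstrass
    theorem: it tends to 1 below 1/2 and to 0 above. At x = 1/2 it tends to 1/e, and the outer power
    [m] is what forces the limit 0 there too. *)
Lemma soft_step_cvg (x : R) : 0 <= x <= 1 ->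
  soft_step ^~ x @ \oo --> ((2^-1 < x)%R%:R : R).
Proof.
move=> x01; have /andP[x0 x1] := x01.
have [xl|xg] := lerP x 2^-1.
  apply: (@squeeze_cvgr _ _ _ _ (fun=> 0) (fun m => (3 / 4) ^+ m)); last first.
  - by apply: cvg_expr; rewrite ger0_norm//; lra.
  - exact: cvg_cst.
  exists 1%N => // -[//|m] _ /=; have /andP[-> _] /= := soft_step_itv m.+1 x01.
  rewrite /soft_step ler_pXn2r// ?nnegrE//; last first.
    by rewrite subr_ge0 exprn_ile1// ?subr_ge0 ?exprn_ile1// ?gerBl ?exprn_ge0.
  suff h : 4^-1 <= (1 - x ^+ m.+1) ^+ (2 ^ m.+1) by lra.
  pose y : R := (2^-1) ^+ m.+1.
  have xy : x ^+ m.+1 <= y by apply: lerXn2r; rewrite ?nnegrE ?invr_ge0.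
  have y1 : y <= 1 by rewrite exprn_ile1// ?invr_ge0//; lra.
  apply: (@le_trans _ _ ((1 - y) ^+ (2 ^ m.+1))); last first.
    by rewrite lerXn2r ?nnegrE ?subr_ge0 ?lerB// ?exprn_ile1.
  (* Bernoulli with the full exponent would give the bound 0; with half of it the bound is 1/2, and
     squaring yields 1/4. *)
  rewrite expnSr exprM.
  have := @bernoulli_ineq y (2 ^ m) y1.
  have -> : (2 ^ m)%:R * y = 2^-1.
    by rewrite natrX /y exprS mulrCA -exprMn divff// expr1n mulr1.
  move=> h; have -> : 4^-1 = (2^-1) ^+ 2 :> R by field.
  by rewrite lerXn2r// ?nnegrE; lra.
(* Writing 2x = s^2 splits the growth (2x)^m into two factors s^m: one absorbs the [m] lost to
   Bernoulli, the other gives geometric convergence. *)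
pose s := Num.sqrt (2 * x).
have s1 : 1 < s by rewrite -[ltLHS]sqrtr1 ltr_sqrt; lra.
have ss : s ^+ 2 = 2 * x by rewrite sqr_sqrtr; lra.
have bnd m : 1 - (s - 1)^-1 * (s^-1) ^+ m <= soft_step m x <= 1.
  have /andP[_ ->] := soft_step_itv m x01; rewrite andbT.
  pose d := (1 - x ^+ m) ^+ (2 ^ m).
  have x1m : 0 <= 1 - x ^+ m by rewrite subr_ge0 exprn_ile1.
  have d1 : d <= 1 by rewrite exprn_ile1 ?gerBl ?exprn_ge0.
  rewrite (le_trans _ (bernoulli_ineq m d1))// lerB//.
  have sm : 0 < s ^+ m by rewrite exprn_gt0//; lra.
  (* By Bernoulli (1 + x^m)^(2^m) is at least (2x)^m, and (1 - x^m)(1 + x^m) <= 1. *)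
  have dm : d * (s ^+ m) ^+ 2 <= 1.
    rewrite -exprM mulnC exprM ss exprMn -natrX /d.
    have h : 1 + (2 ^ m)%:R * x ^+ m <= (1 + x ^+ m) ^+ (2 ^ m).
      by have := @bernoulli_ineq (- x ^+ m) (2 ^ m); rewrite !mulrN !opprK; apply; rewrite (@le_trans _ _ 0) ?oppr_le0 ?exprn_ge0.
    rewrite (@le_trans _ _ (((1 - x ^+ m) * (1 + x ^+ m)) ^+ (2 ^ m)))//.
      rewrite exprMn ler_wpM2l ?exprn_ge0//; apply: le_trans h; lra.
    rewrite exprn_ile1// ?mulr_ge0// ?addr_ge0 ?exprn_ge0//.
    rewrite -subr_sqr expr1n gerBl sqr_ge0//.
  have m1 : m%:R * (s - 1) <= s ^+ m.
    have h : 1 - m%:R * (1 - s) <= (1 - (1 - s)) ^+ m by apply: bernoulli_ineq; lra.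
    have e : 1 - (1 - s) = s by ring.
    by rewrite e in h; lra.
  have d0 : 0 <= d by exact: exprn_ge0.
  rewrite exprVn -invfM -div1r ler_pdivlMr ?mulr_gt0 ?subr_gt0//.
  apply: le_trans dm.
  have -> : m%:R * d * ((s - 1) * s ^+ m) = (d * s ^+ m) * (m%:R * (s - 1)) by ring.
  by rewrite (expr2 (s ^+ m)) (mulrA d) ler_wpM2l// mulr_ge0// ltW.
apply: (@squeeze_cvgr _ _ _ _ (fun m => 1 - (s - 1)^-1 * (s^-1) ^+ m) (fun=> 1)).
- by apply: nearW => m; exact: bnd.
- rewrite -[X in _ --> X]subr0; apply: cvgB; first exact: cvg_cst.
  rewrite -[X in _ --> X](mulr0 (s - 1)^-1); apply: cvgM; first exact: cvg_cst.
  by apply: cvg_expr; rewrite ger0_norm ?invf_lt1// ?invr_ge0; lra.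
- exact: cvg_cst.
Qed.

End real_lemmas.

Section dominated.
Context d (T : measurableType d) (R : realType) (mu : {measure set T -> \bar R}).

Lemma Rintegral_dominated_cvg (D : set T) (f_ : (T -> R)^nat) (f g : T -> R) :
  measurable D -> (forall k, measurable_fun D (f_ k)) ->
  (forall x, D x -> f_ ^~ x @ \oo --> f x) ->
  mu.-integrable D (EFin \o g) ->
  (forall k x, D x -> `|f_ k x| <= g x) ->
  mu.-integrable D (EFin \o f) /\
  \int[mu]_(x in D) f_ k x @[k --> \oo] --> \int[mu]_(x in D) f x.
Proof.
move=> mD mf_ cf ig fg.
have mf : measurable_fun D f by exact: (@measurable_fun_cvg _ _ _ _ f_).
have [||||| intf _ cvgf] :=
  @dominated_convergence _ _ _ mu D mD (fun k => EFin \o f_ k) (EFin \o f) (EFin \o g).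
- by move=> k; exact/measurable_EFinP.
- exact/measurable_EFinP.
- by apply: aeW => x Dx; apply: cvg_EFin; [exact: nearW|exact: cf].
- by [].
- by apply: aeW => x Dx k; rewrite /= lee_fin fg.
split => //; apply: fine_cvg; rewrite fineK//.
exact: integrable_fin_num.
Qed.

Lemma le_integrableR (D : set T) (f g : T -> R) : measurable D ->
  measurable_fun D f -> (forall x, D x -> `|f x| <= g x) ->
  mu.-integrable D (EFin \o g) -> mu.-integrable D (EFin \o f).
Proof.
move=> mD mf fg; apply: le_integrable => //; first exact/measurable_EFinP.
by move=> x Dx; rewrite /= lee_fin (le_trans (fg x Dx))// ler_norm.
Qed.

Lemma integrable_bounded (D : set T) (f : T -> R) (B : R) : measurable D ->
  (mu D < +oo)%E -> measurable_fun D f -> (forall x, D x -> `|f x| <= B) ->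
  mu.-integrable D (EFin \o f).
Proof.
move=> mD muD mf fB; apply: (@le_integrableR _ _ (cst B)) => //.
apply/integrableP; split; first exact/measurable_EFinP.
by rewrite /= integral_cst// lte_mul_pinfty.
Qed.

Lemma integrableRD (D : set T) (f g : T -> R) : measurable D ->
  mu.-integrable D (EFin \o f) -> mu.-integrable D (EFin \o g) ->
  mu.-integrable D (EFin \o (fun x => f x + g x)).
Proof. by move=> mD fi gi; exact: (integrableD mD fi gi). Qed.

Lemma integrableRB (D : set T) (f g : T -> R) : measurable D ->
  mu.-integrable D (EFin \o f) -> mu.-integrable D (EFin \o g) ->
  mu.-integrable D (EFin \o (fun x => f x - g x)).
Proof. by move=> mD fi gi; exact: (integrableB mD fi gi). Qed.

Lemma integrableRZ (D : set T) (c : R) (f : T -> R) : measurable D ->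
  mu.-integrable D (EFin \o f) -> mu.-integrable D (EFin \o (fun x => c * f x)).
Proof. by move=> mD fi; exact: (integrableZl mD c fi). Qed.

End dominated.

(** * Fourier uniqueness for finite measures *)

Section fourier_uniqueness.
Context {R : realType} {n : nat}.
Notation V := 'cV[R]_n.
Implicit Types (u v : V).

(** The phase [t] lets one constructor cover cosines, sines and constants, and keeps the class
    stable under products by the product-to-sum formula. Equality of Fourier transforms therefore
    extends to polynomials in such functions, in particular to [soft_step]. *)
Inductive trig_poly : (V -> R) -> Prop :=
| trig_cos a u t : trig_poly (fun v => a * cos (dot v u + t))
| trig_add f g : trig_poly f -> trig_poly g -> trig_poly (f \+ g).

Lemma trig_cst (a : R) : trig_poly (cst a).
Proof.
rewrite (_ : cst a = fun v => a * cos (dot v 0 + 0)); first exact: trig_cos.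
by apply/funext => v; rewrite dot0r addr0 cos0 mulr1.
Qed.

Lemma trig_scale a f : trig_poly f -> trig_poly (fun v => a * f v).
Proof.
elim=> [b u t|g h _ ig _ ih].
  by under eq_fun do rewrite mulrA; exact: trig_cos.
rewrite (_ : (fun v => _) = (fun v => a * g v) \+ (fun v => a * h v)); first exact: trig_add.
by apply/funext => v /=; rewrite mulrDr.
Qed.

Lemma trig_sub f g : trig_poly f -> trig_poly g -> trig_poly (f \- g).
Proof.
move=> tf tg; rewrite (_ : f \- g = f \+ (fun v => -1 * g v)).
  by apply: trig_add => //; exact: trig_scale.
by apply/funext => v /=; rewrite mulN1r.
Qed.

Lemma trig_mul f g : trig_poly f -> trig_poly g -> trig_poly (f \* g).
Proof.
move=> tf; elim=> [b w s|g1 g2 _ i1 _ i2]; last first.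
  rewrite (_ : _ \* _ = (f \* g1) \+ (f \* g2)); first exact: trig_add.
  by apply/funext => v /=; rewrite mulrDr.
elim: tf => [a u t|f1 f2 _ i1 _ i2]; last first.
  rewrite (_ : _ \* _ = (f1 \* (fun v => b * cos (dot v w + s))) \+
                        (f2 \* (fun v => b * cos (dot v w + s)))); first exact: trig_add.
  by apply/funext => v /=; rewrite mulrDl.
rewrite (_ : _ \* _ =
  (fun v => (a * b / 2) * cos (dot v (u + w) + (t + s))) \+
  (fun v => (a * b / 2) * cos (dot v (u - w) + (t - s)))).
  by apply: trig_add; exact: trig_cos.
apply/funext => v /=; rewrite dotDr dotBr.
set x := dot v u; set y := dot v w.
rewrite (_ : x + y + (t + s) = (x + t) + (y + s)); last by ring.
rewrite (_ : x - y + (t - s) = (x + t) - (y + s)); last by ring.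
by rewrite (cosD (x + t)) (cosB (x + t)); field.
Qed.

Lemma trig_exp f k : trig_poly f -> trig_poly (fun v => f v ^+ k).
Proof.
move=> tf; elim: k => [|k ik]; first by under eq_fun do rewrite expr0; exact: trig_cst.
by under eq_fun do rewrite exprS; exact: trig_mul.
Qed.

Lemma trig_prod I (r : seq I) (F : I -> V -> R) :
  (forall i, trig_poly (F i)) -> trig_poly (fun v => \prod_(i <- r) F i v).
Proof.
move=> tF; elim: r => [|i r ir]; first by under eq_fun do rewrite big_nil; exact: trig_cst.
by under eq_fun do rewrite big_cons; exact: trig_mul.
Qed.

Lemma trig_soft_step f k : trig_poly f -> trig_poly (fun v => soft_step k (f v)).
Proof.
move=> tf; apply: trig_exp; apply: (@trig_sub (cst 1)); first exact: trig_cst.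
apply: trig_exp; apply: (@trig_sub (cst 1)); first exact: trig_cst.
exact: trig_exp.
Qed.

Lemma measurable_trig f : trig_poly f -> measurable_fun setT f.
Proof.
elim=> [a u t|g h _ mg _ mh]; last exact: measurable_funD.
apply: measurable_funM => //; apply: measurableT_comp => //.
  by apply: continuous_measurable_fun; exact: continuous_cos.
by apply: measurable_funD => //; exact: measurable_dot.
Qed.

Lemma trig_bounded f : trig_poly f -> exists B, forall v, `|f v| <= B.
Proof.
elim=> [a u t|g h _ [B gB] _ [C hC]].
  by exists `|a| => v; rewrite normrM ler_piMr// cos_max.
by exists (B + C) => v; rewrite (le_trans (ler_normD _ _))// lerD.
Qed.

Variables nu1 nu2 : {measure set V -> \bar R}.
Hypothesis fin1 : (nu1 setT < +oo)%E.
Hypothesis fin2 : (nu2 setT < +oo)%E.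
Hypothesis eq_cos : forall u,
  \int[nu1]_v cos (dot v u) = \int[nu2]_v cos (dot v u).
Hypothesis eq_sin : forall u,
  \int[nu1]_v sin (dot v u) = \int[nu2]_v sin (dot v u).

Let mcos u : measurable_fun setT (fun v => cos (dot v u)).
Proof.
apply: measurableT_comp; last exact: measurable_dot.
by apply: continuous_measurable_fun; exact: continuous_cos.
Qed.

Let msin u : measurable_fun setT (fun v => sin (dot v u)).
Proof.
apply: measurableT_comp; last exact: measurable_dot.
by apply: continuous_measurable_fun; exact: continuous_sin.
Qed.

Lemma eq_trig f : trig_poly f -> \int[nu1]_v f v = \int[nu2]_v f v.
Proof.
have icos (nu : {measure set V -> \bar R}) u : (nu setT < +oo)%E ->
    nu.-integrable setT (EFin \o (fun v => cos (dot v u))).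
  by move=> fin; apply: (@integrable_bounded _ _ _ _ _ _ 1) => // v _; exact: cos_max.
have isin (nu : {measure set V -> \bar R}) u : (nu setT < +oo)%E ->
    nu.-integrable setT (EFin \o (fun v => sin (dot v u))).
  by move=> fin; apply: (@integrable_bounded _ _ _ _ _ _ 1) => // v _; exact: sin_max.
have itrig (nu : {measure set V -> \bar R}) g : (nu setT < +oo)%E -> trig_poly g ->
    nu.-integrable setT (EFin \o g).
  move=> fin tg; have [B gB] := trig_bounded tg.
  by apply: (@integrable_bounded _ _ _ _ _ _ B) => //; exact: measurable_trig.
elim=> [a u t|g h tg ig th ih]; last by rewrite !RintegralD ?ig ?ih//; exact: itrig.
have E (nu : {measure set V -> \bar R}) : (nu setT < +oo)%E ->
    \int[nu]_v (a * cos (dot v u + t)) =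
    a * cos t * \int[nu]_v cos (dot v u) - a * sin t * \int[nu]_v sin (dot v u).
  move=> fin; rewrite -!RintegralZl//; [|exact: isin|exact: icos].
  rewrite -RintegralB//; last 2 first.
  - by apply: (@integrableZl _ _ _ _ _ measurableT (a * cos t) (EFin \o _)); exact: icos.
  - by apply: (@integrableZl _ _ _ _ _ measurableT (a * sin t) (EFin \o _)); exact: isin.
  by apply: eq_Rintegral => v _; rewrite cosD; ring.
by rewrite !E// eq_cos eq_sin.
Qed.

Lemma eq_bounded_lim (f_ : (V -> R)^nat) (f : V -> R) :
  (forall k, measurable_fun setT (f_ k)) ->
  (forall k, \int[nu1]_v f_ k v = \int[nu2]_v f_ k v) ->
  (forall k v, `|f_ k v| <= 1) ->
  (forall v, f_ ^~ v @ \oo --> f v) ->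
  \int[nu1]_v f v = \int[nu2]_v f v.
Proof.
move=> mf ef f1 cf.
have [||_] := @Rintegral_dominated_cvg _ _ _ nu1 setT f_ f (cst 1) measurableT mf (fun x _ => cf x).
- by apply: (@integrable_bounded _ _ _ _ _ _ 1) => // v _; rewrite normr1.
- by move=> k x _; exact: f1.
move=> /cvg_lim <-//.
have [||_] := @Rintegral_dominated_cvg _ _ _ nu2 setT f_ f (cst 1) measurableT mf (fun x _ => cf x).
- by apply: (@integrable_bounded _ _ _ _ _ _ 1) => // v _; rewrite normr1.
- by move=> k x _; exact: f1.
move=> /cvg_lim <-//.
by rewrite (_ : (fun k => \int[nu1]_x f_ k x) = (fun k => \int[nu2]_x f_ k x))//; exact/funext.
Qed.

Definition orthant (b : 'I_n -> R) : set V := [set v | forall i, b i < v i 0].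

(** For large [k] the argument lies in ]-2, 2[, where the sine has the sign of its argument. This
    removes the periodicity that keeps a single trigonometric function from detecting a
    half-space. *)
Lemma sin_small_gt0 (x : R) : \forall k \near \oo, ((0 < sin (x / k.+1%:R)) = (0 < x))%R.
Proof.
near=> k.
have k0 : 0 < k.+1%:R :> R by [].
have h : `|x / k.+1%:R| < 2.
  rewrite normrM normfV (gtr0_norm k0) ltr_pdivrMr//.
  have : `|x| < k.+1%:R.
    near: k; have [N _ HN] := @nbhs_infty_gtr R `|x|.
    by exists N => // k /= Nk; rewrite (lt_le_trans (HN k Nk))// ler_nat.
  lra.
have [x0|x0] := ltrP 0 x.
  by apply: sin2_gt0; rewrite divr_gt0//= (le_lt_trans (ler_norm _) h).
apply/negbTE; rewrite -leNgt -oppr_ge0 -sinN.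
have [->|xN0] := eqVneq x 0; first by rewrite mul0r oppr0 sin0.
have xl : x < 0 by rewrite lt_neqAle xN0.
apply/ltW/sin2_gt0; rewrite -mulNr divr_gt0 ?oppr_gt0//=.
by rewrite mulNr (le_lt_trans (ler_norm _))// normrN.
Unshelve. all: by end_near. Qed.

(** A sine rescaled to [0, 1]: it exceeds 1/2, the threshold of [soft_step], exactly where the sine
    is positive. *)
Let angle b k (i : 'I_n) v : R := (1 + sin ((v i 0 - b i) / k.+1%:R)) / 2.

Let angle01 b k i v : 0 <= angle b k i v <= 1.
Proof.
rewrite /angle; set x := sin _.
have h1 : -1 <= x by exact: sin_geN1.
have h2 : x <= 1 by exact: sin_le1.
by apply/andP; split; lra.
Qed.

Let trig_angle b k i : trig_poly (angle b k i).
Proof.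
rewrite (_ : angle b k i = cst 2^-1 \+ (fun v => 2^-1 *
   cos (dot v (k.+1%:R^-1 *: delta_mx i 0) + (- (b i / k.+1%:R) - pi / 2)))).
  by apply: trig_add; [exact: trig_cst|exact: trig_cos].
apply/funext => v; rewrite /angle /= addrA cosBpihalf dotZr dot_delta.
rewrite (_ : (v i 0 - b i) / _ = k.+1%:R^-1 * v i 0 - b i / k.+1%:R); first by field.
by ring.
Qed.

(** Two limits in succession: [soft_step] sharpens a trigonometric product into a periodic
    indicator, then a growing period turns that into the indicator of the orthant. All functions are
    bounded by 1, an integrable constant for finite measures. *)
Lemma eq_orthant b : nu1 (orthant b) = nu2 (orthant b).
Proof.
pose ind_k k v : R := \prod_i (2^-1 < angle b k i v)%R%:R.
have prod01 (F : 'I_n -> R) : (forall i, 0 <= F i <= 1) -> `|\prod_i F i| <= 1.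
  move=> F01; rewrite ger0_norm; first by apply: prodr_ile1 => i _.
  by apply: prodr_ge0 => i _; have /andP[] := F01 i.
have cvg_prod (F : nat -> 'I_n -> R) (G : 'I_n -> R) :
    (forall i, F ^~ i @ \oo --> G i) -> \prod_i F k i @[k --> \oo] --> \prod_i G i.
  move=> FG; elim: (index_enum _) => [|i r ir].
    by under eq_fun do rewrite big_nil; rewrite big_nil; exact: cvg_cst.
  by under eq_fun do rewrite big_cons; rewrite big_cons; exact: cvgM.
have cvg_soft k v : \prod_i soft_step m (angle b k i v) @[m --> \oo] --> ind_k k v.
  by apply: cvg_prod => i; apply: soft_step_cvg.
have msoft k m : measurable_fun setT (fun v => \prod_i soft_step m (angle b k i v)).
  by apply: measurable_trig; apply: trig_prod => i; exact: trig_soft_step.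
have e1 k : \int[nu1]_v ind_k k v = \int[nu2]_v ind_k k v.
  apply: (@eq_bounded_lim (fun m v => \prod_i soft_step m (angle b k i v))) => //.
  - by move=> m; apply: eq_trig; apply: trig_prod => i; exact: trig_soft_step.
  - by move=> m v; apply: prod01 => i; exact: soft_step_itv.
have mo : measurable (orthant b).
  rewrite (_ : orthant b = \bigcap_(i : 'I_n) ((fun v : V => v i 0) @^-1` `]b i, +oo[)).
    apply: fin_bigcap_measurable => // i _; rewrite -[X in measurable X]setTI.
    exact: measurable_coord.
  apply/seteqP; split => v h i /=; first by move=> _; rewrite in_itv/= andbT.
  by have := h i I; rewrite /= in_itv/= andbT.
have e2 : \int[nu1]_v \1_(orthant b) v = \int[nu2]_v \1_(orthant b) v.
  apply: (@eq_bounded_lim ind_k) => //.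
  - by move=> k; apply: (measurable_fun_cvg (msoft k)) => v _.
  - by move=> k v; apply: prod01 => i; case: (_ < _); rewrite ?ler01 ?lexx.
  move=> v; rewrite (_ : \1_(orthant b) v = \prod_i (b i < v i 0)%R%:R); last first.
    rewrite indicE; case: (boolP (v \in _)); rewrite ?inE => vo.
      by rewrite big1// => i _; rewrite vo.
    move/negP : vo; rewrite inE => /existsNP[i /negP bi].
    by rewrite (bigD1 i)//= (negbTE bi) mul0r.
  apply: cvg_prod => i; apply: cvg_near_cst.
  apply: filterS (sin_small_gt0 (v i 0 - b i)) => k h.
  rewrite subr_gt0 in h; rewrite -h /angle; congr (_%:R); congr nat_of_bool.
  by apply/idP/idP => ?; lra.
have fe (nu : {measure set V -> \bar R}) : (nu setT < +oo)%E ->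
    (\int[nu]_v \1_(orthant b) v)%:E = nu (orthant b).
  move=> fin; rewrite /Rintegral integral_indic// setIT fineK//.
  by rewrite ge0_fin_numE// (le_lt_trans _ fin)// le_measure ?inE.
by rewrite -!fe// e2.
Qed.

Lemma finite_measure_fourier_unique E : measurable E -> nu1 E = nu2 E.
Proof.
pose G := range orthant.
(* A coordinate half-space is the union of orthants whose other bounds tend to minus infinity, so
   orthants generate the Borel sets; they are also stable under intersection. *)
have mG : (@measurable _ V) = <<s G >>.
  apply/seteqP; split => [A mA|]; last first.
    apply: smallest_sub; first exact: sigma_algebra_measurable.
    move=> _ [b _ <-].
    rewrite (_ : orthant b = \bigcap_(i : 'I_n) ((fun v : V => v i 0) @^-1` `]b i, +oo[)).
      apply: fin_bigcap_measurable => // i _; rewrite -[X in measurable X]setTI.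
      exact: measurable_coord.
    apply/seteqP; split => v h i /=; first by move=> _; rewrite in_itv/= andbT.
    by have := h i I; rewrite /= in_itv/= andbT.
  have mid : measurable_fun setT (fun v : g_sigma_algebraType G => (v : V)).
    apply: measurable_mxP => i j; rewrite ord1.
    apply: (measurability _ (RGenOInfty.measurableE R)) => _ [_ [a ->] <-].
    rewrite setTI.
    rewrite (_ : _ @^-1` _ = \bigcup_k orthant (fun l => if l == i then a else - k%:R)).
      by apply: bigcupT_measurable => k; apply: sub_sigma_algebra; exists (fun l => if l == i then a else - k%:R).
    apply/seteqP; split => v /=; rewrite in_itv/= andbT.
      move=> av.
      have [N _ HN] := @nbhs_infty_gtr R (enorm v).
      exists N => // l; case: eqP => [->//|_].
      by have := HN N (leqnn N); have := coord_le_enorm v l; rewrite ler_norml; lra.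
    by move=> [k _ /(_ i)]; rewrite eqxx.
  by have := mid measurableT A mA; rewrite setTI.
apply: (@measure_unique _ _ V G (fun k => orthant (fun=> - k%:R))) => //.
- move=> _ _ [b _ <-] [c _ <-]; exists (fun i => Num.max (b i) (c i)) => //.
  apply/seteqP; split => v /=.
    by move=> h; split => i; have := h i; rewrite gt_max => /andP[].
  by move=> [h1 h2] i; rewrite gt_max h1 h2.
- by move=> k; exists (fun=> - k%:R).
- apply/seteqP; split => // v _.
  have [N _ HN] := @nbhs_infty_gtr R (enorm v).
  exists N => // l.
  by have := HN N (leqnn N); have := coord_le_enorm v l; rewrite ler_norml; lra.
- by move=> _ [b _ <-]; exact: eq_orthant.
- move=> k; rewrite (le_lt_trans _ fin1)// le_measure ?inE//.
  by rewrite mG; apply: sub_sigma_algebra; exists (fun=> - k%:R).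
Qed.

End fourier_uniqueness.

(** * Integration against a measure with a density *)

Section density.
Context d (T : measurableType d) (R : realType).
Variables (mu : {measure set T -> \bar R}) (h : T -> R).
Hypothesis mh : measurable_fun setT h.
Hypothesis h0 : forall x, 0 <= h x.

(* The hypotheses are arguments so that the measure structure can be inferred. *)
Definition density_measure of measurable_fun setT h & (forall x, 0 <= h x) :=
  fun E : set T => (\int[mu]_(x in E) (h x)%:E)%E.

Notation dm := (density_measure mh h0).

Let dm0 : dm set0 = 0%E.
Proof. exact: integral_set0. Qed.

Let dm_ge0 E : (0 <= dm E)%E.
Proof. by apply: integral_ge0 => x _; rewrite lee_fin. Qed.

Let dm_sigma_additive : semi_sigma_additive dm.
Proof.
move=> F mF tF mUF; rewrite /density_measure ge0_integral_bigcup//; last 2 first.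
- by apply: measurable_funTS; exact/measurable_EFinP.
- by move=> x _; rewrite lee_fin.
by apply: is_cvg_ereal_nneg_natsum_cond => k _ _; exact: dm_ge0.
Qed.

HB.instance Definition _ := isMeasure.Build _ _ _ dm dm0 dm_ge0 dm_sigma_additive.

Import HBNNSimple.

Lemma ge0_integral_density (f : T -> \bar R) : measurable_fun setT f ->
  (forall x, 0 <= f x)%E -> (\int[dm]_x f x = \int[mu]_x (f x * (h x)%:E))%E.
Proof.
move=> mf f0; pose f_ := nnsfun_approx measurableT mf.
have mhE : measurable_fun setT (EFin \o h) by exact/measurable_EFinP.
transitivity (limn (fun k => \int[dm]_x (f_ k x)%:E))%E.
  rewrite -monotone_convergence//.
  - apply: eq_integral => y _; apply/esym/cvg_lim => //.
    by apply: cvg_nnsfun_approx => // *; apply: f0.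
  - by move=> k; exact/measurable_EFinP/measurable_funP.
  - by move=> k y _; rewrite lee_fin.
  - by move=> y _ k l kl; rewrite lee_fin; exact/lefP/nd_nnsfun_approx.
rewrite [X in limn X](_ : _ =
    (fun k => \int[mu]_x ((f_ k x)%:E * (h x)%:E))%E); last first.
  apply/funext => k.
  transitivity (\sum_(r \in range (f_ k)) r%:E * dm (f_ k @^-1` [set r]))%E.
    under eq_integral do rewrite fimfunE -fsumEFin//.
    rewrite ge0_integral_fsum//; last 2 first.
    - by move=> y; exact/measurable_EFinP/measurable_funM.
    - by move=> y x _; rewrite nnfun_muleindic_ge0.
    apply: eq_fsbigr => r _; rewrite integralZl_indic_nnsfun// integral_indic//=.
    by rewrite setIT.
  transitivity (\int[mu]_x (\sum_(r \in range (f_ k))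
      ((r * \1_(f_ k @^-1` [set r]) x)%:E * (h x)%:E)))%E; last first.
    apply: eq_integral => x _; rewrite -ge0_mule_fsuml; last first.
      by move=> r; rewrite nnfun_muleindic_ge0.
    by rewrite [in RHS]fimfunE -fsumEFin.
  rewrite ge0_integral_fsum//; last 2 first.
  - move=> r; apply: emeasurable_funM => //.
    by apply/measurable_EFinP/measurable_funM => //; exact: measurable_indic.
  - by move=> r x _; rewrite mule_ge0 ?nnfun_muleindic_ge0 ?lee_fin.
  apply: eq_fsbigr => r; rewrite inE => -[z _ zr].
  have r0 : (0 <= r%:E)%E by rewrite lee_fin -zr.
  rewrite /density_measure integral_mkcond -ge0_integralZl//; last 2 first.
  - have mE : measurable (f_ k @^-1` [set r]) by exact: measurable_sfunP.
    exact: (measurable_restrictT _ mE).1 (measurable_funTS mhE).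
  - by move=> x _; rewrite /patch; case: ifP; rewrite ?lee_fin.
  apply: eq_integral => x _; rewrite EFinM -muleA; congr (_ * _)%E.
  by rewrite /patch /= indicE; case: (_ \in _); rewrite ?mul1e ?mul0e.
rewrite -monotone_convergence//.
- apply: eq_integral => x _; apply/cvg_lim => //.
  apply: cvgeZr; first by [].
  by apply: cvg_nnsfun_approx => // *; apply: f0.
- by move=> k; apply: emeasurable_funM => //; exact/measurable_EFinP/measurable_funP.
- by move=> k x _; rewrite mule_ge0// lee_fin.
- move=> x _ k l kl; apply: lee_wpmul2r; rewrite lee_fin//.
  exact/lefP/nd_nnsfun_approx.
Qed.

Lemma Rintegral_density (f : T -> R) : measurable_fun setT f ->
  \int[dm]_x f x = \int[mu]_x (f x * h x).
Proof.
move=> mf; have mfE : measurable_fun setT (EFin \o f) by exact/measurable_EFinP.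
rewrite /Rintegral integralE [in RHS]integralE.
have -> : (\int[dm]_x (EFin \o f)^\+ x =
    \int[mu]_x (fun x => (f x * h x)%:E)^\+ x)%E.
  rewrite ge0_integral_density//; last exact: measurable_funepos.
  apply: eq_integral => x _; rewrite !funeposE /= EFinM maxe_pMl ?mul0e//.
  by rewrite lee_fin.
have -> : (\int[dm]_x (EFin \o f)^\- x =
    \int[mu]_x (fun x => (f x * h x)%:E)^\- x)%E.
  rewrite ge0_integral_density//; last exact: measurable_funeneg.
  apply: eq_integral => x _; rewrite !funenegE /= -mulNr EFinM maxe_pMl ?mul0e// ?lee_fin//.
by [].
Qed.

End density.

(** * Elementary trigonometric estimates *)

Section sine_bounds.
Context {R : realType}.
Implicit Types x y : R.

Lemma norm_sin_le x : `|sin x| <= `|x|.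
Proof.
wlog x0 : x / 0 <= x => [h|].
  have [/h//|x0] := lerP 0 x.
  by rewrite -[leLHS]normrN -sinN -[leRHS]normrN h// oppr_ge0 ltW.
have [|c _] := @MVT_segment R sin cos 0 x x0 (fun y _ => is_derive_sin y).
  by apply: continuous_subspaceT; exact: continuous_sin.
by rewrite sin0 !subr0 => ->; rewrite normrM ler_piMl// cos_max.
Qed.

Lemma cosB1_half x : 1 - cos x = 2 * sin (x / 2) ^+ 2.
Proof.
have {1}-> : x = (x / 2) *+ 2 by rewrite mulr2n -splitr.
by rewrite cos_mulr2n cos2sin2; ring.
Qed.

Lemma cosB1_ge0 x : 0 <= 1 - cos x.
Proof. by rewrite subr_ge0 cos_le1. Qed.

Lemma cosB1_le2 x : 1 - cos x <= 2.
Proof. by have := cos_geN1 x; lra. Qed.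

Lemma cosB1_le x : 1 - cos x <= x ^+ 2 / 2.
Proof.
rewrite cosB1_half.
have h : sin (x / 2) ^+ 2 <= (x / 2) ^+ 2.
  rewrite -[leLHS]real_normK ?num_real// -[leRHS]real_normK ?num_real//.
  by rewrite ler_pXn2r ?nnegrE ?norm_sin_le.
apply: le_trans (_ : 2 * (x / 2) ^+ 2 <= _); first by rewrite ler_pM2l.
by rewrite le_eqVlt; apply/orP; left; apply/eqP; field.
Qed.

Lemma cosB1_le_norm x : 1 - cos x <= `|x|.
Proof.
have [x2|x2] := lerP `|x| 2.
  apply: le_trans (cosB1_le x) _; rewrite -real_normK ?num_real// expr2 -mulrA.
  by rewrite ler_piMr// ler_pdivrMr// mul1r.
exact: le_trans (cosB1_le2 x) (ltW x2).
Qed.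

(** Mean value theorem, with 1 - cos c <= |c|. Second order in [x] is the order that a Levy measure
    integrates near 0. *)
Lemma sinB_le x : `|sin x - x| <= x ^+ 2.
Proof.
wlog x0 : x / 0 <= x => [h|].
  have [/h//|x0] := lerP 0 x.
  have -> : sin x - x = - (sin (- x) - (- x)) by rewrite sinN; ring.
  by rewrite normrN -sqrrN h// oppr_ge0 ltW.
have D y : is_derive y 1 (fun z => sin z - z) (cos y - 1).
  exact: is_deriveB.
have [|c /[!in_itv]/= /andP[c0 cx]] := @MVT_segment R (fun z => sin z - z) (fun y => cos y - 1) 0 x x0.
  by apply: continuous_subspaceT => y; apply: cvgB; [exact: continuous_sin|exact: cvg_id].
rewrite sin0 !subr0 => ->; rewrite normrM distrC expr2 (ger0_norm x0) ler_wpM2r//.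
rewrite ger0_norm ?cosB1_ge0// (le_trans (cosB1_le_norm c))// ger0_norm//.
Qed.

End sine_bounds.

(** * Uniqueness of the Levy-Khintchine triple *)

Section levy_kernel.
Context {R : realType} {n : nat}.
Notation V := 'cV[R]_n.
Implicit Types (u v w : V).

(** Comparable to min(1, |v|^2); integrability against a Levy measure is mostly obtained by
    domination by a multiple of it. *)
Definition lkern v : R := enorm v ^+ 2 / (1 + enorm v ^+ 2).
Definition lphi v : R := (1 + enorm v ^+ 2)^-1.
Definition eta_re u v : R := cos (dot v u) - 1.
Definition eta_im u v : R := sin (dot v u) - dot v u * lphi v.

Let den_gt0 v : 0 < 1 + enorm v ^+ 2.
Proof. by rewrite ltr_pwDl// sqr_ge0. Qed.

Lemma lphi_gt0 v : 0 < lphi v. Proof. by rewrite invr_gt0. Qed.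

Lemma lphi_le1 v : lphi v <= 1.
Proof. by rewrite invf_le1// lerDl sqr_ge0. Qed.

Lemma lkernE v : lkern v = 1 - lphi v.
Proof. by rewrite /lkern /lphi; field; rewrite gt_eqF. Qed.

Lemma lkern_ge0 v : 0 <= lkern v.
Proof. by rewrite lkernE subr_ge0 lphi_le1. Qed.

Lemma lkern_le1 v : lkern v <= 1.
Proof. by rewrite lkernE gerBl ltW// lphi_gt0. Qed.

Lemma lkern_small v : enorm v <= 1 -> enorm v ^+ 2 <= 2 * lkern v.
Proof.
move=> v1; rewrite /lkern mulrA ler_pdivlMr// mulrC ler_wpM2r ?sqr_ge0//.
by have := exprn_ile1 2 (enorm_ge0 v) v1; lra.
Qed.

Lemma lkern_big v : 1 <= enorm v -> 1 <= 2 * lkern v.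
Proof.
move=> v1; rewrite /lkern mulrA ler_pdivlMr// mul1r.
by have := exprn_ege1 2 v1; lra.
Qed.

Lemma enorm_lphi_big v : 1 <= enorm v -> enorm v * lphi v <= lkern v.
Proof.
move=> v1; rewrite /lphi /lkern ler_pM2r ?invr_gt0// expr2 ler_peMl//.
by rewrite (le_trans _ v1).
Qed.

Lemma measurable_lphi : measurable_fun [set: V] lphi.
Proof.
have mg : measurable_fun setT (fun x : R => (1 + x ^+ 2)^-1).
  apply: continuous_measurable_fun => x; apply: cvgV.
    by rewrite gt_eqF// ltr_pwDl// sqr_ge0.
  by apply: cvgD; [exact: cvg_cst|exact: exprn_continuous].
exact: (measurableT_comp mg measurable_enorm).
Qed.

Lemma measurable_lkern : measurable_fun [set: V] lkern.
Proof.
apply: (eq_measurable_fun (fun v => 1 - lphi v)); first by move=> v _; rewrite lkernE.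
by apply: measurable_funB => //; exact: measurable_lphi.
Qed.

(** Taylor estimates inside the unit ball, boundedness outside, where [lkern] is at least 1/2. The
    constant is generous so that the same one serves [eta_im]. *)
Lemma eta_re_le u v : `|eta_re u v| <= (5 + 3 * enorm u ^+ 2) * lkern v.
Proof.
have k0 := lkern_ge0 v.
have p0 : 0 <= enorm u ^+ 2 * lkern v by rewrite mulr_ge0// sqr_ge0.
rewrite /eta_re distrC ger0_norm ?cosB1_ge0//.
have [v1|/ltW v1] := lerP (enorm v) 1; last first.
  apply: le_trans (cosB1_le2 _) _; have := lkern_big v1; lra.
apply: le_trans (cosB1_le _) _.
have h : dot v u ^+ 2 <= enorm u ^+ 2 * (2 * lkern v).
  rewrite (le_trans (dot_sqr_le v u))// -!enorm_sq mulrC.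
  by rewrite ler_wpM2l ?sqr_ge0// lkern_small.
lra.
Qed.

Lemma eta_im_le u v : `|eta_im u v| <= (5 + 3 * enorm u ^+ 2) * lkern v.
Proof.
have k0 := lkern_ge0 v.
have p0 : 0 <= enorm u ^+ 2 * lkern v by rewrite mulr_ge0// sqr_ge0.
have p1 : enorm u * lkern v <= (1 + enorm u ^+ 2) * lkern v.
  by rewrite ler_wpM2r//; have := sqr_ge0 (enorm u - 2^-1); lra.
have xle := cauchy_schwarz v u.
have [v1|/ltW v1] := lerP (enorm v) 1; last first.
  apply: le_trans (ler_normB _ _) _.
  have h : `|dot v u * lphi v| <= enorm u * lkern v.
    rewrite normrM (gtr0_norm (lphi_gt0 v)).
    rewrite (le_trans (ler_wpM2r (ltW (lphi_gt0 v)) xle))// mulrAC mulrC.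
    by rewrite ler_wpM2l ?enorm_ge0// enorm_lphi_big.
  have := sin_max (dot v u); have := lkern_big v1; lra.
have -> : eta_im u v = (sin (dot v u) - dot v u) + dot v u * lkern v.
  by rewrite /eta_im lkernE; ring.
apply: le_trans (ler_normD _ _) _.
have h : dot v u ^+ 2 <= enorm u ^+ 2 * (2 * lkern v).
  rewrite (le_trans (dot_sqr_le v u))// -!enorm_sq mulrC.
  by rewrite ler_wpM2l ?sqr_ge0// lkern_small.
have h2 : `|dot v u * lkern v| <= enorm u * lkern v.
  rewrite normrM (ger0_norm k0) ler_wpM2r// (le_trans xle)//.
  by rewrite ler_piMl ?enorm_ge0.
have := sinB_le (dot v u); lra.
Qed.

Lemma measurable_eta_re u : measurable_fun [set: V] (eta_re u).
Proof.
apply: measurable_funB => //; apply: measurableT_comp; last exact: measurable_dot.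
by apply: continuous_measurable_fun; exact: continuous_cos.
Qed.

Lemma measurable_eta_im u : measurable_fun [set: V] (eta_im u).
Proof.
apply: measurable_funB.
  apply: measurableT_comp; last exact: measurable_dot.
  by apply: continuous_measurable_fun; exact: continuous_sin.
by apply: measurable_funM; [exact: measurable_dot|exact: measurable_lphi].
Qed.

Lemma lkern0 : lkern 0 = 0.
Proof. by rewrite /lkern enorm0 expr0n mul0r. Qed.

Lemma eta_re0 u : eta_re u 0 = 0.
Proof. by rewrite /eta_re dot0l cos0 subrr. Qed.

Lemma eta_im0 u : eta_im u 0 = 0.
Proof. by rewrite /eta_im dot0l sin0 mul0r subrr. Qed.

Section levy_measures.
Variable M : {measure set V -> \bar R}.

(** The integrands vanish at 0, so integrals over [V0] can be taken over all of [V] and no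
    restriction has to be carried along. *)
Lemma integral_V0 (f : V -> \bar R) : f 0 = 0%E ->
  (\int[M]_(v in V0) f v = \int[M]_v f v)%E.
Proof.
move=> f0; rewrite integral_mkcond; apply: eq_integral => v _.
rewrite /patch; case: ifPn => // /negP; rewrite inE /V0 /= => /contrapT ->.
by rewrite f0.
Qed.

Lemma Rintegral_V0 (f : V -> R) : f 0 = 0 ->
  \int[M]_(v in V0) f v = \int[M]_v f v.
Proof. by move=> f0; rewrite /Rintegral integral_V0// f0. Qed.

Lemma levy_measureP : levy_measure M <->
  M [set 0] = 0%E /\ M.-integrable setT (EFin \o lkern).
Proof.
have mk : measurable_fun [set: V] (EFin \o lkern).
  by apply/measurable_EFinP; exact: measurable_lkern.
rewrite /levy_measure integral_V0 ?enorm0 ?expr0n ?mul0r//.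
split=> -[M0 Mi]; split => //.
  apply/integrableP; split => //; apply: le_lt_trans Mi.
  rewrite le_eqVlt; apply/orP; left; apply/eqP; apply: eq_integral => v _.
  by rewrite gee0_abs// lee_fin lkern_ge0.
have /integrableP[_] := Mi; apply: le_lt_trans.
rewrite le_eqVlt; apply/orP; left; apply/eqP; apply: eq_integral => v _.
by rewrite gee0_abs// lee_fin lkern_ge0.
Qed.

Hypothesis lM : levy_measure M.

Lemma integrable_lkern c : M.-integrable setT (EFin \o (fun v => c * lkern v)).
Proof.
have [_ h] := levy_measureP.1 lM.
exact: (integrableZl measurableT c h).
Qed.

Lemma integrable_le_lkern c (f : V -> R) : measurable_fun setT f ->
  (forall v, `|f v| <= c * lkern v) -> M.-integrable setT (EFin \o f).
Proof.
move=> mf fk; apply: (@le_integrableR _ _ _ _ setT f (fun v => c * lkern v)) => //.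
exact: integrable_lkern.
Qed.

Lemma integrable_eta_re u : M.-integrable setT (EFin \o eta_re u).
Proof.
apply: integrable_le_lkern; [exact: measurable_eta_re|exact: eta_re_le].
Qed.

Lemma integrable_eta_im u : M.-integrable setT (EFin \o eta_im u).
Proof.
apply: integrable_le_lkern; [exact: measurable_eta_im|exact: eta_im_le].
Qed.

End levy_measures.

Definition lk_re (D : 'M[R]_n) (M : {measure set V -> \bar R}) u : R :=
  \int[M]_v eta_re u v - 2^-1 * dot (D *m u) u.

Definition lk_im (m : V) (M : {measure set V -> \bar R}) u : R :=
  dot m u + \int[M]_v eta_im u v.

Local Open Scope complex_scope.

Lemma cexpE (x y : R) : cexp (x +i* y) = (expR x * cos y) +i* (expR x * sin y).
Proof. by rewrite /cexp /=; apply/eqP; rewrite eq_complex /= !mul0r subr0 addr0 !eqxx. Qed.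

Lemma mulI_real (x : R) : 'i * x%:C = 0 +i* x.
Proof.
rewrite -complexiE; apply/eqP; rewrite eq_complex /=.
by apply/andP; split; apply/eqP; ring.
Qed.

Lemma charfunE (mu : probability V R) u :
  charfun mu u = (\int[mu]_v cos (dot v u)) +i* (\int[mu]_v sin (dot v u)).
Proof.
rewrite /charfun /cintegral; congr (_ +i* _);
  by apply: eq_Rintegral => v _; rewrite mulI_real cexpE /= expR0 mul1r.
Qed.

(** Separates real and imaginary parts once and for all; complex numbers do not occur afterwards. *)
Lemma levy_khintchineE (mu : probability V R) m D (M : {measure set V -> \bar R}) :
  levy_khintchine mu m D M <->
  [/\ nonneg_operator D, levy_measure M &
    forall u,
      \int[mu]_v cos (dot v u) = expR (lk_re D M u) * cos (lk_im m M u) /\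
      \int[mu]_v sin (dot v u) = expR (lk_re D M u) * sin (lk_im m M u)].
Proof.
have E u : cexp ('i * (dot m u)%:C - (2^-1 * dot (D *m u) u)%:C
           + cintegral M V0 (fun v => cexp ('i * (dot v u)%:C) - 1
                - 'i * (dot v u)%:C / (1 + enorm v ^+ 2)%:C)) =
    (expR (lk_re D M u) * cos (lk_im m M u)) +i* (expR (lk_re D M u) * sin (lk_im m M u)).
  have -> : cintegral M V0 (fun v => cexp ('i * (dot v u)%:C) - 1
                - 'i * (dot v u)%:C / (1 + enorm v ^+ 2)%:C) =
      (\int[M]_v eta_re u v) +i* (\int[M]_v eta_im u v).
    have F v : cexp ('i * (dot v u)%:C) - 1 - 'i * (dot v u)%:C / (1 + enorm v ^+ 2)%:C
        = eta_re u v +i* eta_im u v.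
      rewrite mulI_real cexpE expR0 !mul1r -fmorphV; apply/eqP.
      by rewrite eq_complex /eta_re /eta_im /lphi /=; apply/andP; split; apply/eqP; ring.
    rewrite /cintegral -!Rintegral_V0 ?eta_re0 ?eta_im0//; congr (_ +i* _);
      by apply: eq_Rintegral => v _; rewrite F.
  rewrite mulI_real -cexpE; congr cexp; apply/eqP.
  by rewrite eq_complex /= /lk_re /lk_im; apply/andP; split; apply/eqP; ring.
split=> -[Dn lM h]; split => // u.
  by have := h u; rewrite charfunE E => -[-> ->].
by rewrite charfunE E; have [-> ->] := h u.
Qed.

End levy_kernel.

Section measure_scale.
Context d (T : measurableType d) (R : realType) (mu : {measure set T -> \bar R}).

Lemma integrable_mscale (k : {nonneg R}) (f : T -> R) :
  mu.-integrable setT (EFin \o f) -> (mscale k mu).-integrable setT (EFin \o f).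
Proof.
move=> /integrableP[mf fi]; apply/integrableP; split => //.
rewrite ge0_integral_mscale//; last exact: measurableT_comp.
by rewrite lte_mul_pinfty.
Qed.

Lemma Rintegral_mscale (k : {nonneg R}) (f : T -> R) :
  mu.-integrable setT (EFin \o f) ->
  \int[mscale k mu]_x f x = k%:num * \int[mu]_x f x.
Proof.
move=> fi; have mf := measurable_int _ fi.
rewrite /Rintegral integralE [in RHS]integralE.
rewrite ge0_integral_mscale//; last exact: measurable_funepos.
rewrite ge0_integral_mscale//; last exact: measurable_funeneg.
have fp := integrable_pos_fin_num measurableT fi.
have fn := integrable_neg_fin_num measurableT fi.
by rewrite [LHS]fineB ?fin_numM// !fineM// [X in _ = _ * X]fineB// mulrBr.
Qed.

Lemma Rintegral_add (nu : {measure set T -> \bar R}) (f : T -> R) :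
  mu.-integrable setT (EFin \o f) -> nu.-integrable setT (EFin \o f) ->
  \int[measure_add mu nu]_x f x = \int[mu]_x f x + \int[nu]_x f x.
Proof.
move=> fi gi; rewrite /Rintegral integral_measure_add//.
by rewrite fineD//; exact: integrable_fin_num.
Qed.

End measure_scale.

(** The inverse is discontinuous at 0; it is the pointwise limit of the continuous functions y /
    (y^2 + 1/k), which also vanish at 0, in accordance with the convention that the inverse of 0 is
    0. *)
Lemma measurable_inv {R : realType} : measurable_fun setT (fun y : R => y^-1).
Proof.
apply: (@measurable_fun_cvg _ _ _ _ (fun k (y : R) => y / (y ^+ 2 + k.+1%:R^-1))).
  move=> k; apply: continuous_measurable_fun => y.
  apply: cvgM; first exact: cvg_id.
  apply: cvgV; first by rewrite gt_eqF// ltr_wpDl ?sqr_ge0// invr_gt0.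
  by apply: cvgD; [exact: exprn_continuous|exact: cvg_cst].
move=> y _; have [->|y0] := eqVneq y 0.
  by under eq_fun do rewrite mul0r; rewrite invr0; exact: cvg_cst.
have -> : y^-1 = y / (y ^+ 2 + 0) by rewrite addr0 expr2 invfM mulrA divff// mul1r.
apply: cvgM; first exact: cvg_cst.
apply: cvgV; first by rewrite addr0 sqrf_eq0.
by apply: cvgD; [exact: cvg_cst|exact: cvg_harmonic].
Qed.

(** Otherwise the intermediate value theorem produces a value of [f] or of [- f] in ]0, 1], where
    the sine is positive. *)
Lemma continuous_sin_eq0 {R : realType} (f : R -> R) :
  continuous f -> f 0 = 0 -> (forall t, sin (f t) = 0) -> f 1 = 0.
Proof.
suff H (g : R -> R) : continuous g -> g 0 = 0 -> (forall t, sin (g t) = 0) -> g 1 <= 0.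
  move=> cf f0 sf; apply/eqP; rewrite eq_le H//= -oppr_le0.
  apply: (H (fun t => - f t)).
  - by move=> x; apply: cvgN; exact: cf.
  - by rewrite f0 oppr0.
  - by move=> t; rewrite sinN sf oppr0.
move=> cg g0 sg; rewrite leNgt; apply/negP => g1.
have [|c _ gc] := @IVT R g 0 1 (Num.min (g 1) 1) ler01 (continuous_subspaceT cg).
  by rewrite g0 (min_l (ltW g1)) (max_r (ltW g1)) ge_min lexx /= andbT le_min (ltW g1) ler01.
have : 0 < sin (g c).
  apply: sin2_gt0; rewrite gc lt_min g1 ltr01/=.
  by rewrite gt_min ltr1n orbT.
by rewrite sg ltxx.
Qed.

(** The sine is positive on ]0, 2[, so the cosine is not 1 once |x| / k is below 2. Cosines at the
    countably many scales 1/k thus detect whether a linear form vanishes. *)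
Lemma cos_neq1_small {R : realType} (x : R) : x != 0 ->
  exists k : nat, cos (k.+1%:R^-1 * x) != 1.
Proof.
move=> x0; have [N _ HN] := @nbhs_infty_gtr R `|x|.
exists N; apply/negP => /eqP c1.
have k0 : 0 < N.+1%:R :> R by [].
have h : 0 < N.+1%:R^-1 * `|x| < 2.
  rewrite mulr_gt0 ?invr_gt0 ?normr_gt0//= mulrC ltr_pdivrMr//.
  have := HN N (leqnn N); rewrite -[N.+1%:R]natr1; lra.
have := sin2_gt0 h; have := sin2cos2 (N.+1%:R^-1 * `|x|).
have -> : cos (N.+1%:R^-1 * `|x|) = 1.
  transitivity (cos (N.+1%:R^-1 * x)) => //; rewrite -[RHS]cos_norm; congr cos.
  by rewrite normrM gtr0_norm// invr_gt0.
by rewrite expr1n subrr => /eqP; rewrite sqrf_eq0 => /eqP ->; rewrite ltxx.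
Qed.

Section levy_khintchine_uniqueness.
Context {R : realType} {n : nat}.
Notation V := 'cV[R]_n.
Implicit Types (u v w : V).

Lemma dot_scale_continuous v u : continuous (fun t : R => dot v (t *: u)).
Proof.
rewrite (_ : (fun _ => _) = (fun t : R => t * dot v u)); last first.
  by apply/funext => t; rewrite dotZr.
by move=> t; apply: cvgM; [exact: cvg_id|exact: cvg_cst].
Qed.

Lemma lk_im_continuous m (M : {measure set V -> \bar R}) u : levy_measure M ->
  continuous (fun t : R => lk_im m M (t *: u)).
Proof.
move=> lM t; rewrite /lk_im; apply: cvgD; first exact: dot_scale_continuous.
pose K := `|t| + 1.
apply: (@continuity_under_integral _ _ _ M (fun s v => eta_im (s *: u) v) setT
   measurableT (- K) K _ _ (fun v => (5 + 3 * (K ^+ 2 * enorm u ^+ 2)) * lkern v)).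
- by move=> s _; exact: integrable_eta_im.
- apply: aeW => v _ s _; rewrite /eta_im.
  apply: cvgB; [|apply: cvgM; [exact: dot_scale_continuous|exact: cvg_cst]].
  apply: (@continuous_comp _ _ _ (fun s : R => dot v (s *: u)) sin).
    exact: dot_scale_continuous.
  exact: continuous_sin.
- exact: integrable_lkern.
- move=> s; rewrite /= in_itv/= => /andP[sK1 sK2]; apply: aeW => v _.
  apply: le_trans (eta_im_le _ _) _; rewrite ler_wpM2r ?lkern_ge0// lerD2l.
  rewrite ler_pM2l// enormZ exprMn ler_wpM2r ?sqr_ge0//.
  by rewrite lerXn2r ?nnegrE ?addr_ge0// ltW// ltr_norml sK1.
- by rewrite inE /= in_itv/= -ltr_norml /K ltrDl.
Qed.

(** The modulus of the Fourier transform gives [lk_re]. The phases agree modulo 2 pi; along the ray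
    through [u] their difference is continuous and starts at 0, hence vanishes. *)
Lemma lk_exponent_unique (mu : probability V R) m D (M : {measure set V -> \bar R})
    m' D' (M' : {measure set V -> \bar R}) :
  levy_khintchine mu m D M -> levy_khintchine mu m' D' M' ->
  forall u, lk_re D M u = lk_re D' M' u /\ lk_im m M u = lk_im m' M' u.
Proof.
move=> /levy_khintchineE[_ lM h] /levy_khintchineE[_ lM' h'].
have sq (a b : R) : (expR a * cos b) ^+ 2 + (expR a * sin b) ^+ 2 = expR a ^+ 2.
  by rewrite !exprMn -mulrDr cos2Dsin2 mulr1.
have re u : lk_re D M u = lk_re D' M' u.
  apply: expR_inj; apply/eqP; rewrite -(@eqrXn2 _ 2) ?expR_ge0//; apply/eqP.
  have [hc hs] := h u; have [hc' hs'] := h' u.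
  by rewrite -(sq _ (lk_im m M u)) -(sq _ (lk_im m' M' u)) -hc -hs hc' hs'.
move=> u; split => //; apply/eqP; rewrite -subr_eq0; apply/eqP.
pose f (t : R) := lk_im m M (t *: u) - lk_im m' M' (t *: u).
rewrite -[X in lk_im m M X](scale1r u) -[X in lk_im m' M' X](scale1r u) -/(f 1).
apply: continuous_sin_eq0.
- by move=> t; apply: cvgB; exact: lk_im_continuous.
- rewrite /f /lk_im scale0r !dot0r.
  have e0 (N : {measure set V -> \bar R}) : \int[N]_v eta_im 0 v = 0.
    under eq_Rintegral => v _ do rewrite /eta_im dot0r sin0 mul0r subrr.
    by rewrite /Rintegral integral0.
  by rewrite !e0 subrr.
- move=> t; rewrite /f sinB.
  have [hc hs] := h (t *: u); have [hc' hs'] := h' (t *: u).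
  rewrite re in hc hs; have ne := expR_gt0 (lk_re D' M' (t *: u)).
  have -> : cos (lk_im m M (t *: u)) = cos (lk_im m' M' (t *: u)).
    by apply: (mulfI (lt0r_neq0 ne)); rewrite -hc.
  have -> : sin (lk_im m M (t *: u)) = sin (lk_im m' M' (t *: u)).
    by apply: (mulfI (lt0r_neq0 ne)); rewrite -hs.
  by rewrite mulrC subrr.
Qed.

Definition cosw w v : R := 1 - cos (dot v w).

Lemma measurable_cosw w : measurable_fun [set: V] (cosw w).
Proof.
apply: measurable_funB => //; apply: measurableT_comp; last exact: measurable_dot.
by apply: continuous_measurable_fun; exact: continuous_cos.
Qed.

Lemma cosw_ge0 w v : 0 <= cosw w v. Proof. exact: cosB1_ge0. Qed.

Lemma coswE w v : cosw w v = - eta_re w v. Proof. by rewrite /cosw opprB. Qed.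

Section second_difference.
Variables (m : V) (D : 'M[R]_n) (M : {measure set V -> \bar R}).
Hypotheses (D0 : nonneg_operator D) (lM : levy_measure M).

Let c_ge0 w : 0 <= 2^-1 * dot (D *m w) w.
Proof. by rewrite mulr_ge0 ?invr_ge0// D0.2. Qed.

(* Damping [M] by [1 - cos (v, w)] makes it finite; the Fourier transform of the
   result is a second difference of the exponent, see [lk_re_diff]. *)
Definition lk_finite w : {measure set V -> \bar R} :=
  measure_add (density_measure M (measurable_cosw w) (cosw_ge0 w))
    (mscale (NngNum (c_ge0 w)) (dirac (0 : V))).

Let int_cosw w (f : V -> R) : measurable_fun setT f -> (forall v, `|f v| <= 1) ->
  M.-integrable setT (EFin \o (fun v => f v * cosw w v)).
Proof.
move=> mf f1; apply: (integrable_le_lkern lM (c := 5 + 3 * enorm w ^+ 2)).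
  by apply: measurable_funM => //; exact: measurable_cosw.
move=> v; rewrite normrM coswE normrN (le_trans _ (eta_re_le w v))//.
by rewrite ler_piMl.
Qed.

Let density_fin w :
  (density_measure M (measurable_cosw w) (cosw_ge0 w) setT < +oo)%E.
Proof.
rewrite /density_measure; have := @int_cosw w (cst 1) ltac:(by []) (fun=> ltac:(by rewrite normr1)).
move=> /integrableP[_]; apply: le_lt_trans; apply: ge0_le_integral => //.
- by move=> v _; rewrite lee_fin cosw_ge0.
- by apply/measurable_EFinP; exact: measurable_cosw.
- apply: measurableT_comp => //; apply/measurable_EFinP.
  by apply: measurable_funM => //; exact: measurable_cosw.
- by move=> v _ /=; rewrite mul1r lee_fin ler_norm.
Qed.

Lemma lk_finiteE w E : lk_finite w E =
  (density_measure M (measurable_cosw w) (cosw_ge0 w) E +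
   (2^-1 * dot (D *m w) w)%:E * dirac (0%R : V) E)%E.
Proof. exact: measure_addE. Qed.

Lemma lk_finite_fin w : (lk_finite w setT < +oo)%E.
Proof.
by rewrite lk_finiteE lte_add_pinfty// diracT mule1 ltry.
Qed.

Lemma Rintegral_lk_finite w (f : V -> R) : measurable_fun setT f -> (forall v, `|f v| <= 1) ->
  \int[lk_finite w]_v f v =
  \int[M]_v (f v * cosw w v) + 2^-1 * dot (D *m w) w * f 0.
Proof.
move=> mf f1; have fin : (dirac (0%R : V) setT < (+oo : \bar R))%E by rewrite diracT ltry.
have id : (dirac (0 : V)).-integrable setT (EFin \o f).
  by apply: (integrable_bounded (B := 1)).
rewrite Rintegral_add; last 2 first.
- by apply: (integrable_bounded (B := 1)) => //; exact: density_fin.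
- exact: integrable_mscale.
rewrite Rintegral_density// Rintegral_mscale//=; congr (_ + _ * _).
by rewrite /Rintegral integral_dirac//; [rewrite diracT mul1e|exact/measurable_EFinP].
Qed.

(** The addition formulas produce the factor 1 - cos (v, w). The parallelogram identity turns the
    Gaussian term into the constant (D w, w) / 2, which is the atom at 0. *)
Lemma lk_re_diff u w :
  lk_re D M u - (lk_re D M (u + w) + lk_re D M (u - w)) / 2 =
  \int[lk_finite w]_v cos (dot v u).
Proof.
rewrite Rintegral_lk_finite; last 2 first.
- apply: measurableT_comp; last exact: measurable_dot.
  by apply: continuous_measurable_fun; exact: continuous_cos.
- by move=> v; exact: cos_max.
rewrite dot0l cos0 mulr1 /lk_re.
have -> : \int[M]_v (cos (dot v u) * cosw w v) =
    \int[M]_v eta_re u v - 2^-1 * (\int[M]_v eta_re (u + w) v + \int[M]_v eta_re (u - w) v).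
  rewrite -RintegralD//; [|exact: integrable_eta_re|exact: integrable_eta_re].
  have i1 := integrable_eta_re lM.
  have i2 : M.-integrable setT (EFin \o (fun v => eta_re (u + w) v + eta_re (u - w) v)).
    by apply: integrableRD => //; exact: i1.
  rewrite -RintegralZl// -RintegralB//; last first.
    exact: integrableRZ.
  apply: eq_Rintegral => v _; by rewrite /eta_re /cosw dotDr dotBr cosD cosB; lra.
by rewrite mulmxDr mulmxBr !dotDl !dotDr !dotNl !dotNr; lra.
Qed.

Lemma lk_im_diff u w :
  lk_im m M u - (lk_im m M (u + w) + lk_im m M (u - w)) / 2 =
  \int[lk_finite w]_v sin (dot v u).
Proof.
rewrite Rintegral_lk_finite; last 2 first.
- apply: measurableT_comp; last exact: measurable_dot.
  by apply: continuous_measurable_fun; exact: continuous_sin.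
- by move=> v; exact: sin_max.
rewrite dot0l sin0 mulr0 addr0 /lk_im.
have -> : \int[M]_v (sin (dot v u) * cosw w v) =
    \int[M]_v eta_im u v - 2^-1 * (\int[M]_v eta_im (u + w) v + \int[M]_v eta_im (u - w) v).
  rewrite -RintegralD//; [|exact: integrable_eta_im|exact: integrable_eta_im].
  have i1 := integrable_eta_im lM.
  have i2 : M.-integrable setT (EFin \o (fun v => eta_im (u + w) v + eta_im (u - w) v)).
    by apply: integrableRD => //; exact: i1.
  rewrite -RintegralZl// -RintegralB//; last first.
    exact: integrableRZ.
  apply: eq_Rintegral => v _; by rewrite /eta_im /cosw dotDr dotBr sinD sinB; lra.
by rewrite !dotDr !dotNr; lra.
Qed.

(** Undoes the damping where it is nonzero; where [cosw] vanishes, the convention x / 0 = 0 drops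
    the points, which produces the intersection on the right. *)
Lemma density_cosw_inv w E : measurable E ->
  (\int[density_measure M (measurable_cosw w) (cosw_ge0 w)]_v
     (\1_E v / cosw w v)%:E = M (E `&` [set v | cosw w v != 0%R]))%E.
Proof.
move=> mE; have mC : measurable [set v | cosw w v != 0].
  rewrite (_ : [set v | _] = cosw w @^-1` (~` [set 0])); last first.
    by apply/seteqP; split => v /= /eqP.
  rewrite -[X in measurable X]setTI; apply: measurable_cosw => //.
  by apply: measurableC; exact: measurable_set1.
rewrite ge0_integral_density; last 2 first.
- apply/measurable_EFinP/measurable_funM; first exact: measurable_indic.
  exact: (measurableT_comp measurable_inv (measurable_cosw w)).
- by move=> v; rewrite lee_fin divr_ge0// cosw_ge0.
rewrite -[in RHS](setIT (E `&` _)) -integral_indic//; last exact: measurableI.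
apply: eq_integral => v _; rewrite -EFinM !indicE in_setI; congr EFin.
case: (v \in E); rewrite ?mul0r// mul1r.
have [c0|c0] := eqVneq (cosw w v) 0.
  by rewrite c0 mulr0 memNset//= c0 eqxx.
by rewrite mulVf// mem_set.
Qed.

End second_difference.

Lemma eq_measure_cosw (M M' : {measure set V -> \bar R}) :
  M [set 0] = 0%E -> M' [set 0] = 0%E ->
  (forall w E, measurable E -> M (E `&` [set v | cosw w v != 0]) =
                               M' (E `&` [set v | cosw w v != 0])) ->
  forall E, measurable E -> M E = M' E.
Proof.
move=> M0 M'0 eqw.
(* The directions e_i / (k + 1), enumerated by [pickle]: the countably many sets where these
   dampings are nonzero cover all nonzero vectors. *)
pose dir (j : nat) : V := if unpickle j is Some (i, k)
  then (k : nat).+1%:R^-1 *: delta_mx (i : 'I_n) 0 else 0.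
pose C j := [set v | cosw (dir j) v != 0].
have mC j : measurable (C j).
  rewrite (_ : C j = cosw (dir j) @^-1` (~` [set 0])); last first.
    by apply/seteqP; split => v /= /eqP.
  rewrite -[X in measurable X]setTI; apply: measurable_cosw => //.
  by apply: measurableC; exact: measurable_set1.
have UC : \bigcup_j C j = ~` [set 0].
  apply/seteqP; split => v /=.
    by move=> [j _ /negP Cv] v0; apply: Cv; rewrite v0 /cosw dot0l cos0 subrr.
  move=> /eqP v0; have [i vi0] : exists i, v i 0 != 0.
    apply: contrapT => /forallNP h; move/eqP: v0; apply; apply/matrixP => i j.
    by rewrite ord1 mxE; apply/eqP; have /negP := h i; rewrite negbK.
  have [k hk] := cos_neq1_small vi0.
  exists (pickle (i, k)) => //; rewrite /C /= /dir pickleK /cosw dotZr dot_delta.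
  by rewrite subr_eq0 eq_sym.
have mD j : measurable (seqDU C j).
  by apply: measurableD => //; apply: bigsetU_measurable.
have H (N : {measure set V -> \bar R}) E : measurable E -> N [set 0] = 0%E ->
    N E = (\sum_(j <oo) N (E `&` seqDU C j))%E.
  move=> mE N0.
  transitivity (N (E `&` ~` [set 0])).
    have m0 := @measurable_set1V R n 0.
    have z : N (E `&` [set 0]) = 0%E.
      apply/eqP; rewrite -measure_le0 -[leRHS]N0 le_measure// inE//.
      exact: measurableI.
    by rewrite [LHS](measureDI N mE m0) [X in (_ + X)%E]z adde0.
  rewrite -UC seqDU_bigcup_eq setI_bigcupr measure_bigcup//.
  - by apply: eq_eseriesl => j; exact: mem_set.
  - by move=> j _; exact: measurableI.
  - by apply: trivIset_setIl; exact: trivIset_seqDU.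
move=> E mE; rewrite (H M)// (H M')//; apply: eq_eseriesr => j _.
have -> : E `&` seqDU C j = (E `&` seqDU C j) `&` C j.
  by apply/seteqP; split => v; [move=> [Ev [Cv nC]]|move=> []].
by apply: eqw; exact: measurableI.
Qed.

(** All damped measures coincide by Fourier uniqueness. Their atom at 0 gives the quadratic form of
    [D], the rest gives the damped [M], and then only the linear part of the exponent is left for
    [m]. *)
Lemma levy_khintchine_unique (mu : probability V R) m D (M : {measure set V -> \bar R})
    m' D' (M' : {measure set V -> \bar R}) :
  levy_khintchine mu m D M -> levy_khintchine mu m' D' M' ->
  [/\ m = m', D = D' & forall E, measurable E -> M E = M' E].
Proof.
move=> lk lk'; have eqe := lk_exponent_unique lk lk'.
have /levy_khintchineE[D0 lM _] := lk; have /levy_khintchineE[D0' lM' _] := lk'.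
have /levy_measureP[M0 _] := lM; have /levy_measureP[M'0 _] := lM'.
have eqf w E : measurable E -> lk_finite M D0 w E = lk_finite M' D0' w E.
  apply: finite_measure_fourier_unique; do ?exact: lk_finite_fin.
  - move=> u; rewrite -!lk_re_diff//.
    by have [-> _] := eqe u; have [-> _] := eqe (u + w); have [-> _] := eqe (u - w).
  - move=> u; rewrite -(lk_im_diff m)// -(lk_im_diff m')//.
    by have [_ ->] := eqe u; have [_ ->] := eqe (u + w); have [_ ->] := eqe (u - w).
have den0 (N : {measure set V -> \bar R}) w :
    density_measure N (measurable_cosw w) (cosw_ge0 w) [set 0] = 0%E.
  apply: integral0_eq => v /= ->.
  by rewrite /cosw dot0l cos0 subrr.
have eqD w : dot (D *m w) w = dot (D' *m w) w.
  have := eqf w [set 0] (measurable_set1V 0).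
  rewrite !lk_finiteE !den0 !add0e !diracE mem_set// !mule1 => -[].
  by move/(mulfI _); apply; rewrite invr_neq0.
have eqDD : D = D'.
  apply/eqP; rewrite -subr_eq0; apply/eqP.
  set B := D - D'.
  have BT : B^T = B by rewrite /B linearB /= D0.1 D0'.1.
  have B0 w : dot (B *m w) w = 0 by rewrite /B mulmxBl dotBl eqD subrr.
  have Buw u w : dot (B *m u) w = 0.
    have := B0 (u + w); rewrite mulmxDr dotDl !dotDr !B0 add0r addr0.
    by rewrite [dot (B *m w) u]dot_mulmxl BT (dotC w); lra.
  apply/matrixP => i j; have := Buw (delta_mx j 0) (delta_mx i 0).
  by rewrite dot_delta -colE !mxE.
have eqMw w E : measurable E ->
    density_measure M (measurable_cosw w) (cosw_ge0 w) E =
    density_measure M' (measurable_cosw w) (cosw_ge0 w) E.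
  move=> mE; have := eqf w E mE; rewrite !lk_finiteE eqD.
  move=> /(congr1 (fun z => z - (2^-1 * dot (D' *m w) w)%:E * dirac (0%R : V) E)%E).
  by rewrite !addeK// diracE.
have eqM : forall E, measurable E -> M E = M' E.
  apply: eq_measure_cosw => // w E mE.
  rewrite -!density_cosw_inv//; apply: eq_measure_integral => A mA _.
  exact: eqMw.
split => //; apply: dot_inj => u.
have [_] := eqe u; rewrite /lk_im.
rewrite (_ : \int[M]_v eta_im u v = \int[M']_v eta_im u v); first by move/addIr.
by rewrite /Rintegral; congr fine; apply: eq_measure_integral => A mA _; exact: eqM.
Qed.

End levy_khintchine_uniqueness.

(** * Vector-valued integrals *)

Section vector_integral.
Context {R : realType} {n : nat}.
Notation V := 'cV[R]_n.
Implicit Types (u v w : V) (F G : V -> V) (A : 'M[R]_n).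
Variable M : {measure set V -> \bar R}.

Definition vint F : V := \col_i \int[M]_v (F v i 0).

Definition vintegrable F : Prop :=
  forall i, M.-integrable setT (EFin \o (fun v => F v i 0)).

Lemma vintegrable_dot F u : vintegrable F ->
  M.-integrable setT (EFin \o (fun v => dot (F v) u)).
Proof.
move=> iF; rewrite /dot.
elim: (index_enum _) => [|i r ir].
  by under eq_fun do rewrite big_nil; exact: integrable0.
under eq_fun do rewrite big_cons; apply: integrableRD => //.
by under eq_fun do rewrite mulrC; exact: integrableRZ.
Qed.

Lemma vint_dot F u : vintegrable F -> dot (vint F) u = \int[M]_v dot (F v) u.
Proof.
move=> iF; rewrite /dot.
have H r : M.-integrable setT (EFin \o (fun v => \sum_(i <- r) F v i 0 * u i 0)) /\
    \sum_(i <- r) vint F i 0 * u i 0 = \int[M]_v \sum_(i <- r) F v i 0 * u i 0.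
  elim: r => [|i r [ir er]].
    split; first by under eq_fun do rewrite big_nil; exact: integrable0.
    rewrite big_nil (@eq_Rintegral _ _ _ M setT (cst 0)); last by move=> v _; rewrite big_nil.
    by rewrite /Rintegral integral0.
  have h : M.-integrable setT (EFin \o (fun v => F v i 0 * u i 0)).
    by under eq_fun do rewrite mulrC; exact: integrableRZ.
  split; first by under eq_fun do rewrite big_cons; exact: integrableRD.
  rewrite big_cons er [RHS](@eq_Rintegral _ _ _ M setT
    (fun v => F v i 0 * u i 0 + \sum_(i <- r) F v i 0 * u i 0)); last first.
    by move=> v _; rewrite big_cons.
  by rewrite RintegralD// RintegralZr// mxE.
exact: (H _).2.
Qed.

Lemma eq_vint F G : F =1 G -> vint F = vint G.
Proof. by move=> FG; apply/matrixP => i j; rewrite !mxE; apply: eq_Rintegral => v _; rewrite FG. Qed.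

Lemma vintegrableP F :
  (forall u, M.-integrable setT (EFin \o (fun v => dot (F v) u))) -> vintegrable F.
Proof. by move=> h i; have := h (delta_mx i 0); under eq_fun do rewrite dot_delta. Qed.

Lemma vintegrableD F G : vintegrable F -> vintegrable G -> vintegrable (fun v => F v + G v).
Proof. by move=> iF iG i; under eq_fun do rewrite mxE; exact: integrableRD. Qed.

Lemma vintegrableB F G : vintegrable F -> vintegrable G -> vintegrable (fun v => F v - G v).
Proof. by move=> iF iG i; under eq_fun do rewrite !mxE; exact: integrableRB. Qed.

Lemma vintegrable_mulmx A F : vintegrable F -> vintegrable (fun v => A *m F v).
Proof.
by move=> iF; apply: vintegrableP => u; under eq_fun do rewrite dot_mulmxl; exact: vintegrable_dot.
Qed.

Lemma vintD F G : vintegrable F -> vintegrable G ->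
  vint (fun v => F v + G v) = vint F + vint G.
Proof.
move=> iF iG; apply/matrixP => i j; rewrite !mxE -RintegralD//.
by apply: eq_Rintegral => v _; rewrite mxE.
Qed.

Lemma vintB F G : vintegrable F -> vintegrable G ->
  vint (fun v => F v - G v) = vint F - vint G.
Proof.
move=> iF iG; apply/matrixP => i j; rewrite !mxE -RintegralB//.
by apply: eq_Rintegral => v _; rewrite !mxE.
Qed.

Lemma vint_mulmx A F : vintegrable F -> vint (fun v => A *m F v) = A *m vint F.
Proof.
move=> iF; apply: dot_inj => u; rewrite dot_mulmxl !vint_dot//.
  by apply: eq_Rintegral => v _; rewrite dot_mulmxl.
exact: vintegrable_mulmx.
Qed.

Lemma le_vintegrable F (g : V -> R) :
  (forall i, measurable_fun setT (fun v => F v i 0)) ->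
  (forall v, enorm (F v) <= g v) -> M.-integrable setT (EFin \o g) ->
  vintegrable F.
Proof.
move=> mF Fg ig i; apply: (le_integrableR _ _ _ ig) => // v _.
exact: le_trans (coord_le_enorm _ _) (Fg v).
Qed.

End vector_integral.

Section translation.
Context {R : realType} {n : nat}.
Notation V := 'cV[R]_n.

Definition shift_by (h v : V) : V := v + h.

Lemma measurable_shift_by h : measurable_fun setT (shift_by h).
Proof.
apply: measurable_mxP => i j; under eq_fun do rewrite mxE.
by apply: measurable_funD => //; exact: measurable_coord.
Qed.

HB.instance Definition _ h :=
  isMeasurableFun.Build _ _ V V (shift_by h) (measurable_shift_by h).

Lemma conv_pmassE (mu : probability V R) h E : measurable E ->
  Defs.conv mu (pmass h) E = pushforward mu (shift_by h) E.
Proof.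
move=> mE; rewrite /Defs.conv /= /convolution /pushforward /=.
rewrite /product_measure1 /=.
have mS : measurable (shift_by h @^-1` E).
  by rewrite -[X in measurable X]setTI; exact: measurable_shift_by.
rewrite -[in RHS](setIT (shift_by h @^-1` E)) -integral_indic//; apply: eq_integral => v _.
rewrite diracE indicE (_ : h \in _ = (v \in shift_by h @^-1` E))//.
apply/idP/idP => /set_mem H; apply/mem_set; first by move: H => /xsectionP.
exact/xsectionP.
Qed.

Lemma Rintegral_conv_pmass (mu : probability V R) h (f : V -> R) :
  measurable_fun setT f -> (forall v, `|f v| <= 1) ->
  \int[Defs.conv mu (pmass h)]_v f v = \int[mu]_v f (v + h).
Proof.
move=> mf f1; rewrite /Rintegral; congr fine.
rewrite (eq_measure_integral (pushforward mu (shift_by h))); last first.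
  by move=> E mE _; exact: conv_pmassE.
rewrite integral_pushforward//; first exact/measurable_EFinP.
rewrite preimage_setT; apply: (integrable_bounded (B := 1)) => //.
- by rewrite [X in (X < _)%E]probability_setT ltry.
- exact: (measurableT_comp mf (measurable_shift_by h)).
Qed.

Lemma Rintegral_image (mu : probability V R) A (f : V -> R) :
  measurable_fun setT f -> (forall v, `|f v| <= 1) ->
  \int[image_measure A mu]_v f v = \int[mu]_v f (A *m v).
Proof.
move=> mf f1; rewrite /Rintegral; congr fine.
rewrite integral_pushforward//; first exact/measurable_EFinP.
rewrite preimage_setT; apply: (integrable_bounded (B := 1)) => //.
- by rewrite [X in (X < _)%E]probability_setT ltry.
- exact: (measurableT_comp mf (measurable_mulmx A)).
Qed.

End translation.

(** * Convolution powers and centerings in terms of the triple *)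

Section levy_khintchine_transforms.
Context {R : realType} {n : nat}.
Notation V := 'cV[R]_n.
Implicit Types (u v w m h : V) (A D : 'M[R]_n) (mu : probability V R)
  (M : {measure set V -> \bar R}).

Lemma measurable_cos_dot u : measurable_fun [set: V] (fun v => cos (dot v u)).
Proof.
apply: measurableT_comp; last exact: measurable_dot.
by apply: continuous_measurable_fun; exact: continuous_cos.
Qed.

Lemma measurable_sin_dot u : measurable_fun [set: V] (fun v => sin (dot v u)).
Proof.
apply: measurableT_comp; last exact: measurable_dot.
by apply: continuous_measurable_fun; exact: continuous_sin.
Qed.

Lemma integrable_cos_dot mu u : mu.-integrable setT (EFin \o (fun v => cos (dot v u))).
Proof.
apply: (integrable_bounded (B := 1)) => //.
- by rewrite [X in (X < _)%E]probability_setT ltry.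
- exact: measurable_cos_dot.
- by move=> v _; exact: cos_max.
Qed.

Lemma integrable_sin_dot mu u : mu.-integrable setT (EFin \o (fun v => sin (dot v u))).
Proof.
apply: (integrable_bounded (B := 1)) => //.
- by rewrite [X in (X < _)%E]probability_setT ltry.
- exact: measurable_sin_dot.
- by move=> v _; exact: sin_max.
Qed.

Lemma cos_conv_pmass mu h u :
  \int[Defs.conv mu (pmass h)]_v cos (dot v u) =
  cos (dot h u) * \int[mu]_v cos (dot v u) - sin (dot h u) * \int[mu]_v sin (dot v u).
Proof.
rewrite (Rintegral_conv_pmass _ _ (measurable_cos_dot u)); last by move=> v; exact: cos_max.
rewrite -!RintegralZl//; do ?[exact: integrable_cos_dot|exact: integrable_sin_dot].
rewrite -RintegralB//; last 2 first.
- by apply: integrableRZ => //; exact: integrable_cos_dot.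
- by apply: integrableRZ => //; exact: integrable_sin_dot.
by apply: eq_Rintegral => v _; rewrite dotDl cosD; ring.
Qed.

Lemma sin_conv_pmass mu h u :
  \int[Defs.conv mu (pmass h)]_v sin (dot v u) =
  cos (dot h u) * \int[mu]_v sin (dot v u) + sin (dot h u) * \int[mu]_v cos (dot v u).
Proof.
rewrite (Rintegral_conv_pmass _ _ (measurable_sin_dot u)); last by move=> v; exact: sin_max.
rewrite -!RintegralZl//; do ?[exact: integrable_cos_dot|exact: integrable_sin_dot].
rewrite -RintegralD//; last 2 first.
- by apply: integrableRZ => //; exact: integrable_sin_dot.
- by apply: integrableRZ => //; exact: integrable_cos_dot.
by apply: eq_Rintegral => v _; rewrite dotDl sinD; ring.
Qed.

Lemma cos_image mu A u : \int[image_measure A mu]_v cos (dot v u) =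
  \int[mu]_v cos (dot v (A^T *m u)).
Proof.
rewrite (Rintegral_image _ _ (measurable_cos_dot u)); last by move=> v; exact: cos_max.
by apply: eq_Rintegral => v _; rewrite dot_mulmxl.
Qed.

Lemma sin_image mu A u : \int[image_measure A mu]_v sin (dot v u) =
  \int[mu]_v sin (dot v (A^T *m u)).
Proof.
rewrite (Rintegral_image _ _ (measurable_sin_dot u)); last by move=> v; exact: sin_max.
by apply: eq_Rintegral => v _; rewrite dot_mulmxl.
Qed.

Lemma levy_khintchine_shift mu m D M h :
  levy_khintchine mu m D M -> levy_khintchine (Defs.conv mu (pmass h)) (m + h) D M.
Proof.
move=> /levy_khintchineE[D0 lM e]; apply/levy_khintchineE; split => // u.
rewrite cos_conv_pmass sin_conv_pmass; have [-> ->] := e u.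
have -> : lk_im (m + h) M u = lk_im m M u + dot h u by rewrite /lk_im dotDl; ring.
by rewrite cosD sinD; split; ring.
Qed.

Lemma levy_khintchine_ext mu m D M M' :
  (forall E, measurable E -> M E = M' E) ->
  levy_khintchine mu m D M -> levy_khintchine mu m D M'.
Proof.
move=> MM' /levy_khintchineE[D0 lM e].
have eI (f : V -> \bar R) : (\int[M]_v f v = \int[M']_v f v)%E.
  by apply: eq_measure_integral => E mE _; exact: MM'.
apply/levy_khintchineE; split => //.
  have /levy_measureP[M0 /integrableP[mk ki]] := lM; apply/levy_measureP; split.
    by rewrite -MM'//; exact: measurable_set1V.
  by apply/integrableP; split => //; rewrite -eI.
move=> u; have := e u.
by rewrite /lk_re /lk_im /Rintegral !eI.
Qed.

Definition push_mx A M : {measure set V -> \bar R} :=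
  measure_function_pushforward__canonical__measure_function_Measure M (measurable_mulmx A).

Lemma Rintegral_push A M (f : V -> R) : measurable_fun setT f ->
  M.-integrable setT (EFin \o (fun v => f (A *m v))) ->
  \int[push_mx A M]_v f v = \int[M]_v f (A *m v).
Proof.
move=> mf fi; rewrite /Rintegral integral_pushforward//; exact/measurable_EFinP.
Qed.

Lemma integrable_push A M (f : V -> R) : measurable_fun setT f ->
  M.-integrable setT (EFin \o (fun v => f (A *m v))) ->
  (push_mx A M).-integrable setT (EFin \o f).
Proof.
by move=> mf fi; apply: integrable_pushforward => //; exact/measurable_EFinP.
Qed.

Lemma measurable_fun_mulmx A (f : V -> R) : measurable_fun setT f ->
  measurable_fun setT (fun v => f (A *m v)).
Proof. by move=> mf; exact: (measurableT_comp mf (measurable_mulmx A)). Qed.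

Lemma lkern_mulmx A v : lkern (A *m v) <= (2 + 2 * mxbound A ^+ 2) * lkern v.
Proof.
have k0 := lkern_ge0 v; have b0 := mxbound_ge0 A.
have p0 : 0 <= mxbound A ^+ 2 * lkern v by rewrite mulr_ge0// sqr_ge0.
have [v1|/ltW v1] := lerP (enorm v) 1; last first.
  by have := lkern_big v1; have := lkern_le1 (A *m v); lra.
apply: (@le_trans _ _ (enorm (A *m v) ^+ 2)).
  by rewrite /lkern ler_piMr ?sqr_ge0// invf_le1 ?lerDl ?sqr_ge0// ltr_pwDl// sqr_ge0.
apply: (@le_trans _ _ ((mxbound A * enorm v) ^+ 2)).
  by rewrite lerXn2r ?nnegrE ?mulr_ge0 ?enorm_ge0// enorm_mulmx.
rewrite exprMn; apply: (@le_trans _ _ (mxbound A ^+ 2 * (2 * lkern v))).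
  by rewrite ler_wpM2l ?sqr_ge0// lkern_small.
lra.
Qed.

Lemma levy_measure_push A M : A \in unitmx -> levy_measure M ->
  levy_measure (push_mx A M).
Proof.
move=> uA lM; have /levy_measureP[M0 _] := lM; apply/levy_measureP; split.
  rewrite /= /pushforward (_ : _ @^-1` _ = [set 0])//; apply/seteqP; split => v /=.
    by move=> Av; rewrite -(mulKmx uA v) Av mulmx0.
  by move=> ->; rewrite mulmx0.
apply: integrable_push; first exact: measurable_lkern.
apply: (integrable_le_lkern lM (c := 2 + 2 * mxbound A ^+ 2)).
  by apply: measurable_fun_mulmx; exact: measurable_lkern.
by move=> v; rewrite ger0_norm ?lkern_ge0// lkern_mulmx.
Qed.

(** The truncation [lphi] does not commute with [A]; this vector is the resulting change of drift
    when the measure is transported by [A]. *)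
Definition corr A M : V := vint M (fun v => (lphi (A *m v) - lphi v) *: (A *m v)).

Lemma enorm_lphi v : enorm v * lphi v <= 1.
Proof.
have [v1|/ltW v1] := lerP (enorm v) 1.
  by rewrite mulr_ile1 ?enorm_ge0 ?lphi_le1// ltW// lphi_gt0.
exact: le_trans (enorm_lphi_big v1) (lkern_le1 v).
Qed.

(** Inside the unit ball the difference of the truncations is of order [lkern] and [A v] is bounded.
    Outside, the two terms are estimated separately: the first is bounded, the second is at most a
    multiple of |v| times [lphi v]. *)
Lemma vintegrable_corr A M : levy_measure M ->
  vintegrable M (fun v => (lphi (A *m v) - lphi v) *: (A *m v)).
Proof.
move=> lM; set C := mxbound A; have C0 : 0 <= C := mxbound_ge0 A.
apply: (@le_vintegrable _ _ _ _
  (fun v => (2 + 2 * C + C * (2 + 2 * C ^+ 2)) * lkern v)).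
- move=> i; under eq_fun do rewrite mxE; apply: measurable_funM.
    apply: measurable_funB; last exact: measurable_lphi.
    by apply: measurable_fun_mulmx; exact: measurable_lphi.
  by apply: (@measurable_fun_mulmx A (fun v => v i 0)); exact: measurable_coord.
- move=> v; rewrite enormZ; have k0 := lkern_ge0 v.
  have C1 : 0 <= C * lkern v by rewrite mulr_ge0.
  have C2 : 0 <= C * (2 + 2 * C ^+ 2) * lkern v.
    by rewrite mulr_ge0// mulr_ge0// addr_ge0 ?mulr_ge0 ?sqr_ge0.
  have [v1|/ltW v1] := lerP (enorm v) 1.
    have h1 : `|lphi (A *m v) - lphi v| <= (2 + 2 * C ^+ 2) * lkern v.
      have -> : lphi (A *m v) - lphi v = lkern v - lkern (A *m v) by rewrite !lkernE; ring.
      have := lkern_mulmx A v; have := lkern_ge0 (A *m v); rewrite -/C => a1 a2.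
      have a3 : 0 <= C ^+ 2 * lkern v by rewrite mulr_ge0// sqr_ge0.
      by rewrite ler_norml; apply/andP; split; lra.
    have h2 : enorm (A *m v) <= C.
      by rewrite (le_trans (enorm_mulmx _ _))// ler_piMr.
    apply: (@le_trans _ _ ((2 + 2 * C ^+ 2) * lkern v * C)).
      by apply: ler_pM => //; exact: enorm_ge0.
    have -> : (2 + 2 * C ^+ 2) * lkern v * C = C * (2 + 2 * C ^+ 2) * lkern v by ring.
    lra.
  have h1 : `|lphi (A *m v) - lphi v| * enorm (A *m v) <=
      lphi (A *m v) * enorm (A *m v) + lphi v * enorm (A *m v).
    rewrite -mulrDl ler_wpM2r ?enorm_ge0// (le_trans (ler_normB _ _))//.
    by rewrite !gtr0_norm ?lphi_gt0.
  have h2 := enorm_lphi (A *m v).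
  have h3 : lphi v * enorm (A *m v) <= C * lkern v.
    rewrite mulrC (le_trans (ler_wpM2r (ltW (lphi_gt0 v)) (enorm_mulmx A v)))//.
    by rewrite -mulrA ler_wpM2l// enorm_lphi_big.
  by have h4 := lkern_big v1; lra.
- exact: integrable_lkern.
Qed.

Lemma levy_khintchine_image mu m D M A : A \in unitmx ->
  levy_khintchine mu m D M ->
  levy_khintchine (image_measure A mu) (A *m m + corr A M) (A *m D *m A^T)
    (push_mx A M).
Proof.
move=> uA /levy_khintchineE[[DT D0] lM e]; apply/levy_khintchineE; split.
- split; first by rewrite !trmx_mul trmxK DT mulmxA.
  by move=> u; rewrite -!mulmxA dot_mulmxl D0.
- exact: levy_measure_push.
move=> u; rewrite cos_image sin_image; have [-> ->] := e (A^T *m u).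
have -> : lk_re (A *m D *m A^T) (push_mx A M) u = lk_re D M (A^T *m u).
  have E v : eta_re u (A *m v) = eta_re (A^T *m u) v by rewrite /eta_re dot_mulmxl.
  rewrite /lk_re Rintegral_push; last 2 first.
  - exact: measurable_eta_re.
  - by under eq_fun do rewrite E; exact: integrable_eta_re.
  congr (_ - _ * _); first by apply: eq_Rintegral => v _.
  by rewrite -!mulmxA dot_mulmxl.
have -> : lk_im (A *m m + corr A M) (push_mx A M) u =
          lk_im m M (A^T *m u).
  have E v : eta_im u (A *m v) =
      eta_im (A^T *m u) v - dot ((lphi (A *m v) - lphi v) *: (A *m v)) u.
    by rewrite /eta_im dotZl !dot_mulmxl; ring.
  have ic := vintegrable_dot u (vintegrable_corr A lM).
  rewrite /lk_im Rintegral_push; last 2 first.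
  - exact: measurable_eta_im.
  - by under eq_fun do rewrite E; apply: integrableRB => //; exact: integrable_eta_im.
  under eq_Rintegral => v _ do rewrite E.
  rewrite RintegralB//; last exact: integrable_eta_im.
  rewrite dotDl /corr vint_dot; last exact: vintegrable_corr.
  by rewrite dot_mulmxl; ring.
by [].
Qed.

(** Membership in [Gset] read on the triple. The vector [m] is absent because the free translation
    absorbs every drift; see [GsetP]. *)
Definition Gmx (a : R) D M A : Prop :=
  [/\ A \in unitmx, A *m D *m A^T = a *: D &
   forall E, measurable E -> M (mulmx A @^-1` E) = (a%:E * M E)%E].

Lemma is_conv_powerP a mu m D M m' D' M' (nu : probability V R) :
  0 <= a -> levy_khintchine mu m D M -> levy_khintchine nu m' D' M' ->
  is_conv_power a mu nu <->
  [/\ m' = a *: m, D' = a *: D & forall E, measurable E -> M' E = (a%:E * M E)%E].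
Proof.
move=> a0 lmu lnu; split.
  move=> [m1 [D1 [M1 [a0' [l1 l2]]]]].
  have [-> -> eM] := levy_khintchine_unique lmu l1.
  have [-> -> eM'] := levy_khintchine_unique lnu l2.
  split => // E mE; rewrite eM'//= /mscale /= -eM//.
move=> [em eD eM]; exists m, D, M, a0; split => //; rewrite -em -eD.
by apply: levy_khintchine_ext lnu => E mE; rewrite eM.
Qed.

Lemma GsetP a mu m D M A : 0 < a -> levy_khintchine mu m D M -> A \in unitmx ->
  Gset a mu A <-> Gmx a D M A.
Proof.
move=> a0 lmu uA.
have li h := levy_khintchine_shift h (levy_khintchine_image uA lmu).
split.
  move=> [h /(is_conv_powerP (ltW a0) lmu (li h))[_ eD eM]].
  by split => // E mE; rewrite -eM.
(* The translation is forced: it is the discrepancy between the two drifts. *)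
move=> [_ eD eM]; exists (a *: m - (A *m m + corr A M)).
apply/(is_conv_powerP (ltW a0) lmu (li _)); split => //.
by rewrite addrC subrK.
Qed.

(** The conditions on [D] and [M] hold by [Gmx], and a translation does not affect them; what is
    left is one affine equation for the drift. *)
Lemma centering_eqP a mu m D M A h : 0 < a -> levy_khintchine mu m D M ->
  Gmx a D M A ->
  is_conv_power a (Defs.conv mu (pmass h)) (image_measure A (Defs.conv mu (pmass h))) <->
  A *m (m + h) + corr A M = a *: (m + h).
Proof.
move=> a0 lmu [uA eD eM].
have l1 := levy_khintchine_shift h lmu.
have l2 := levy_khintchine_image uA l1.
split; first by move=> /(is_conv_powerP (ltW a0) l1 l2)[].
by move=> e; apply/(is_conv_powerP (ltW a0) l1 l2); split.
Qed.

End levy_khintchine_transforms.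

(** * The graded group of operators rescaling [D] and [M], and changes of truncation *)

Section invariance.
Context {R : realType} {n : nat}.
Notation V := 'cV[R]_n.
Implicit Types (u v w x : V) (A B D : 'M[R]_n) (a b : R).
Variable D : 'M[R]_n.
Variable M : {measure set V -> \bar R}.

Lemma GmxV a A : 0 < a -> Gmx a D M A -> Gmx a^-1 D M (invmx A).
Proof.
move=> a0 [uA eD eM]; split; first by rewrite unitmx_inv.
  have -> : invmx A *m D *m (invmx A)^T = a^-1 *: (invmx A *m (a *: D) *m (invmx A)^T).
    by rewrite -scalemxAr -scalemxAl scalerA mulVf ?gt_eqF// scale1r.
  by rewrite -eD trmx_inv !mulmxA mulVmx// mul1mx -mulmxA mulmxV ?unitmx_tr// mulmx1.
move=> E mE; have mE' : measurable (mulmx (invmx A) @^-1` E).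
  by rewrite -[X in measurable X]setTI; exact: measurable_mulmx.
have := eM _ mE'.
have -> : mulmx A @^-1` (mulmx (invmx A) @^-1` E) = E.
  by apply/seteqP; split => v /=; rewrite mulKmx.
by move=> ->; rewrite muleA -EFinM mulVf ?gt_eqF// mul1e.
Qed.

Lemma GmxM a b A B : Gmx a D M A -> Gmx b D M B -> Gmx (a * b) D M (A *m B).
Proof.
move=> [uA eD eM] [uB fD fM]; split; first by rewrite unitmx_mul uA.
  rewrite trmx_mul !mulmxA -(mulmxA A B D) -(mulmxA A) fD.
  by rewrite -scalemxAr -scalemxAl eD scalerA mulrC.
move=> E mE; have mE' : measurable (mulmx A @^-1` E).
  by rewrite -[X in measurable X]setTI; exact: measurable_mulmx.
have := fM _ mE'; rewrite eM// muleA -EFinM [b * a]mulrC => <-.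
by congr (M _); apply/seteqP; split => v /=; rewrite mulmxA.
Qed.

Lemma Gmx1 : Gmx 1 D M 1%:M.
Proof.
split; first exact: unitmx1.
  by rewrite trmx1 mulmx1 mul1mx scale1r.
by move=> E _; rewrite mul1e; congr (M _); apply/seteqP; split => v /=; rewrite mul1mx.
Qed.

Section fixed_operator.
Variables (a : R) (A : 'M[R]_n).
Hypotheses (a0 : 0 < a) (GA : Gmx a D M A).

Lemma Gmx_integral (f : V -> \bar R) : measurable_fun setT f -> (forall v, 0 <= f v)%E ->
  (\int[M]_v f (A *m v) = a%:E * \int[M]_v f v)%E.
Proof.
move=> mf f0; have [_ _ eM] := GA.
rewrite -[LHS](@ge0_integral_pushforward _ _ _ _ _ _ (measurable_mulmx A) M setT)//.
transitivity (\int[mscale (NngNum (ltW a0)) M]_v f v)%E; last by rewrite ge0_integral_mscale.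
rewrite -[LHS]/(\int[push_mx A M]_v f v)%E.
by apply: eq_measure_integral => E mE _; exact: eM.
Qed.

Lemma Gmx_integrable (f : V -> R) : M.-integrable setT (EFin \o f) ->
  M.-integrable setT (EFin \o (fun v => f (A *m v))).
Proof.
move=> /integrableP[mf fi]; apply/integrableP; split.
  by apply/measurable_EFinP; apply: measurable_fun_mulmx; exact/measurable_EFinP.
rewrite /= (Gmx_integral (f := fun v => `|(f v)%:E|%E))//; last exact: measurableT_comp.
by rewrite lte_mul_pinfty// ?lee_fin ?ltW.
Qed.

Lemma Gmx_Rintegral (f : V -> R) : M.-integrable setT (EFin \o f) ->
  \int[M]_v f (A *m v) = a * \int[M]_v f v.
Proof.
move=> fi; have [_ _ eM] := GA.
have mf : measurable_fun setT f by apply/measurable_EFinP; exact: measurable_int fi.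
rewrite -(Rintegral_push mf); last exact: Gmx_integrable.
rewrite -(Rintegral_mscale (NngNum (ltW a0)) fi) /Rintegral; congr fine.
by apply: eq_measure_integral => E mE _; exact: eM.
Qed.

Lemma Gmx_vintegrable (F : V -> V) : vintegrable M F -> vintegrable M (fun v => F (A *m v)).
Proof. by move=> iF i; exact: (Gmx_integrable (iF i)). Qed.

Lemma Gmx_vint (F : V -> V) : vintegrable M F -> vint M (fun v => F (A *m v)) = a *: vint M F.
Proof. by move=> iF; apply/matrixP => i j; rewrite !mxE (Gmx_Rintegral (iF i)). Qed.

End fixed_operator.

Lemma Gmx_integrableE a A (f : V -> R) : 0 < a -> Gmx a D M A ->
  M.-integrable setT (EFin \o (fun v => f (A *m v))) -> M.-integrable setT (EFin \o f).
Proof.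
move=> a0 GA fi; have [uA _ _] := GA; have Vi : 0 < a^-1 by rewrite invr_gt0.
have := Gmx_integrable Vi (GmxV a0 GA) fi.
by under [in X in EFin \o X]eq_fun do rewrite mulKVmx//.
Qed.

Section truncation.
Hypothesis lM : levy_measure M.
Implicit Type psi : V -> R.

(* A truncation replacing [1 / (1 + |v|^2)] in the Levy-Khintchine formula. *)
Definition truncation psi : Prop :=
  measurable_fun setT psi /\ vintegrable M (fun v => (lphi v - psi v) *: v).

Definition tshift psi : V := vint M (fun v => (lphi v - psi v) *: v).

Definition beta psi A : V := vint M (fun v => (psi (A *m v) - psi v) *: (A *m v)).

(** Each of the three terms on the right is integrable by itself, so the identity yields both the
    integrability of the integrand of [beta] and its comparison with [corr]. *)
Let corr_splitE psi A v :
  (psi (A *m v) - psi v) *: (A *m v) =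
  (lphi (A *m v) - lphi v) *: (A *m v) -
  (lphi (A *m v) - psi (A *m v)) *: (A *m v) + A *m ((lphi v - psi v) *: v).
Proof.
rewrite -scalemxAr -!scalerBl -scalerDl; congr (_ *: _); ring.
Qed.

Lemma vintegrable_beta psi a A : 0 < a -> Gmx a D M A -> truncation psi ->
  vintegrable M (fun v => (psi (A *m v) - psi v) *: (A *m v)).
Proof.
move=> a0 GA [mpsi ipsi].
rewrite (_ : (fun _ => _) = fun v => (lphi (A *m v) - lphi v) *: (A *m v) -
  (lphi (A *m v) - psi (A *m v)) *: (A *m v) + A *m ((lphi v - psi v) *: v)); last first.
  by apply/funext => v; exact: corr_splitE.
apply: vintegrableD; last exact: vintegrable_mulmx.
apply: vintegrableB; first exact: vintegrable_corr.
exact: (Gmx_vintegrable a0 GA ipsi).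
Qed.

Lemma corrE psi a A : 0 < a -> Gmx a D M A -> truncation psi ->
  corr A M = beta psi A + a *: tshift psi - A *m tshift psi.
Proof.
move=> a0 GA [mpsi ipsi].
rewrite /beta (@eq_vint _ _ _ _ (fun v => (lphi (A *m v) - lphi v) *: (A *m v) -
  (lphi (A *m v) - psi (A *m v)) *: (A *m v) + A *m ((lphi v - psi v) *: v)));
  last by move=> v; exact: corr_splitE.
have i1 := vintegrable_corr A lM.
have i2 := Gmx_vintegrable a0 GA ipsi.
have i3 := vintegrable_mulmx A ipsi.
rewrite vintD//; last exact: vintegrableB.
rewrite vintB// vint_mulmx// (Gmx_vint a0 GA ipsi) -/(tshift psi) -/(corr A M).
by rewrite addrAC addrK subrK.
Qed.

(* x is the centering vector relative to psi: x = m + h - tshift psi. *)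
Lemma centering_beta psi a A m h : 0 < a -> Gmx a D M A -> truncation psi ->
  A *m (m + h) + corr A M = a *: (m + h) <->
  A *m (m + h - tshift psi) + beta psi A = a *: (m + h - tshift psi).
Proof.
move=> a0 GA tpsi; rewrite (corrE a0 GA tpsi) mulmxBr scalerBr.
set c := tshift psi; set y := m + h; set b := beta psi A.
have -> : A *m y + (b + a *: c - A *m c) = (A *m y - A *m c + b) + a *: c.
  by rewrite -!addrA; congr (_ + _); rewrite addrA addrC.
by split => [e|->]; [rewrite -e addrK|rewrite subrK].
Qed.

End truncation.
End invariance.

Section range_orthogonal.
Context {R : realType} {n : nat}.
Implicit Types (z w x : 'cV[R]_n).

(** A row lies in the row space of [B^T] as soon as it annihilates the cokernel matrix, and the
    columns of that matrix lie in the kernel of [B^T]. *)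
Lemma range_orthP (B : 'M[R]_n) z :
  (exists x, B *m x = z) <-> (forall w, B^T *m w = 0 -> dot z w = 0).
Proof.
split=> [[x <-] w Bw|h]; first by rewrite dot_mulmxl Bw dot0r.
have : (z^T <= B^T)%MS.
  rewrite submxE; apply/eqP/matrixP => i j; rewrite !ord1 [RHS]mxE.
  have -> : (z^T *m cokermx B^T) 0 j = dot z (col j (cokermx B^T)).
    by rewrite dotE !mxE; apply: eq_bigr => k _; rewrite !mxE.
  by apply: h; rewrite colE mulmxA mulmx_coker mul0mx.
by move=> /submxP[y e]; exists y^T; rewrite -[LHS]trmxK trmx_mul trmxK -e trmxK.
Qed.

End range_orthogonal.

Section unit_ball.
Context {R : realType} {n : nat}.
Notation V := 'cV[R]_n.

Lemma measurable_unit_ball : measurable [set v : V | enorm v <= 1].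
Proof.
have e : [set v : V | enorm v <= 1] = @enorm R n @^-1` `]-oo, 1].
  by apply/seteqP; split => v /=; rewrite in_itv.
rewrite e -[X in measurable X]setTI.
exact: (measurable_enorm measurableT (measurable_itv _)).
Qed.

End unit_ball.

(** * The discrete case *)

Section discrete.
Context {R : realType} {n : nat}.
Notation V := 'cV[R]_n.
Implicit Types (u v w x : V) (A B D : 'M[R]_n) (a b : R).
Variables (D : 'M[R]_n) (M : {measure set V -> \bar R}).
Hypothesis lM : levy_measure M.

Lemma truncation_le (psi : V -> R) c : measurable_fun setT psi ->
  (forall v, `|lphi v - psi v| * enorm v <= c * lkern v) -> truncation M psi.
Proof.
move=> mpsi h; split => //; apply: (@le_vintegrable _ _ _ _ (fun v => c * lkern v)).
- move=> i; under eq_fun do rewrite mxE; apply: measurable_funM; last exact: measurable_coord.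
  by apply: measurable_funB => //; exact: measurable_lphi.
- by move=> v; rewrite enormZ.
- exact: integrable_lkern.
Qed.

Definition ball1 (v : V) : R := \1_[set v : V | enorm v <= 1] v.

Lemma ball1E v : ball1 v = (enorm v <= 1)%R%:R.
Proof.
rewrite /ball1 indicE; have [v1|v1] := boolP (enorm v <= 1).
  by rewrite mem_set.
by rewrite memNset//= (negbTE v1).
Qed.

Lemma truncation_ball1 : truncation M ball1.
Proof.
apply: (@truncation_le _ 1); first by apply: measurable_indic; exact: measurable_unit_ball.
move=> v; rewrite mul1r ball1E; have [v1|v1] := boolP (enorm v <= 1).
  by rewrite distrC -lkernE ger0_norm ?lkern_ge0// ler_piMr ?lkern_ge0.
move: v1; rewrite -ltNge => /ltW v1.
by rewrite subr0 gtr0_norm ?lphi_gt0// mulrC enorm_lphi_big.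
Qed.

Variables (a : R) (A : 'M[R]_n).
Hypotheses (a0 : 0 < a) (GA : Gmx a D M A) (A1 : opnorm A < 1).

Definition zmean : V := vint M (fun u => \1_(Z_set A) u *: u).

(** Because |A v| <= |v|, the ball indicator can only jump from 0 to 1, and it does so exactly when
    |A v| <= 1 < |v|, that is, when [A v] lies in [Z_set A]. *)
Let beta_integrand v :
  (ball1 (A *m v) - ball1 v) *: (A *m v) = \1_(Z_set A) (A *m v) *: (A *m v).
Proof.
congr (_ *: _); rewrite !ball1E indicE; have [uA _ _] := GA.
have Av : enorm (A *m v) <= enorm v.
  by rewrite (le_trans (opnorm_ub _ _))// ler_piMl ?enorm_ge0// ltW.
have [v1|v1] := boolP (enorm v <= 1).
  rewrite (le_trans Av v1) subrr memNset// => -[_].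
  by rewrite mulKmx// ltNge v1.
have [Av1|Av1] := boolP (enorm (A *m v) <= 1).
  by rewrite subr0 mem_set//; split => //; rewrite mulKmx// ltNge.
by rewrite subrr memNset// => -[]; rewrite (negbTE Av1).
Qed.

(** Transported back through [A] from the integrability of the integrand of [beta], which is a
    function of [A v]. *)
Lemma vintegrable_zmean : vintegrable M (fun u => \1_(Z_set A) u *: u).
Proof.
move=> i; apply: (Gmx_integrableE a0 GA).
have := vintegrable_beta lM a0 GA truncation_ball1 i.
by under eq_fun do rewrite beta_integrand.
Qed.

Lemma beta_ball1 : beta M ball1 A = a *: zmean.
Proof.
rewrite /beta (@eq_vint _ _ _ _ _ beta_integrand).
exact: (Gmx_vint a0 GA vintegrable_zmean).
Qed.

Lemma integral_Z_set w : (\int[M]_(u in Z_set A) (dot u w)%:E = (dot zmean w)%:E)%E.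
Proof.
rewrite vint_dot; last exact: vintegrable_zmean.
have iw := vintegrable_dot w vintegrable_zmean.
rewrite /Rintegral fineK; last exact: (integrable_fin_num measurableT iw).
rewrite [LHS]integral_mkcond; apply: eq_integral => v _; rewrite dotZl /patch indicE.
by case: ifP; rewrite ?mul1r ?mul0r.
Qed.

Lemma balanced_discreteP :
  (forall w, nullspace (A^T - a%:M) w -> (\int[M]_(u in Z_set A) (dot u w)%:E = 0)%E) <->
  (exists x, A *m x + beta M ball1 A = a *: x).
Proof.
transitivity (exists x, (A - a%:M) *m x = - (a *: zmean)); last first.
  rewrite beta_ball1; split=> -[x e]; exists x.
    move: e; rewrite mulmxBl mul_scalar_mx => /eqP; rewrite subr_eq => /eqP ->.
    by rewrite addrAC addNr add0r.
  by rewrite mulmxBl mul_scalar_mx -e opprD addrA subrr sub0r.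
rewrite range_orthP linearB /= tr_scalar_mx; split=> h w hw.
  have := h w hw; rewrite integral_Z_set => -[].
  by rewrite dotNl dotZl => ->; rewrite mulr0 oppr0.
rewrite integral_Z_set; congr EFin; apply/eqP; move: (h w hw) => /eqP.
by rewrite dotNl dotZl oppr_eq0 mulf_eq0 (gt_eqF a0).
Qed.

End discrete.

(** * Subspaces as ranges of matrices, and invariant projections *)

Section linear_algebra.
Context {R : realType} {n : nat}.
Notation V := 'cV[R]_n.
Implicit Types (u v w x y : V) (A B P Q W X : 'M[R]_n).

(** Take a matrix of maximal rank among those with range in [F]: a vector of [F] outside its range
    could be adjoined and would raise the rank. *)
Lemma subspace_basis (F : V -> Prop) : F 0 -> (forall x y, F x -> F y -> F (x + y)) ->
  (forall a x, F x -> F (a *: x)) ->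
  exists W, (forall y, F (W *m y)) /\ (forall x, F x -> exists y, x = W *m y).
Proof.
move=> F0 FD FZ.
pose p k := `[< exists W, (forall y, F (W *m y)) /\ \rank W = k >].
have p0 : exists k, p k.
  by exists 0%N; apply/asboolP; exists 0; split => [y|]; rewrite ?mul0mx ?mxrank0.
have pn k : p k -> (k <= n)%N by move=> /asboolP[W [_ <-]]; exact: rank_leq_row.
case: (ex_maxnP p0 pn) => k /asboolP[W [FW rW]] kmax.
exists W; split => // x Fx.
have [|nxW] := boolP (x^T <= W^T)%MS.
  by move=> /submxP[y e]; exists y^T; rewrite -[LHS]trmxK e trmx_mul trmxK.
pose W' : 'M[R]_n := ((W^T + x^T)%MS)^T.
have FW' y : F (W' *m y).
  have -> : W' *m y = (y^T *m (W^T + x^T)%MS)^T by rewrite trmx_mul trmxK.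
  have /sub_addsmxP[[u1 u2] ->] := submxMl y^T (W^T + x^T)%MS.
  rewrite /= linearD /= !trmx_mul !trmxK; apply: FD; first exact: FW.
  by rewrite [u2^T]mx11_scalar mul_mx_scalar; exact: FZ.
have : p (\rank W') by apply/asboolP; exists W'.
move=> /kmax; rewrite -rW /W' mxrank_tr -[\rank W]mxrank_tr leqNgt => /negP[].
rewrite ltn_neqAle mxrankS ?addsmxSl// andbT; apply/negP => /eqP e.
have : (W^T + x^T <= W^T)%MS by rewrite -(geq_leqif (mxrank_leqif_sup (addsmxSl _ _))) e.
by rewrite addsmx_sub (negbTE nxW) andbF.
Qed.

Section positive_definite.
Variable Q : 'M[R]_n.
Hypothesis QT : Q^T = Q.
Hypothesis Q0 : forall u, 0 <= dot (Q *m u) u.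
Hypothesis Qdef : forall u, dot (Q *m u) u = 0 -> u = 0.

Lemma kernel0_unitmx A : (forall u, A *m u = 0 -> u = 0) -> A \in unitmx.
Proof.
move=> A0; rewrite -unitmx_tr -row_free_unit -kermx_eq0.
apply/eqP/row_matrixP => i; rewrite row0; apply/trmx_inj; rewrite trmx0.
by apply: A0; apply/trmx_inj; rewrite trmx_mul trmxK -row_mul mulmx_ker row0 trmx0.
Qed.

Lemma posdef_unitmx : Q \in unitmx.
Proof. by apply: kernel0_unitmx => u Qu; apply: Qdef; rewrite Qu dot0l. Qed.

Let Qsym u w : dot (Q *m u) w = dot (Q *m w) u.
Proof. by rewrite dot_mulmxl QT dotC. Qed.

Lemma posdef_cauchy_schwarz u w :
  dot (Q *m u) w ^+ 2 <= dot (Q *m u) u * dot (Q *m w) w.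
Proof.
have [->|w0] := eqVneq w 0; first by rewrite dot0r expr0n mulmx0 dot0l mulr0.
have z0 : 0 < dot (Q *m w) w.
  by rewrite lt_def Q0 andbT; apply: contra w0 => /eqP /Qdef ->.
have := Q0 (dot (Q *m w) w *: u - dot (Q *m u) w *: w).
rewrite mulmxBr -!scalemxAr !dotBl !dotBr !dotZl !dotZr (Qsym w u).
set p := dot (Q *m u) u; set y := dot (Q *m u) w; set z := dot (Q *m w) w => h.
have : 0 <= z * (p * z - y ^+ 2).
  by apply: le_trans h _; rewrite le_eqVlt; apply/orP; left; apply/eqP; ring.
by rewrite pmulr_rge0// subr_ge0.
Qed.

(** Cauchy-Schwarz for the form [Q] at the pair u, Q u bounds |Q u|^2 by a multiple of (Q u, u), and
    invertibility bounds |u| by a multiple of |Q u|. The added 1 keeps the constant positive when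
    the matrix bounds vanish. *)
Lemma posdef_lower_bound : exists2 d : R, 0 < d & forall u, d * dot u u <= dot (Q *m u) u.
Proof.
pose b := mxbound Q; pose b' := mxbound (invmx Q).
have b0 : 0 <= b := mxbound_ge0 _; have b'0 : 0 <= b' := mxbound_ge0 _.
have K0 : 0 < b' ^+ 2 * b + 1 by rewrite ltr_wpDl// mulr_ge0// sqr_ge0.
exists (b' ^+ 2 * b + 1)^-1; first by rewrite invr_gt0.
move=> u; rewrite mulrC ler_pdivrMr//.
have h1 : dot (Q *m u) (Q *m u) <= b * dot (Q *m u) u.
  have := posdef_cauchy_schwarz u (Q *m u).
  have [->|nz] := eqVneq (dot (Q *m u) (Q *m u)) 0; first by rewrite mulr_ge0.
  have z0 : 0 < dot (Q *m u) (Q *m u) by rewrite lt_def nz dot_ge0.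
  move=> h; rewrite -(ler_pM2l z0) -expr2 (le_trans h)//.
  rewrite mulrC [leRHS]mulrA ler_wpM2r// mulrC.
  rewrite (le_trans (ler_norm _))// (le_trans (cauchy_schwarz _ _))//.
  rewrite (le_trans (ler_wpM2r (enorm_ge0 _) (enorm_mulmx Q _)))//.
  by rewrite -mulrA -expr2 enorm_sq.
have h2 : dot u u <= b' ^+ 2 * dot (Q *m u) (Q *m u).
  rewrite -!enorm_sq -exprMn lerXn2r ?nnegrE ?mulr_ge0 ?enorm_ge0//.
  by rewrite -{1}(mulKmx posdef_unitmx u) enorm_mulmx.
apply: (le_trans h2); rewrite mulrDr mulr1.
apply: (@le_trans _ _ (b' ^+ 2 * (b * dot (Q *m u) u))).
  by rewrite ler_wpM2l ?sqr_ge0.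
by rewrite mulrA mulrC lerDl.
Qed.

Section invariant_projection.
Variable S : 'M[R]_n -> Prop.
Hypothesis Su : forall s, S s -> s \in unitmx.
Hypothesis SQ : forall s, S s -> s *m Q *m s^T = Q.

(** The identity s Q s^T = Q says that [s] is orthogonal for the inner product given by the inverse
    of [Q]. [P] is the projection onto the common fixed vectors that is orthogonal for this inner
    product; it takes the place of an average over [S]. The four conclusions together characterize
    it. *)
Lemma invariant_projection : exists P,
  [/\ forall s, S s -> s *m P = P,
      forall s, S s -> P *m s = P,
      forall k (X : 'M[R]_(n, k)), (forall s, S s -> s *m X = X) -> P *m X = X &
      forall X, (forall s, S s -> X *m s = X) -> X *m P = X].
Proof.
have [||| W [FW WF]] := @subspace_basis (fun x => forall s, S s -> s *m x = x).
- by move=> s _; rewrite mulmx0.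
- by move=> x y hx hy s Ss; rewrite mulmxDr hx// hy.
- by move=> a x hx s Ss; rewrite -scalemxAr hx.
have QiT : (invmx Q)^T = invmx Q by rewrite trmx_inv QT.
(* Subspaces are row spaces here, hence the transposes: [U] is the fixed space and [Vc] its
   orthogonal complement for the inverse of [Q]. *)
pose U := W^T; pose Vc := kermx (invmx Q *m W).
have uQ := posdef_unitmx.
have UV : (U :&: Vc = 0)%MS.
  apply/eqP/rowV0P => x; rewrite sub_capmx => /andP[/submxP[y ex] /sub_kermxP xV].
  have : dot (Q *m (invmx Q *m x^T)) (invmx Q *m x^T) = 0.
    rewrite mulKVmx// dotE trmxK.
    suff -> : x *m (invmx Q *m x^T) = 0 by rewrite mxE.
    by rewrite {2}ex trmx_mul trmxK !mulmxA -(mulmxA x) xV mul0mx.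
  by move=> /Qdef e; apply/trmx_inj; rewrite trmx0 -(mulKVmx uQ x^T) e mulmx0.
have full : (1%:M <= U + Vc)%MS.
  apply: submx_full; rewrite /row_full.
  have := mxrank_sum_cap U Vc; rewrite UV mxrank0 addn0 => ->.
  rewrite /U mxrank_tr /Vc mxrank_ker eqmxMfull ?row_full_unit ?unitmx_inv//.
  by rewrite subnKC// rank_leq_row.
pose P := (proj_mx U Vc)^T.
have PX k (X : 'M[R]_(n, k)) : (forall s, S s -> s *m X = X) -> P *m X = X.
  move=> sX; rewrite -[LHS]trmxK trmx_mul trmxK proj_mx_id ?trmxK//.
  apply/row_subP => i; rewrite -tr_col.
  have [|y ->] := WF (col i X); first by move=> s Ss; rewrite colE mulmxA sX.
  by rewrite trmx_mul submxMl.
have sP s : S s -> s *m P = P.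
  move=> Ss; apply/trmx_inj; rewrite trmx_mul trmxK.
  have /submxP[Y ->] : (proj_mx U Vc <= U)%MS by rewrite -[proj_mx _ _]mul1mx proj_mx_sub.
  rewrite -mulmxA -trmx_mul; congr (_ *m _^T).
  by apply/matrixP => i j; have := FW (delta_mx j 0) s Ss; rewrite mulmxA -!colE => /matrixP /(_ i 0); rewrite !mxE.
have Ps s : S s -> P *m s = P.
  move=> Ss; apply/trmx_inj; rewrite trmx_mul trmxK; apply/eqP.
  rewrite -subr_eq0 -{2}[proj_mx _ _]mul1mx -mulmxBl; apply/eqP/proj_mx_0 => //.
  apply/sub_kermxP; rewrite mulmxBl mul1mx.
  (* The adjoint of [s] is its inverse, so s x - x is orthogonal to every fixed vector. *)
  have -> : s^T = invmx Q *m invmx s *m Q.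
    by rewrite -(mulKmx uQ s^T) -(mulKmx (Su Ss) (Q *m s^T)) (mulmxA s) SQ// mulmxA.
  rewrite !mulmxA mulmxK// -mulmxA.
  have sW : s *m W = W.
    apply/matrixP => i j; have := FW (delta_mx j 0) s Ss.
    by rewrite mulmxA -!colE => /matrixP /(_ i 0); rewrite !mxE.
  by rewrite -{1}sW mulKmx ?Su// subrr.
exists P; split => // X Xs.
have QXT : forall s, S s -> s *m (Q *m X^T) = Q *m X^T.
  move=> s Ss; have := SQ Ss => e.
  rewrite -{2}e -!mulmxA; congr (_ *m (_ *m _)).
  by rewrite -trmx_mul Xs.
have [Y eY] : exists Y, Q *m X^T = W *m Y.
  have /submxP[Y eY] : ((Q *m X^T)^T <= W^T)%MS.
    apply/row_subP => i; rewrite -tr_col.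
    have [|y ->] := WF (col i (Q *m X^T)); last by rewrite trmx_mul submxMl.
    by move=> s Ss; rewrite colE mulmxA QXT.
  by exists Y^T; rewrite -[LHS]trmxK eY trmx_mul trmxK.
have eX : X = Y^T *m W^T *m invmx Q.
  apply/trmx_inj; rewrite !trmx_mul !trmxK QiT -eY mulKmx//.
apply/eqP; rewrite -subr_eq0 -{2}[X]mulmx1 -mulmxBr -oppr_eq0 -mulmxN opprB.
apply/eqP/trmx_inj; rewrite trmx_mul trmx0 linearB /= trmx1 trmxK.
have : (1%:M - 1%:M *m proj_mx U Vc <= Vc)%MS by exact: proj_mx_compl_sub.
rewrite mul1mx => /sub_kermxP h.
by rewrite eX !trmx_mul !trmxK QiT !mulmxA -(mulmxA _ _ W) h mul0mx.
Qed.

End invariant_projection.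
End positive_definite.
End linear_algebra.

Section ae_zero.
Context d (T : measurableType d) (R : realType) (mu : {measure set T -> \bar R}).

Lemma Rintegral_eq0_null (f : T -> R) : mu.-integrable setT (EFin \o f) ->
  (forall x, 0 <= f x) -> \int[mu]_x f x = 0 -> mu [set x | f x != 0] = 0%E.
Proof.
move=> fi f0 If; have mf := measurable_int _ fi.
have : (\int[mu]_x `|(f x)%:E| = 0)%E.
  under eq_integral do rewrite gee0_abs ?lee_fin//.
  by rewrite -[LHS]fineK ?(integrable_fin_num measurableT fi)// -/(Rintegral _ _ _) If.
move/(ae_eq_integral_abs mu measurableT mf).1 => [N [mN N0 sN]].
apply/eqP; rewrite -measure_le0 -[leRHS]N0 le_measure ?inE//.
  rewrite (_ : [set x | _] = f @^-1` (~` [set 0])); last first.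
    by apply/seteqP; split => x /= /eqP.
  have mf' : measurable_fun setT f by exact/measurable_EFinP.
  rewrite -[X in measurable X]setTI; apply: mf' => //.
  by apply: measurableC; exact: measurable_set1.
move=> x /= fx; apply: sN => /= h; move/negP: fx; apply.
by have [->] := h I.
Qed.

Lemma Rintegral_null (N : set T) (f : T -> R) : mu.-integrable setT (EFin \o f) ->
  measurable N -> mu N = 0%E -> (forall x, ~ N x -> f x = 0) ->
  \int[mu]_x f x = 0.
Proof.
move=> fi mN N0 fN.
have -> : \int[mu]_x f x = \int[mu]_(x in N) f x.
  rewrite [RHS]Rintegral_mkcond; apply: eq_Rintegral => x _.
  by rewrite /patch; case: ifPn => // /negP; rewrite inE => /fN.
rewrite /Rintegral null_set_integral//.
by apply: measurable_funTS; exact: (measurable_int mu fi).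
Qed.

Lemma null_bigcup (N : (set T)^nat) : (forall k, measurable (N k)) ->
  (forall k, mu (N k) = 0%E) -> mu (\bigcup_k N k) = 0%E.
Proof.
move=> mN N0; apply: measure_negligible; first exact: bigcupT_measurable.
by apply: negligible_bigcup => k; exists (N k); split => //; exact: N0.
Qed.

End ae_zero.

(** * Full measures and their symmetry group *)

Section fullness.
Context {R : realType} {n : nat}.
Notation V := 'cV[R]_n.
Implicit Types (u v w m h : V) (A D : 'M[R]_n) (mu : probability V R)
  (M : {measure set V -> \bar R}).

(** On each set of the union the nonnegative function 1 - cos is nonzero, so nullity can be read off
    integrals. *)
Lemma dot_ne0E u c : [set v : V | dot v u - c != 0] =
  \bigcup_k [set v | cos (k.+1%:R^-1 * (dot v u - c)) != 1].
Proof.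
apply/seteqP; split => v /=; first by move=> /cos_neq1_small[k hk]; exists k.
by move=> [k _]; apply: contra => /eqP ->; rewrite mulr0 cos0.
Qed.

Lemma measurable_dot_ne0 u c : measurable [set v : V | dot v u - c != 0].
Proof.
rewrite (_ : [set v | _] = (fun v => dot v u - c) @^-1` (~` [set 0])); last first.
  by apply/seteqP; split => v /= /eqP.
have mf : measurable_fun setT (fun v => dot v u - c).
  by apply: measurable_funB => //; exact: measurable_dot.
rewrite -[X in measurable X]setTI; apply: mf => //.
by apply: measurableC; exact: measurable_set1.
Qed.

Lemma full_dot mu u c : full mu -> mu [set v | dot v u - c != 0] = 0%E -> u = 0.
Proof.
move=> fmu mu0; apply: contrapT => /eqP u0.
have uu : dot u u != 0 by rewrite dot_eq0.
pose f : 'Hom('cV[R]_n, 'M[R]_(1, 1)) := linfun (mulmx u^T).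
have fE v : f v = (dot v u)%:M.
  by rewrite lfunE /= [LHS]mx11_scalar dotC dotE.
(* The hyperplane (v, u) = c is the kernel of the linear form translated by (c / |u|^2) u. *)
have /(fmu ((c / dot u u) *: u))/eqP : lker f != fullv.
  apply/negP => /eqP e; have : u \in lker f by rewrite e memvf.
  rewrite memv_ker fE => /eqP /matrixP /(_ 0 0); rewrite !mxE eqxx mulr1n => /eqP.
  by rewrite (negbTE uu).
apply.
have -> : [set v | v - (c / dot u u) *: u \in lker f] = ~` [set v | dot v u - c != 0].
  apply/seteqP; split => v /=; rewrite memv_ker fE dotBl dotZl divfK//.
    by move=> /eqP /matrixP /(_ 0 0); rewrite !mxE eqxx mulr1n => ->; rewrite eqxx.
  by move=> /negP; rewrite negbK => /eqP ->; apply/eqP/matrixP => i j; rewrite !mxE mul0rn.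
by rewrite probability_setC ?mu0 ?sube0//; exact: measurable_dot_ne0.
Qed.

(** If neither [D] nor [M] sees the direction [u], the Fourier transform of [mu] on the line through
    [u] is that of a point mass. Then (v, u) = (m, u) almost surely, which for u <> 0 puts [mu] on a
    hyperplane. *)
Lemma levy_null_full mu m D M u : full mu -> levy_khintchine mu m D M ->
  dot (D *m u) u = 0 -> M [set v | dot v u != 0] = 0%E -> u = 0.
Proof.
move=> fmu /levy_khintchineE[[DT D0] lM e] Du Mu.
have mN : measurable [set v : V | dot v u != 0].
  have := measurable_dot_ne0 u 0; congr measurable.
  by apply/seteqP; split => v /=; rewrite subr0.
have h t : lk_re D M (t *: u) = 0 /\ lk_im m M (t *: u) = t * dot m u.
  rewrite /lk_re /lk_im -scalemxAr !dotZl !dotZr Du !mulr0 subr0.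
  split.
    apply: (Rintegral_null (N := [set v | dot v u != 0])) => //.
      exact: integrable_eta_re.
    by move=> v /negP; rewrite negbK => /eqP vu; rewrite /eta_re dotZr vu mulr0 cos0 subrr.
  rewrite (Rintegral_null (N := [set v | dot v u != 0])) ?addr0//.
    exact: integrable_eta_im.
  by move=> v /negP; rewrite negbK => /eqP vu; rewrite /eta_im dotZr vu mulr0 sin0 mul0r subrr.
apply: (@full_dot mu u (dot m u) fmu); rewrite dot_ne0E.
have mcos t : measurable_fun setT (fun v : V => cos (t * (dot v u - dot m u))).
  apply: measurableT_comp.
    by apply: continuous_measurable_fun; exact: continuous_cos.
  by apply: measurable_funM => //; apply: measurable_funB => //; exact: measurable_dot.
apply: null_bigcup => k.
  rewrite (_ : [set v | _] = (fun v => cos (k.+1%:R^-1 * (dot v u - dot m u))) @^-1` (~` [set 1])).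
    rewrite -[X in measurable X]setTI; apply: mcos => //.
    by apply: measurableC; exact: measurable_set1.
  by apply/seteqP; split => v /= /eqP.
set t := k.+1%:R^-1.
have -> : [set v : V | cos (t * (dot v u - dot m u)) != 1] =
          [set v | 1 - cos (t * (dot v u - dot m u)) != 0].
  by apply/seteqP; split => v /=; rewrite subr_eq0 eq_sym.
have fin : (mu setT < +oo)%E by rewrite [X in (X < _)%E]probability_setT ltry.
have icos : mu.-integrable setT (EFin \o (fun v : V => cos (t * (dot v u - dot m u)))).
  by apply: (integrable_bounded (B := 1)) => // v _; exact: cos_max.
apply: Rintegral_eq0_null.
- by apply: integrableRB => //; apply: (integrable_bounded (B := 1)) => // v _; rewrite normr1.
- by move=> v; exact: cosB1_ge0.
rewrite RintegralB//; last by apply: (integrable_bounded (B := 1)) => // v _; rewrite normr1.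
rewrite Rintegral_cst// [X in fine X]probability_setT mulr1.
have -> : \int[mu]_v cos (t * (dot v u - dot m u)) =
    cos (t * dot m u) * \int[mu]_v cos (dot v (t *: u)) +
    sin (t * dot m u) * \int[mu]_v sin (dot v (t *: u)).
  rewrite -!RintegralZl//; do ?[exact: integrable_cos_dot|exact: integrable_sin_dot].
  rewrite -RintegralD//; last 2 first.
  - by apply: integrableRZ => //; exact: integrable_cos_dot.
  - by apply: integrableRZ => //; exact: integrable_sin_dot.
  by apply: eq_Rintegral => v _; rewrite dotZr mulrBr cosB; ring.
have [-> ->] := e (t *: u); have [-> ->] := h t.
by rewrite expR0 !mul1r -!expr2 cos2Dsin2 subrr.
Qed.

(** [- lk_re] is a sum of two nonnegative terms, a Gaussian one and a cosine integral. If it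
    vanishes on the whole line, both do, and [M] has no mass off the hyperplane orthogonal to
    [u]. *)
Lemma lk_re_full mu m D M u : full mu -> levy_khintchine mu m D M ->
  (forall t, lk_re D M (t *: u) = 0) -> u = 0.
Proof.
move=> fmu lmu l0; have /levy_khintchineE[[DT D0] lM _] := lmu.
have h t : dot (D *m (t *: u)) (t *: u) = 0 /\ M [set v | eta_re (t *: u) v != 0] = 0%E.
  have i1 := integrable_eta_re lM (t *: u).
  have i0 : \int[M]_v (- eta_re (t *: u) v) = - \int[M]_v eta_re (t *: u) v.
    under eq_Rintegral => v _ do rewrite -mulN1r.
    by rewrite RintegralZl// mulN1r.
  have p0 : 0 <= \int[M]_v (- eta_re (t *: u) v).
    by apply: Rintegral_ge0 => v _; rewrite opprB cosB1_ge0.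
  have d0 := D0 (t *: u); have := l0 t; rewrite /lk_re => l.
  have z : \int[M]_v (- eta_re (t *: u) v) = 0 by rewrite i0 in p0 *; lra.
  split; first by rewrite i0 in z; lra.
  rewrite (_ : [set v | _] = [set v | - eta_re (t *: u) v != 0]); last first.
    by apply/seteqP; split => v /=; rewrite oppr_eq0.
  apply: Rintegral_eq0_null => //.
    have := integrableRZ (-1) measurableT i1.
    by under eq_fun do rewrite mulN1r.
  by move=> v; rewrite opprB cosB1_ge0.
apply: (levy_null_full fmu lmu); first by have [+ _] := h 1; rewrite scale1r.
have -> : [set v | dot v u != 0] = [set v | dot v u - 0 != 0].
  by apply/seteqP; split => v /=; rewrite subr0.
rewrite dot_ne0E.
have -> : \bigcup_k [set v | cos (k.+1%:R^-1 * (dot v u - 0)) != 1] =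
          \bigcup_k [set v | eta_re (k.+1%:R^-1 *: u) v != 0].
  by apply: eq_bigcupr => k _; apply/seteqP; split => v /=; rewrite /eta_re dotZr subr0 subr_eq0.
apply: null_bigcup => k; last by have [_ +] := h k.+1%:R^-1.
rewrite (_ : [set v | _] = eta_re (k.+1%:R^-1 *: u) @^-1` (~` [set 0])).
  rewrite -[X in measurable X]setTI; apply: measurable_eta_re => //.
  by apply: measurableC; exact: measurable_set1.
by apply/seteqP; split => v /= /eqP.
Qed.

(** If A^T u = 0, the translated image measure is a point mass in the direction [u], so its Fourier
    transform has modulus 1 on the line through [u]; by the power relation [lk_re] of [mu] vanishes
    there. *)
Lemma full_Gset_unitmx mu a A : full mu -> 0 < a -> Gset a mu A -> A \in unitmx.
Proof.
move=> fmu a0 [h [m [D [M [a0' [lmu lnu]]]]]].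
rewrite -unitmx_tr; apply: kernel0_unitmx => u Au.
apply: (lk_re_full fmu lmu) => t.
have /levy_khintchineE[_ lM _] := lmu.
have /levy_khintchineE[_ _ /(_ (t *: u))[]] := lnu.
rewrite cos_conv_pmass sin_conv_pmass !cos_image !sin_image -!scalemxAr Au scaler0.
have fin : (mu setT < +oo)%E by rewrite [X in (X < _)%E]probability_setT ltry.
have -> : \int[mu]_v cos (dot v 0) = 1.
  under eq_Rintegral => v _ do rewrite dot0r cos0.
  by rewrite Rintegral_cst// [X in fine X]probability_setT mulr1.
have -> : \int[mu]_v sin (dot v 0) = 0.
  under eq_Rintegral => v _ do rewrite dot0r sin0.
  by rewrite Rintegral_cst// mul0r.
rewrite !mulr1 !mulr0 subr0 add0r => e1 e2.
have E : expR (lk_re (a *: D) (mscale (NngNum a0') M) (t *: u)) ^+ 2 = 1.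
  have := cos2Dsin2 (dot h (t *: u)); rewrite e1 e2 !exprMn -mulrDr cos2Dsin2 mulr1.
  by [].
have : lk_re (a *: D) (mscale (NngNum a0') M) (t *: u) = 0.
  apply: expR_inj; rewrite expR0; apply/eqP; rewrite -(@eqrXn2 _ 2) ?expR_ge0//.
  by rewrite E expr1n.
rewrite /lk_re Rintegral_mscale; last exact: integrable_eta_re.
rewrite /= -scalemxAl dotZl => E2.
have : a * lk_re D M (t *: u) = 0 by rewrite /lk_re -[RHS]E2; ring.
by move=> /eqP; rewrite mulf_eq0 (gt_eqF a0) => /eqP.
Qed.

End fullness.

Section gram_matrix.
Context {R : realType} {n : nat}.
Notation V := 'cV[R]_n.
Implicit Types (u v w : V) (D : 'M[R]_n).
Variables (mu : probability V R) (m : V) (D : 'M[R]_n) (M : {measure set V -> \bar R}).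
Hypotheses (fmu : full mu) (lmu : levy_khintchine mu m D M).

Let lM : levy_measure M. Proof. by have /levy_khintchineE[_] := lmu. Qed.
Let D0 : nonneg_operator D. Proof. by have /levy_khintchineE[] := lmu. Qed.

(** Second moments of [M] with a weight that is kept below [lphi], which makes them finite. Adding
    [D] gives a form that is definite for a full measure and, for an invariant weight, invariant
    under the symmetry group. *)
Definition gram (psi : V -> R) : 'M[R]_n :=
  \matrix_(i, j) \int[M]_v (psi v * v i 0 * v j 0).

Section weight.
Variable psi : V -> R.
Hypotheses (mpsi : measurable_fun setT psi) (psi0 : forall v, 0 < psi v)
  (psi_le : forall v, psi v <= lphi v).

Let weight_le v (x y : R) : `|x| <= enorm v -> `|y| <= enorm v ->
  `|psi v * x * y| <= 1 * lkern v.
Proof.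
move=> xv yv; rewrite mul1r -mulrA normrM (gtr0_norm (psi0 v)) normrM.
have -> : lkern v = lphi v * (enorm v * enorm v) by rewrite /lkern /lphi mulrC -expr2.
by apply: ler_pM; [exact: ltW|exact: mulr_ge0|exact: psi_le|exact: ler_pM].
Qed.

Lemma vintegrable_gram u : vintegrable M (fun v => (psi v * dot v u) *: v).
Proof.
apply: (@le_vintegrable _ _ _ _ (fun v => enorm u * lkern v)).
- move=> i; under eq_fun do rewrite mxE; apply: measurable_funM; last exact: measurable_coord.
  by apply: measurable_funM => //; exact: measurable_dot.
- move=> v; rewrite enormZ normrM (gtr0_norm (psi0 v)) -mulrA.
  have -> : enorm u * lkern v = lphi v * ((enorm v * enorm u) * enorm v).
    by rewrite /lkern /lphi; ring.
  apply: ler_pM; [exact: ltW|by rewrite mulr_ge0 ?enorm_ge0|exact: psi_le|].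
  by rewrite ler_wpM2r ?enorm_ge0// cauchy_schwarz.
- exact: integrable_lkern.
Qed.

Lemma gram_mulmx u : gram psi *m u = vint M (fun v => (psi v * dot v u) *: v).
Proof.
apply/matrixP => i j; rewrite ord1 [RHS]mxE.
pose F v := (psi v * v i 0) *: v.
have iF : vintegrable M F.
  move=> k; apply: (integrable_le_lkern lM (c := 1)).
    rewrite /F; under eq_fun do rewrite mxE; apply: measurable_funM; last exact: measurable_coord.
    by apply: measurable_funM => //; exact: measurable_coord.
  by move=> v; rewrite mxE; apply: weight_le; exact: coord_le_enorm.
transitivity (dot (vint M F) u).
  rewrite mxE; apply: eq_bigr => k _; rewrite !mxE; congr (_ * _).
  by apply: eq_Rintegral => v _; rewrite mxE.
rewrite vint_dot//; apply: eq_Rintegral => v _; rewrite /F dotZl mxE; ring.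
Qed.

Lemma dot_gram u w : dot (gram psi *m u) w = \int[M]_v (psi v * dot v u * dot v w).
Proof.
rewrite gram_mulmx vint_dot; last exact: vintegrable_gram.
by apply: eq_Rintegral => v _; rewrite dotZl.
Qed.

Lemma integrable_gram u w : M.-integrable setT (EFin \o (fun v => psi v * dot v u * dot v w)).
Proof.
have := vintegrable_dot w (vintegrable_gram u).
by under eq_fun do rewrite dotZl.
Qed.

Lemma gram_sym : (D + gram psi)^T = D + gram psi.
Proof.
rewrite linearD /= D0.1; congr (_ + _); apply/matrixP => i j; rewrite !mxE.
by apply: eq_Rintegral => v _; rewrite mulrAC.
Qed.

Let gram_ge0 u : 0 <= dot (gram psi *m u) u.
Proof.
rewrite dot_gram; apply: Rintegral_ge0 => v _.
by rewrite -mulrA -expr2 mulr_ge0 ?sqr_ge0// ltW.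
Qed.

Lemma gram_nonneg u : 0 <= dot ((D + gram psi) *m u) u.
Proof. by rewrite mulmxDl dotDl addr_ge0// D0.2. Qed.

Lemma gram_definite u : dot ((D + gram psi) *m u) u = 0 -> u = 0.
Proof.
rewrite mulmxDl dotDl => e; have d0 := D0.2 u; have g0 := gram_ge0 u.
apply: (levy_null_full fmu lmu); first lra.
have -> : [set v | dot v u != 0] = [set v | psi v * dot v u * dot v u != 0].
  by apply/seteqP; split => v /=; rewrite -mulrA !mulf_eq0 (gt_eqF (psi0 v)) orbb.
apply: Rintegral_eq0_null; first exact: integrable_gram.
  by move=> v; rewrite -mulrA -expr2 mulr_ge0 ?sqr_ge0// ltW.
by rewrite -dot_gram; lra.
Qed.

End weight.

(* Bounded and comparable to [x ^+ 2] near [0]: [levy_size] is then finite, scales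
   by [a] under [A^T], and is positive off [0] when [mu] is full. *)
Definition kap (x : R) : R := x ^+ 2 / (1 + x ^+ 2).

Lemma kap_ge0 x : 0 <= kap x.
Proof. by rewrite divr_ge0 ?addr_ge0 ?sqr_ge0. Qed.

Lemma ler_kap x y : x ^+ 2 <= y ^+ 2 -> kap x <= kap y.
Proof.
have d z : 0 < 1 + z ^+ 2 :> R by rewrite ltr_pwDl// sqr_ge0.
move=> xy; rewrite /kap ler_pdivrMr// mulrAC ler_pdivlMr//.
by rewrite !mulrDr !mulr1 [y ^+ 2 * _]mulrC lerD2r.
Qed.

Lemma kap_dot_le u v : kap (dot v u) <= kap (enorm u * enorm v).
Proof.
apply: ler_kap; rewrite exprMn !enorm_sq mulrC; exact: dot_sqr_le.
Qed.

Lemma kap_lkern (r : R) v : kap (r * enorm v) <= (1 + r ^+ 2) * lkern v.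
Proof.
have d z : 0 < 1 + z ^+ 2 :> R by rewrite ltr_pwDl// sqr_ge0.
rewrite /kap /lkern exprMn; set p := r ^+ 2; set q := enorm v ^+ 2.
have p0 : 0 <= p by rewrite sqr_ge0.
have q0 : 0 <= q by rewrite sqr_ge0.
have pq : 0 <= p * q by rewrite mulr_ge0.
rewrite ler_pdivrMr ?ltr_pwDl//.
have -> : (1 + p) * (q / (1 + q)) * (1 + p * q) = (1 + p) * q * (1 + p * q) / (1 + q) by ring.
rewrite ler_pdivlMr ?ltr_pwDl//.
rewrite -subr_ge0 (_ : _ - _ = q + p * q * p * q); last ring.
by rewrite addr_ge0// mulr_ge0// mulr_ge0.
Qed.

Lemma measurable_kap : measurable_fun setT kap.
Proof.
apply: measurable_funM; first exact: measurable_funX.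
apply: measurableT_comp; first exact: measurable_inv.
by apply: measurable_funD => //; exact: measurable_funX.
Qed.

Lemma integrable_kap_enorm r : M.-integrable setT (EFin \o (fun v => kap (r * enorm v))).
Proof.
apply: (integrable_le_lkern lM (c := 1 + r ^+ 2)).
  apply: measurableT_comp; first exact: measurable_kap.
  by apply: measurable_funM => //; exact: measurable_enorm.
by move=> v; rewrite ger0_norm ?kap_ge0// kap_lkern.
Qed.

Lemma integrable_kap_dot u : M.-integrable setT (EFin \o (fun v => kap (dot v u))).
Proof.
apply: (le_integrableR _ _ _ (integrable_kap_enorm (enorm u))) => //.
  by apply: measurableT_comp; [exact: measurable_kap|exact: measurable_dot].
by move=> v _; rewrite ger0_norm ?kap_ge0// kap_dot_le.
Qed.

Definition levy_size u : R := dot (D *m u) u + \int[M]_v kap (dot v u).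

Lemma levy_size_scale (r : R) u : 1 <= r -> levy_size u <= levy_size (r *: u).
Proof.
move=> r1; have r2 : 1 <= r ^+ 2 by exact: exprn_ege1.
rewrite /levy_size -scalemxAr dotZl dotZr mulrA -expr2; apply: lerD.
  by rewrite ler_peMl// D0.2.
apply: le_Rintegral => //; do ?exact: integrable_kap_dot.
by move=> v _; apply: ler_kap; rewrite dotZr exprMn ler_peMl// sqr_ge0.
Qed.

(** For |u| <= 1 one has (v, u)^2 <= |v|^2, so [kap] has the smaller denominator. This bounds
    [levy_size] from below on the unit sphere. *)
Lemma levy_size_gram u : enorm u <= 1 ->
  dot ((D + gram lphi) *m u) u <= levy_size u.
Proof.
move=> u1; rewrite mulmxDl dotDl lerD2l.
rewrite (dot_gram measurable_lphi (@lphi_gt0 _ _) (fun v => lexx _)).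
apply: le_Rintegral => //.
- exact: (integrable_gram measurable_lphi (@lphi_gt0 _ _) (fun v => lexx _)).
- exact: integrable_kap_dot.
move=> v _; rewrite -mulrA -expr2 mulrC /kap ler_wpM2l ?sqr_ge0//.
rewrite /lphi lef_pV2 ?posrE ?ltr_pwDl ?sqr_ge0// lerD2l.
rewrite (le_trans (dot_sqr_le v u))// -!enorm_sq ler_piMr ?sqr_ge0//.
by rewrite exprn_ile1 ?enorm_ge0.
Qed.

Lemma levy_size_le (r : R) u : enorm u <= r ->
  levy_size u <= mxbound D * r ^+ 2 + \int[M]_v kap (r * enorm v).
Proof.
move=> ur; apply: lerD.
  rewrite (le_trans (ler_norm _))// (le_trans (cauchy_schwarz _ _))//.
  rewrite (le_trans (ler_wpM2r (enorm_ge0 _) (enorm_mulmx D _)))//.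
  rewrite -mulrA -expr2 ler_wpM2l ?mxbound_ge0// lerXn2r ?nnegrE ?enorm_ge0//.
  exact: le_trans (enorm_ge0 _) ur.
apply: le_Rintegral => //; [exact: integrable_kap_dot|exact: integrable_kap_enorm|].
move=> v _; apply: le_trans (kap_dot_le _ _) _; apply: ler_kap.
rewrite !exprMn ler_wpM2r ?sqr_ge0// lerXn2r ?nnegrE ?enorm_ge0//.
exact: le_trans (enorm_ge0 _) ur.
Qed.

Lemma levy_size_small (d : R) : 0 < d ->
  exists2 k : nat, (0 < k)%N & forall u, enorm u <= k%:R^-1 -> levy_size u < d.
Proof.
move=> d0.
have hk : (fun k : nat => k.+1%:R^-1 : R) @ \oo --> (0 : R) by exact: cvg_harmonic.
have h1 : (fun k : nat => mxbound D * (k.+1%:R^-1) ^+ 2) @ \oo --> (0 : R).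
  rewrite -(mulr0 (mxbound D)); apply: cvgM; first exact: cvg_cst.
  by rewrite -(mulr0 (0 : R)); under eq_fun do rewrite expr2; exact: cvgM.
have [||||_ h2] := @Rintegral_dominated_cvg _ _ _ M setT
  (fun k v => kap (k.+1%:R^-1 * enorm v)) (cst 0) (fun v => (1 + 1) * lkern v) measurableT.
- move=> k; apply: measurableT_comp; first exact: measurable_kap.
  by apply: measurable_funM => //; exact: measurable_enorm.
- move=> v _; rewrite (_ : cst 0 v = 0 / (1 + 0)); last by rewrite mul0r.
  have h2 : (fun k : nat => (k.+1%:R^-1 * enorm v) ^+ 2) @ \oo --> (0 : R).
    have h : (fun k : nat => k.+1%:R^-1 * enorm v) @ \oo --> (0 : R).
      by rewrite -(mul0r (enorm v)); apply: cvgM => //; exact: cvg_cst.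
    by rewrite -(mulr0 (0 : R)); under eq_fun do rewrite expr2; exact: cvgM.
  apply: cvgM => //; apply: cvgV; first by rewrite addr0 oner_neq0.
  by apply: cvgD => //; exact: cvg_cst.
- exact: integrable_lkern.
- move=> k v _; rewrite ger0_norm ?kap_ge0// (le_trans (kap_lkern _ _))//.
  by rewrite ler_wpM2r ?lkern_ge0// lerD2l exprn_ile1 ?invr_ge0// invf_le1// ler1n.
have h3 : (fun k : nat => mxbound D * (k.+1%:R^-1) ^+ 2 +
    \int[M]_v kap (k.+1%:R^-1 * enorm v)) @ \oo --> (0 : R).
  rewrite -(addr0 (0 : R)); apply: cvgD => //.
  by move: h2; rewrite /Rintegral integral0.
have [N _ HN] := cvgr_lt 0 h3 d d0.
exists N.+1 => // u /levy_size_le h.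
exact: (le_lt_trans h (HN N (leqnn N))).
Qed.

Lemma levy_size_invariant s u : Gmx 1 D M s -> levy_size (s^T *m u) = levy_size u.
Proof.
move=> Ss; have [_ sD _] := Ss; rewrite /levy_size; congr (_ + _).
  by rewrite -dot_mulmxl !mulmxA sD scale1r.
rewrite -[RHS]mul1r -(Gmx_Rintegral ltr01 Ss (integrable_kap_dot u)).
by apply: eq_Rintegral => v _; rewrite dot_mulmxl.
Qed.

(** [levy_size] is at least [d] at norm 1 and beyond, and below [d] at norm 1/k. It is invariant
    under [s^T], so no symmetry takes a vector of the small ball out of the unit ball; hence [s^T]
    has norm at most [k], and duality passes to [s]. *)
Lemma symmetry_bounded : exists2 C : R, 1 <= C &
  forall s v, Gmx 1 D M s -> enorm (s *m v) <= C * enorm v.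
Proof.
have [d d0 dle] := posdef_lower_bound
  (gram_sym lphi)
  (gram_nonneg measurable_lphi (@lphi_gt0 _ _) (fun v => lexx _))
  (@gram_definite _ measurable_lphi (@lphi_gt0 _ _) (fun v => lexx _)).
have [k k0 small] := levy_size_small d0.
have K0 : 0 < k%:R :> R by rewrite ltr0n.
exists k%:R; first by rewrite ler1n.
have bT s u : Gmx 1 D M s -> enorm (s^T *m u) <= k%:R * enorm u.
  move=> Ss; have [->|u0] := eqVneq u 0; first by rewrite mulmx0 enorm0 mulr0.
  rewrite leNgt; apply/negP => h.
  have un : 0 < enorm u by rewrite enorm_gt0.
  (* Normalized so that |x| = 1/k while |s^T x| > 1. *)
  pose x := (k%:R * enorm u)^-1 *: u.
  have kx0 : 0 < k%:R * enorm u by rewrite mulr_gt0.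
  have ex : enorm x = k%:R^-1.
    by rewrite enormZ gtr0_norm ?invr_gt0// invfM -mulrA mulVf ?mulr1// gt_eqF.
  have rx : levy_size x < d by apply: small; rewrite ex.
  have ey : 1 < enorm (s^T *m x).
    by rewrite -scalemxAr enormZ gtr0_norm ?invr_gt0// mulrC ltr_pdivlMr// mul1r.
  set y := s^T *m x in ey.
  have y0 : 0 < enorm y by exact: lt_trans ltr01 ey.
  have ew : enorm ((enorm y)^-1 *: y) = 1.
    by rewrite enormZ gtr0_norm ?invr_gt0// mulVf// gt_eqF.
  have := levy_size_scale ((enorm y)^-1 *: y) (ltW ey).
  rewrite scalerA divff ?gt_eqF// scale1r [levy_size y]levy_size_invariant//.
  have := @levy_size_gram ((enorm y)^-1 *: y).
  rewrite ew lexx => /(_ isT).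
  have := dle ((enorm y)^-1 *: y); rewrite -enorm_sq ew expr1n mulr1.
  lra.
move=> s v Ss; have [e|sv0] := eqVneq (enorm (s *m v)) 0.
  by rewrite e mulr_ge0// enorm_ge0.
have sv : 0 < enorm (s *m v) by rewrite lt_def sv0 enorm_ge0.
rewrite -(ler_pM2l sv) -expr2 enorm_sq dot_mulmxl.
rewrite (le_trans (ler_norm _))// (le_trans (cauchy_schwarz _ _))//.
rewrite (le_trans (ler_wpM2l (enorm_ge0 _) (bT s _ Ss)))//.
by rewrite le_eqVlt; apply/orP; left; apply/eqP; ring.
Qed.

End gram_matrix.

Lemma cvg_bigsum {R : realType} {T : Type} (F : set_system T) {FF : Filter F}
    (I : Type) (r : seq I) (f : I -> T -> R) (l : I -> R) :
  (forall i, f i @ F --> l i) -> \sum_(i <- r) f i t @[t --> F] --> \sum_(i <- r) l i.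
Proof.
move=> fl; elim: r => [|i r ir].
  by under eq_fun do rewrite big_nil; rewrite big_nil; exact: cvg_cst.
by under eq_fun do rewrite big_cons; rewrite big_cons; exact: cvgD.
Qed.

(** * A truncation invariant under the symmetry group *)

Section symmetric_truncation.
Context {R : realType} {n : nat}.
Notation V := 'cV[R]_n.
Implicit Types (u v w x y : V) (A B C D s : 'M[R]_n) (a b c : R).
Variables (mu : probability V R) (m : V) (D : 'M[R]_n) (M : {measure set V -> \bar R}).
Hypotheses (fmu : full mu) (lmu : levy_khintchine mu m D M).

Let lM : levy_measure M. Proof. by have /levy_khintchineE[_] := lmu. Qed.

Notation G a A := (Gmx a D M A).
Notation S s := (Gmx 1 D M s).

(* The infimum over the symmetry group makes the truncation invariant under it. *)
Definition sphi v : R := inf [set lphi (s *m v) | s in [set s | S s]].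

Let sphi_set v := [set lphi (s *m v) | s in [set s | S s]].

Let sphi_lb v : has_lbound (sphi_set v).
Proof. by exists 0 => _ [s _ <-]; rewrite ltW// lphi_gt0. Qed.

Let sphi_ne v : sphi_set v !=set0.
Proof. by exists (lphi (1%:M *m v)); exists 1%:M => //; exact: Gmx1. Qed.

Lemma sphi_le v : sphi v <= lphi v.
Proof.
rewrite -{2}[v]mul1mx; apply: ge_inf; first exact: sphi_lb.
by exists (1%:M : 'M[R]_n) => //; exact: Gmx1.
Qed.

(** The infimum may run over an uncountable family, but its members are continuous, so the strict
    sublevel sets are unions of open sets. *)
Lemma measurable_sphi : measurable_fun setT sphi.
Proof.
apply: (measurability _ (RGenInftyO.measurableE R)) => _ [_ [c ->] <-].
rewrite setTI.
have -> : sphi @^-1` `]-oo, c[ = \bigcup_(s in [set s | S s]) [set v | lphi (s *m v) < c].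
  apply/seteqP; split => v /=; rewrite in_itv /=.
    by move=> /(inf_lt (sphi_ne v))[_ [s Ss <-] h]; exists s.
  move=> [s Ss h]; apply: le_lt_trans h; apply: ge_inf; first exact: sphi_lb.
  by exists s.
apply: open_measurable_mx; apply: bigcup_open => s _.
have -> : [set v | lphi (s *m v) < c] = (fun v => lphi (s *m v)) @^-1` `]-oo, c[.
  by apply/seteqP; split => v /=; rewrite in_itv.
apply: open_comp; last exact: interval_open.
have cont : continuous (fun z : V => 1 + enorm (s *m z) ^+ 2).
  move=> v.
  suff c2 : enorm (s *m z) ^+ 2 @[z --> v] --> enorm (s *m v) ^+ 2.
    have FF : Filter (nbhs v) by exact: nbhs_filter.
    by apply: (cvgD _ c2); apply: cvg_cst.
  have FF : Filter (nbhs v) by exact: nbhs_filter.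
  have e z : enorm (s *m z) ^+ 2 = \sum_i (\sum_j s i j * z j 0) * (\sum_j s i j * z j 0).
    by rewrite enorm_sq /dot; apply: eq_bigr => i _; rewrite mxE.
  rewrite e; under eq_fun do rewrite e.
  have c1 i : \sum_j s i j * z j 0 @[z --> v] --> \sum_j s i j * v j 0.
    by apply: cvg_bigsum => j; apply: cvgM; [apply: cvg_cst|exact: coord_continuous].
  by apply: cvg_bigsum => i; exact: (cvgM (c1 i) (c1 i)).
move=> v _; apply: (cvgV _ (cont v)).
by rewrite gt_eqF// ltr_pwDl// sqr_ge0.
Qed.

(** Boundedness of the symmetry group, with [K] the square of the norm bound. The first estimate
    keeps [sphi] positive, the second makes 1 - [sphi] of order [lkern] near 0, which truncations
    are compared by. *)
Lemma sphi_ge : exists2 K : R, 1 <= K &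
  forall v, lphi v <= K * sphi v /\ 1 - K * lkern v <= sphi v.
Proof.
have [C C1 hC] := symmetry_bounded fmu lmu.
have C2 : 1 <= C ^+ 2 by exact: exprn_ege1.
have C0 : 0 < C ^+ 2 by exact: lt_le_trans ltr01 C2.
have d w : 0 < 1 + enorm w ^+ 2 :> R by rewrite ltr_pwDl// sqr_ge0.
exists (C ^+ 2) => // v.
have h s : S s -> enorm (s *m v) ^+ 2 <= C ^+ 2 * enorm v ^+ 2.
  move=> Ss; rewrite -exprMn lerXn2r ?nnegrE ?enorm_ge0// ?hC//.
  by rewrite mulr_ge0 ?enorm_ge0// (le_trans ler01).
split.
  rewrite mulrC -ler_pdivrMr//; apply: lb_le_inf; first exact: sphi_ne.
  move=> _ [s Ss <-]; rewrite ler_pdivrMr// /lphi mulrC.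
  rewrite ler_pdivlMr// mulrC ler_pdivrMr//.
  by rewrite mulrDr mulr1 lerD// h.
apply: lb_le_inf; first exact: sphi_ne.
move=> _ [s Ss <-].
suff : lkern (s *m v) <= C ^+ 2 * lkern v by rewrite [lkern (s *m v)]lkernE; lra.
rewrite /lkern ler_pdivrMr//.
have -> : C ^+ 2 * (enorm v ^+ 2 / (1 + enorm v ^+ 2)) * (1 + enorm (s *m v) ^+ 2) =
  C ^+ 2 * enorm v ^+ 2 * (1 + enorm (s *m v) ^+ 2) / (1 + enorm v ^+ 2) by ring.
rewrite ler_pdivlMr//; have := h s Ss.
set p := enorm (s *m v) ^+ 2; set q := enorm v ^+ 2 => pq.
have q0 : 0 <= q by exact: sqr_ge0.
have p0 : 0 <= p by exact: sqr_ge0.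
rewrite !mulrDr !mulr1 lerD// mulrC ler_wpM2r//.
by rewrite ler_peMl.
Qed.

Lemma sphi_gt0 v : 0 < sphi v.
Proof.
have [K K1 /(_ v)[h _]] := sphi_ge; have := lphi_gt0 v => p.
have K0 : 0 < K by exact: lt_le_trans ltr01 K1.
by rewrite -(pmulr_rgt0 _ K0) (lt_le_trans p).
Qed.

Lemma sphi_inv s v : S s -> sphi (s *m v) = sphi v.
Proof.
move=> Ss; rewrite /sphi; congr inf; apply/seteqP; split => _ [t /= St <-].
  by exists (t *m s); [have := GmxM St Ss; rewrite mulr1|rewrite mulmxA].
have [us _ _] := Ss; exists (t *m invmx s).
  by have := GmxM St (GmxV ltr01 Ss); rewrite invr1 mulr1.
by rewrite -mulmxA mulKmx.
Qed.

(** The symmetry group is normal: the degrees multiply to a times 1 times 1/a. *)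
Lemma conj_symmetry a A s : 0 < a -> G a A -> S s -> S (A *m s *m invmx A).
Proof.
move=> a0 GA Ss; have := GmxM (GmxM GA Ss) (GmxV a0 GA).
by rewrite mulr1 divff// gt_eqF.
Qed.

Lemma sphi_conj a A s v : 0 < a -> G a A -> S s ->
  sphi (A *m (s *m v)) = sphi (A *m v).
Proof.
move=> a0 GA Ss; have [uA _ _] := GA.
by rewrite -(sphi_inv (A *m v) (conj_symmetry a0 GA Ss)) -!mulmxA mulKmx.
Qed.

Lemma truncation_sphi : truncation M sphi.
Proof.
have [K K1 hK] := sphi_ge.
apply: (@truncation_le _ _ _ lM _ K); first exact: measurable_sphi.
move=> v; have k0 := lkern_ge0 v.
have h0 : 0 <= lphi v - sphi v by rewrite subr_ge0 sphi_le.
rewrite ger0_norm//.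
have [v1|/ltW v1] := lerP (enorm v) 1; last first.
  apply: (@le_trans _ _ (lkern v)); last by rewrite ler_peMl.
  rewrite mulrC (le_trans _ (enorm_lphi_big v1))// ler_wpM2l ?enorm_ge0//.
  by rewrite gerBl ltW// sphi_gt0.
apply: (@le_trans _ _ (lphi v - sphi v)); first by rewrite ler_piMr.
by have [_ h] := hK v; have := lphi_le1 v; lra.
Qed.

Lemma beta_sphi_sym s : S s -> beta M sphi s = 0.
Proof.
move=> Ss; apply/matrixP => i j; rewrite !mxE.
under eq_Rintegral => v _ do rewrite sphi_inv// subrr scale0r mxE.
by rewrite /Rintegral integral0.
Qed.

(** Substitute [t v] for [v], where t = A^-1 s A is again a symmetry: [M] is unchanged, the
    truncations are invariant, and A t = s A brings out the factor [s]. *)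
Lemma beta_sphi_fixed a A s : 0 < a -> G a A -> S s ->
  s *m beta M sphi A = beta M sphi A.
Proof.
move=> a0 GA Ss; have [uA _ _] := GA.
have ib := vintegrable_beta lM a0 GA truncation_sphi.
pose t := invmx A *m s *m A.
have At : A *m t = s *m A by rewrite /t !mulmxA mulmxV// mul1mx.
have {}St : S t.
  by have := GmxM (GmxM (GmxV a0 GA) Ss) GA; rewrite mulr1 mulVf// gt_eqF.
rewrite -vint_mulmx// -[RHS]scale1r -(Gmx_vint ltr01 St ib).
apply: eq_vint => v; rewrite -scalemxAr (sphi_conj v a0 GA St) (sphi_inv v St).
by rewrite [in RHS](mulmxA A) At -mulmxA.
Qed.

(** The invariant form is [D + gram M sphi]. Conjugating [P] by [A] preserves the properties that
    characterize [P], because the symmetry group is normal; so [P] commutes with [A]. *)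
Lemma sphi_mean : exists P : 'M[R]_n,
  [/\ forall s, S s -> s *m P = P,
      forall k (X : 'M[R]_(n, k)), (forall s, S s -> s *m X = X) -> P *m X = X &
      forall a A, 0 < a -> G a A -> A *m P = P *m A].
Proof.
have Sm (s : 'M[R]_n) u w : S s -> dot (gram M sphi *m (s^T *m u)) (s^T *m w) =
    dot (gram M sphi *m u) w.
  move=> Ss; rewrite !(dot_gram lmu measurable_sphi sphi_gt0 sphi_le).
  have i1 := integrable_gram lmu measurable_sphi sphi_gt0 sphi_le u w.
  rewrite -[RHS]mul1r -(Gmx_Rintegral ltr01 Ss i1).
  by apply: eq_Rintegral => v _; rewrite sphi_inv// -!dot_mulmxl.
have SQ s : S s -> s *m (D + gram M sphi) *m s^T = D + gram M sphi.
  move=> Ss; have [us sD _] := Ss; rewrite mulmxDr mulmxDl sD scale1r; congr (_ + _).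
  apply/matrixP => i j; have := Sm s (delta_mx j 0) (delta_mx i 0) Ss.
  by rewrite -dot_mulmxl !mulmxA -!colE !dot_delta [LHS]mxE [RHS]mxE.
have [P [sP Ps PX XP]] := @invariant_projection _ _ (D + gram M sphi)
  (gram_sym lmu sphi)
  (@gram_definite _ _ _ _ _ _ fmu lmu _ measurable_sphi sphi_gt0 sphi_le)
  (fun s => S s) (fun s Ss => let: And3 us _ _ := Ss in us) SQ.
exists P; split => // a A a0 GA; have [uA _ _] := GA.
pose P' := A *m P *m invmx A.
have St s : S s -> S (invmx A *m s *m A).
  by move=> Ss; have := GmxM (GmxM (GmxV a0 GA) Ss) GA; rewrite mulr1 mulVf// gt_eqF.
have P's s : S s -> P' *m s = P'.
  by move=> Ss; rewrite /P' -[in RHS](Ps _ (St s Ss)) !mulmxA mulmxK.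
have P'X k (X : 'M[R]_(n, k)) : (forall s, S s -> s *m X = X) -> P' *m X = X.
  move=> sX; rewrite /P' -!mulmxA PX ?mulKVmx// => s Ss.
  by rewrite -{2}(sX _ (conj_symmetry a0 GA Ss)) !mulmxA mulVmx// mul1mx.
have eP : P' = P by rewrite -[LHS](XP _ P's) (P'X _ P).
by rewrite -{2}eP /P' mulmxKV.
Qed.

End symmetric_truncation.

(** * From one centering equation to all of them *)

Section common_centering.
Context {R : realType} {n : nat}.
Notation V := 'cV[R]_n.
Implicit Types (u v w x y : V) (A B C D s : 'M[R]_n) (a b c : R).
Variables (mu : probability V R) (m : V) (D : 'M[R]_n) (M : {measure set V -> \bar R}).
Hypotheses (fmu : full mu) (lmu : levy_khintchine mu m D M).

Let lM : levy_measure M. Proof. by have /levy_khintchineE[_] := lmu. Qed.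

Notation G a A := (Gmx a D M A).
Notation psi := (sphi D M).
Notation beta_ := (beta M psi).

Let tpsi : truncation M psi. Proof. exact: (truncation_sphi fmu lmu). Qed.

(* x solves the centering equation of A relative to the symmetric truncation. *)
Definition centers a A x : Prop := A *m x + beta_ A = a *: x.

Lemma centersE a A y : 0 < a -> G a A ->
  A *m y + corr A M = a *: y <-> centers a A (y - tshift M psi).
Proof.
move=> a0 GA; have := centering_beta lM 0 y a0 GA tpsi.
by rewrite !add0r.
Qed.

(** Telescoping the truncation along v, B v, A B v; the factor [b] comes from the scaling of [M]
    under [B]. This cocycle rule makes the centering equations compatible with products and
    inverses. *)
Lemma beta_comp a b A B : 0 < a -> G a A -> 0 < b -> G b B ->
  beta_ (A *m B) = b *: beta_ A + A *m beta_ B.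
Proof.
move=> a0 GA b0 GB.
have iA := vintegrable_beta lM a0 GA tpsi; have iB := vintegrable_beta lM b0 GB tpsi.
rewrite -(Gmx_vint b0 GB iA) -vint_mulmx// -vintD.
- by apply: eq_vint => v; rewrite -scalemxAr !mulmxA -scalerDl addrA subrK.
- exact: (Gmx_vintegrable b0 GB iA).
- exact: vintegrable_mulmx.
Qed.

Lemma centers_comp a b A B x : 0 < a -> G a A -> 0 < b -> G b B ->
  centers a A x -> centers b B x -> centers (a * b) (A *m B) x.
Proof.
move=> a0 GA b0 GB cA cB.
rewrite /centers (beta_comp a0 GA b0 GB) -mulmxA addrCA -mulmxDr cB -scalemxAr.
by rewrite addrC -scalerDr cA scalerA mulrC.
Qed.

Lemma centers_inv a A x : 0 < a -> G a A -> centers a A x -> centers a^-1 (invmx A) x.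
Proof.
move=> a0 GA cA; have [uA _ _] := GA; have aN0 : a != 0 by rewrite gt_eqF.
have V0 : 0 < a^-1 by rewrite invr_gt0.
have := beta_comp V0 (GmxV a0 GA) a0 GA.
rewrite mulVmx// (beta_sphi_sym (Gmx1 D M)) => e.
have eb : beta_ (invmx A) = - (a^-1 *: (invmx A *m beta_ A)).
  by apply: (scalerI aN0); rewrite scalerN scalerA divff// scale1r; apply/eqP; rewrite -addr_eq0 -e.
rewrite /centers eb; apply: (scalerI aN0).
rewrite scalerDr scalerN !scalerA divff// !scale1r scalemxAr -mulmxBr -cA addrK mulKmx//.
Qed.

Lemma centers_sym s x : G 1 s -> centers 1 s x <-> s *m x = x.
Proof. by move=> Ss; rewrite /centers (beta_sphi_sym Ss) addr0 scale1r. Qed.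

(** The projection [P] fixes every [beta] and commutes with every [A], so it maps solutions to
    solutions; [H] records which equations are to be preserved. *)
Lemma centers_symmetrize (H : R -> 'M[R]_n -> Prop) x :
  (forall a A, H a A -> 0 < a /\ G a A) ->
  (forall a A, H a A -> centers a A x) ->
  exists z, (forall a A, H a A -> centers a A z) /\ (forall s, G 1 s -> s *m z = z).
Proof.
move=> HG cx; have [P [sP PX PA]] := sphi_mean fmu lmu.
exists (P *m x); split => [a A HA|s Ss]; last by rewrite mulmxA sP.
have [a0 GA] := HG a A HA; have := cx a A HA; rewrite /centers => e.
have Pb : P *m beta_ A = beta_ A.
  by apply: PX => s Ss; exact: (beta_sphi_fixed fmu lmu a0 GA Ss).
by rewrite mulmxA (PA a A a0 GA) -mulmxA -Pb -mulmxDr e scalemxAr.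
Qed.

(** B = A (A^-1 B), and the second factor has degree 1, so its equation is solved by every invariant
    vector. *)
Lemma centers_coset a A B x : 0 < a -> G a A -> G a B ->
  (forall s, G 1 s -> s *m x = x) -> centers a A x -> centers a B x.
Proof.
move=> a0 GA GB sx cA; have [uA _ _] := GA.
have Ss : G 1 (invmx A *m B).
  by have := GmxM (GmxV a0 GA) GB; rewrite mulVf// gt_eqF.
have := centers_comp a0 GA ltr01 Ss cA ((centers_sym x Ss).2 (sx _ Ss)).
by rewrite mulr1 mulKVmx.
Qed.

(** The affine map whose fixed points are the centering vectors of [C]; by the cocycle rule its
    iterates belong to the powers of [C]. *)
Definition recenter c C x : V := c^-1 *: (C *m x + beta_ C).

Lemma recenter_fixed c C x : 0 < c -> centers c C x <-> recenter c C x = x.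
Proof.
move=> c0; have cN0 : c != 0 by rewrite gt_eqF.
rewrite /centers /recenter; split=> [->|{2}<-]; first by rewrite scalerA mulVf// scale1r.
by rewrite scalerA divff// scale1r.
Qed.

Lemma recenter_sym c C x : 0 < c -> G c C -> (forall s, G 1 s -> s *m x = x) ->
  forall s, G 1 s -> s *m recenter c C x = recenter c C x.
Proof.
move=> c0 GC sx s Ss; have [uC _ _] := GC.
rewrite /recenter -scalemxAr mulmxDr (beta_sphi_fixed fmu lmu c0 GC Ss); congr (_ *: (_ + _)).
have St : G 1 (invmx C *m s *m C).
  by have := GmxM (GmxM (GmxV c0 GC) Ss) GC; rewrite mulr1 mulVf// gt_eqF.
by rewrite -{2}(sx _ St) !mulmxA mulmxV// mul1mx.
Qed.

Fixpoint mxpow C (k : nat) : 'M[R]_n := if k is k'.+1 then C *m mxpow C k' else 1%:M.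

Lemma Gmx_pow c C k : 0 < c -> G c C -> G (c ^+ k) (mxpow C k).
Proof.
move=> c0 GC; elim: k => [|k ih] /=; first by rewrite expr0; exact: Gmx1.
by rewrite exprS; exact: GmxM.
Qed.

Lemma recenter_iter c C x k : 0 < c -> G c C ->
  iter k (recenter c C) x = recenter (c ^+ k) (mxpow C k) x.
Proof.
move=> c0 GC; elim: k => [|k ih] /=.
  rewrite /recenter expr0 invr1 scale1r mul1mx.
  by rewrite (beta_sphi_sym (Gmx1 D M)) addr0.
have ck : 0 < c ^+ k by rewrite exprn_gt0.
rewrite ih /recenter (beta_comp c0 GC ck (Gmx_pow k c0 GC)) exprS invfM -scalerA.
congr (_ *: _).
rewrite -scalemxAr mulmxDr !scalerDr scalerA mulVf ?gt_eqF// scale1r mulmxA.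
by rewrite -addrA [in RHS](addrC (beta_ C)).
Qed.

(** An affine map preserves barycenters and permutes a periodic orbit cyclically, so it fixes the
    barycenter of that orbit. *)
Lemma recenter_average c C x (k : nat) : (0 < k)%N -> 0 < c -> G c C ->
  iter k (recenter c C) x = x ->
  recenter c C (k%:R^-1 *: \sum_(i < k) iter i (recenter c C) x) =
  k%:R^-1 *: \sum_(i < k) iter i (recenter c C) x.
Proof.
move=> k0 c0 GC kx; set f := recenter c C.
have kN0 : k%:R != 0 :> R by rewrite pnatr_eq0 -lt0n.
have lin : f (k%:R^-1 *: \sum_(i < k) iter i f x) = k%:R^-1 *: \sum_(i < k) f (iter i f x).
  rewrite /f /recenter -scaler_sumr big_split /= -mulmx_sumr sumr_const card_ord.
  rewrite [RHS]scalerA [X in _ = X *: _]mulrC -[RHS]scalerA [in RHS]scalerDr.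
  by rewrite -[in LHS]scalemxAr -[beta_ C *+ k]scaler_nat [in RHS]scalerA mulVf// scale1r.
rewrite lin; congr (_ *: _); case: k k0 kx {kN0 lin} => // k _ kx.
rewrite big_ord_recr /= big_ord_recl /= -/f; rewrite addrC; congr (_ + _).
by rewrite -[RHS]kx.
Qed.

Lemma common_centering_flow (T : R -> 'M[R]_n) y :
  (forall t, 0 < t -> G t (T t)) ->
  (forall t, 0 < t -> T t *m y + corr (T t) M = t *: y) ->
  exists z, forall a A, 0 < a -> G a A -> A *m z + corr A M = a *: z.
Proof.
move=> GT cT; pose H a A := 0 < a /\ A = T a.
have [||z [cz sz]] := @centers_symmetrize H (y - tshift M psi).
- by move=> a A [a0 ->]; split => //; exact: GT.
- by move=> a A [a0 ->]; apply/centersE => //; [exact: GT|exact: cT].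
exists (z + tshift M psi) => a A a0 GA; apply/centersE => //; rewrite addrK.
exact: (centers_coset a0 (GT a a0) GA sz (cz _ _ (conj a0 erefl))).
Qed.

Lemma common_centering_discrete c a A y : 0 < c < 1 -> 0 < a < 1 ->
  (forall b, 0 < b -> (exists B, G b B) <-> exists k : int, b = c ^ k) ->
  G a A -> A *m y + corr A M = a *: y ->
  exists z, forall b B, 0 < b -> G b B -> B *m z + corr B M = b *: z.
Proof.
move=> /andP[c0 c1] /andP[a0 a1] Gc GA cA.
pose H b B := b = a /\ B = A.
have [||x [cx sx]] := @centers_symmetrize H (y - tshift M psi).
- by move=> b B [-> ->].
- by move=> b B [-> ->]; apply/centersE.
have {cx} cx := cx _ _ (conj erefl erefl).
have [C GC] : exists C, G c C by apply/(Gc c c0); exists 1; rewrite expr1z.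
(* Since a < 1, the exponent of [c] is positive; [Negz k] stands for -(k + 1). *)
have [[k|k] ak] := (Gc a a0).1 (ex_intro _ A GA); last first.
  move: a1; rewrite ak NegzE -exprnN invf_lt1 ?exprn_gt0// ltNge.
  by rewrite exprn_ile1// ltW.
have k0 : (0 < k)%N.
  by rewrite lt0n; apply: contraTneq a1 => k0; rewrite ak k0 expr0z ltxx.
rewrite -exprnP in ak.
pose f := recenter c C.
(* [A] and the [k]-th power of [C] have the same degree a = c^k, so they differ by a symmetry, which
   fixes [x]: the vector is a periodic point. *)
have fk : iter k f x = x.
  rewrite recenter_iter//; apply/(recenter_fixed _ _ (exprn_gt0 k c0)).
  apply: (@centers_coset _ A) => //; rewrite -?ak//; rewrite ak; exact: Gmx_pow.
pose z := k%:R^-1 *: \sum_(i < k) iter i f x.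
have sf i : forall s, G 1 s -> s *m iter i f x = iter i f x.
  by elim: i => [|i ih] //=; exact: recenter_sym.
have sz s : G 1 s -> s *m z = z.
  move=> Ss; rewrite /z -scalemxAr mulmx_sumr; congr (_ *: _).
  by apply: eq_bigr => i _; exact: sf.
have cz : centers c C z.
  by apply/(recenter_fixed _ _ c0); exact: recenter_average.
have czn j : centers (c ^+ j) (mxpow C j) z.
  elim: j => [|j ih] /=; first by rewrite expr0; apply/centers_sym; [exact: Gmx1|rewrite mul1mx].
  by rewrite exprS; apply: centers_comp => //; [exact: exprn_gt0|exact: Gmx_pow].
exists (z + tshift M psi) => b B b0 GB; apply/centersE => //; rewrite addrK.
have [[j|j] bj] := (Gc b b0).1 (ex_intro _ B GB).
  rewrite -exprnP in bj.
  by apply: (@centers_coset _ (mxpow C j)); rewrite ?bj//; [rewrite -bj|exact: Gmx_pow|rewrite -bj].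
rewrite NegzE -exprnN in bj.
have cj : 0 < c ^+ j.+1 by exact: exprn_gt0.
apply: (@centers_coset _ (invmx (mxpow C j.+1))) => //.
  by rewrite bj; apply: GmxV => //; exact: Gmx_pow.
by rewrite bj; apply: centers_inv => //; exact: Gmx_pow.
Qed.

End common_centering.

(** * The one-parameter group [t^B = mxflow B (ln t)] *)

Section matrix_exponential.
Context {R : realType} {n : nat}.
Notation V := 'cV[R]_n.
Implicit Types (u v w : V) (s t x : R) (A : 'M[R]_n).
Variable B : 'M[R]_n.

Definition mxflow s : 'M[R]_n := expmx (s *: B).

Let b := mxbound B.

Let pow_entry_le k i j : `|(B ^+ k) i j| <= b ^+ k.
Proof.
have h v : enorm (B ^+ k *m v) <= b ^+ k * enorm v.
  elim: k => [|k ih]; first by rewrite !expr0 mul1r mul1mx.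
  rewrite !exprS -mulrA -mulmxA (le_trans (enorm_mulmx _ _))//.
  by rewrite ler_wpM2l ?mxbound_ge0.
have -> : (B ^+ k) i j = ((B ^+ k) *m (delta_mx j 0 : 'cV[R]_n)) i 0.
  by have := colE j (B ^+ k : 'M[R]_n) => /matrixP/(_ i 0) <-; rewrite mxE.
rewrite (le_trans (coord_le_enorm _ _))// (le_trans (h _))//.
by rewrite /enorm dot_delta mxE !eqxx sqrtr1 mulr1.
Qed.

Lemma cvg_pseries_exp_bound (a : R^nat) (C : R) :
  (forall k, `|a k| <= C * (b ^+ k / k`!%:R)) -> forall x : R, cvgn (pseries a x).
Proof.
move=> aC x; apply: normed_cvg.
apply: (@series_le_cvg _ _ (fun k => C * exp_coeff (b * `|x|) k)).
- by move=> k /=.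
- move=> k; rewrite mulr_ge0//.
    by have := le_trans (normr_ge0 _) (aC 0%N); rewrite expr0 fact0 divr1 mulr1.
  by rewrite /exp_coeff /= divr_ge0// exprn_ge0// mulr_ge0// mxbound_ge0.
- move=> k /=; rewrite normrM normrX /exp_coeff /= exprMn mulrAC mulrA.
  by rewrite ler_wpM2r ?exprn_ge0.
- exact: (@is_cvg_seriesZ _ _ C (is_cvg_series_exp_coeff _)).
Qed.

Definition exp_entry i j (k : nat) : R := k`!%:R^-1 * (B ^+ k) i j.

Let exp_entry_le i j k : `|exp_entry i j k| <= 1 * (b ^+ k / k`!%:R).
Proof.
rewrite mul1r normrM mulrC [X in _ * X]ger0_norm ?invr_ge0//.
by rewrite ler_wpM2r ?invr_ge0.
Qed.

(** The index shift cancels a factor of the factorial: (k + 1) B^(k+1) / (k + 1)! = B B^k / k!.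
    Termwise differentiation thus becomes the equation E' = B E. *)
Lemma pseries_diffs_exp_entry i j :
  pseries_diffs (exp_entry i j) = fun k => \sum_l B i l * exp_entry l j k.
Proof.
apply/funext => k; rewrite /pseries_diffs /exp_entry factS natrM invfM.
rewrite mulrA mulrA divff ?pnatr_eq0// mul1r exprS mxE mulr_sumr.
by apply: eq_bigr => l _; rewrite mulrCA.
Qed.

Let cvg_entry i j (x : R) : cvgn (pseries (exp_entry i j) x).
Proof. exact: (cvg_pseries_exp_bound (exp_entry_le i j)). Qed.

Let cvg_sum_entry (f : 'I_n -> R) (g : 'I_n -> R^nat) (x : R) :
  (forall l, cvgn (pseries (g l) x)) ->
  pseries (fun k => \sum_l f l * g l k) x @ \oo --> \sum_l f l * limn (pseries (g l) x).
Proof.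
move=> cg.
have -> : pseries (fun k => \sum_l f l * g l k) x =
          (fun N => \sum_l f l * pseries (g l) x N).
  apply/funext => N; rewrite /pseries /series /=.
  under eq_bigr do rewrite mulr_suml.
  rewrite exchange_big; apply: eq_bigr => l _; rewrite mulr_sumr.
  by apply: eq_bigr => k _; rewrite mulrA.
by apply: cvg_bigsum => l; apply: cvgM; [exact: cvg_cst|exact: cg].
Qed.

(** The limit in [expmx] is one of matrices; there are finitely many entries, so a common index
    serves them all, and the exponential becomes a family of scalar power series. *)
Lemma mxflow_entry s i j : mxflow s i j = limn (pseries (exp_entry i j) s).
Proof.
pose L : 'M[R]_n := \matrix_(i, j) limn (pseries (exp_entry i j) s).
suff -> : mxflow s = L by rewrite mxE.
have powZ k : (s *: B) ^+ k = s ^+ k *: B ^+ k.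
  elim: k => [|k ih]; first by rewrite !expr0 scale1r.
  by rewrite !exprS ih -[LHS]scalemxAl -[X in _ *: X]scalemxAr scalerA.
apply: cvg_lim; first exact: norm_hausdorff.
apply/cvg_ballP => e e0.
have h (p : 'I_n * 'I_n) : \forall N \near \oo,
    ball (L p.1 p.2) e (series (fun k => k`!%:R^-1 *: (s *: B) ^+ k) N p.1 p.2).
  have e1 N : series (fun k => k`!%:R^-1 *: (s *: B) ^+ k) N p.1 p.2 =
            pseries (exp_entry p.1 p.2) s N.
    rewrite /pseries /series /= summxE; apply: eq_bigr => k _.
    by rewrite powZ !mxE /exp_entry -mulrA; congr (_ * _); rewrite mulrC.
  have /cvg_ballP/(_ e e0) := @cvg_entry p.1 p.2 s.
  by apply: filterS => N; rewrite e1 mxE.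
have hh := filter_forall _ h; near=> N.
have HN : forall p : 'I_n * 'I_n, ball (L p.1 p.2) e
  (series (fun k => k`!%:R^-1 *: (s *: B) ^+ k) N p.1 p.2) by near: N; exact: hh.
by split => // k l; exact: (HN (k, l)).
Unshelve. all: by end_near. Qed.

Lemma is_derive_mxflow s i j :
  is_derive s 1 (fun t => mxflow t i j) ((B *m mxflow s) i j).
Proof.
have -> : (fun t => mxflow t i j) = (fun t => limn (pseries (exp_entry i j) t)).
  by apply/funext => t; rewrite mxflow_entry.
have -> : (B *m mxflow s) i j = limn (pseries (pseries_diffs (exp_entry i j)) s).
  rewrite pseries_diffs_exp_entry; apply/esym/cvg_lim => //.
  rewrite mxE; under eq_bigr do rewrite mxflow_entry.
  exact: (@cvg_sum_entry (B i) _ s (fun l => @cvg_entry l j s)).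
apply: (@pseries_snd_diffs _ _ (`|s| + 1)).
- exact: cvg_entry.
- rewrite pseries_diffs_exp_entry; apply/cvg_ex; eexists.
  by apply: cvg_sum_entry => l; exact: cvg_entry.
- rewrite pseries_diffs_exp_entry.
  have -> : pseries_diffs (fun k => \sum_l B i l * exp_entry l j k) =
            (fun k => \sum_l B i l * pseries_diffs (exp_entry l j) k).
    apply/funext => k; rewrite /pseries_diffs mulr_sumr.
    by apply: eq_bigr => l _; rewrite mulrCA.
  apply/cvg_ex; eexists; apply: cvg_sum_entry => l.
  rewrite pseries_diffs_exp_entry; apply/cvg_ex; eexists.
  by apply: cvg_sum_entry => k; exact: cvg_entry.
- by rewrite [ltRHS]ger0_norm ?addr_ge0// ltrDl.
Qed.

Lemma mxflow0 : mxflow 0 = 1%:M.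
Proof.
apply/matrixP => i j; rewrite mxflow_entry; apply: cvg_lim => //.
apply: cvg_near_cst; exists 1%N => // -[//|N] _.
rewrite /pseries /series /= big_nat_recl//= big1.
  by rewrite addr0 /exp_entry fact0 invr1 mul1r [0 ^+ 0]expr0 mulr1.
by move=> k _; rewrite exprS mul0r mulr0.
Qed.

Lemma mulmx_mxflow_comm s : B *m mxflow s = mxflow s *m B.
Proof.
apply/matrixP => i j; rewrite !mxE.
under eq_bigr do rewrite mxflow_entry.
under [RHS]eq_bigr do rewrite mxflow_entry mulrC.
have c1 := @cvg_sum_entry (B i) _ s (fun l => @cvg_entry l j s).
have c2 := @cvg_sum_entry (fun l => B l j) _ s (fun l => @cvg_entry i l s).
apply: (cvg_unique _ c1) => //.
have -> // : (fun k => \sum_l B i l * exp_entry l j k) =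
             (fun k => \sum_l B l j * exp_entry i l k).
apply/funext => k; have e : B *m (B ^+ k) = (B ^+ k) *m B by rewrite -[LHS]exprS exprSr.
move/matrixP/(_ i j): e; rewrite !mxE => e.
have := congr1 (fun z => k`!%:R^-1 * z) e; rewrite /= !mulr_sumr => e'.
under eq_bigr do rewrite /exp_entry mulrCA.
by rewrite e'; apply: eq_bigr => l _; rewrite /exp_entry; ring.
Qed.

Lemma is_derive_bigsum (f : 'I_n -> R -> R) (df : 'I_n -> R) s :
  (forall l, is_derive s 1 (f l) (df l)) ->
  is_derive s 1 (fun t => \sum_l f l t) (\sum_l df l).
Proof.
move=> h; elim: (index_enum _) => [|l r ir].
  by under eq_fun do rewrite big_nil; rewrite big_nil; exact: is_derive_cst.
under eq_fun do rewrite big_cons; rewrite big_cons.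
exact: is_deriveD.
Qed.

(** For fixed [c] the product E(-z) E(z + c) has zero derivative in [z], so it keeps its value at z
    = 0. This takes the place of a Cauchy product of matrix series. *)
Lemma mxflowD s t : mxflow (s + t) = mxflow s *m mxflow t.
Proof.
have der (x c : R) i j : is_derive x 1
    (fun z => (mxflow (- z) *m mxflow (z + c)) i j) 0.
  have dn l : is_derive x 1 (fun z => mxflow (- z) i l)
      (- (B *m mxflow (- x)) i l).
    rewrite -[X in is_derive _ _ _ X]mulrN1.
    exact: (@is_derive1_comp _ (fun z => mxflow z i l) -%R _ _ _ (is_derive_mxflow _ _ _)).
  have dp l : is_derive x 1 (fun z => mxflow (z + c) l j)
      ((B *m mxflow (x + c)) l j).
    rewrite -[X in is_derive _ _ _ X]mulr1.
    have d1 : is_derive x 1 (fun z : R => z + c) (1 + 0) by exact: is_deriveD.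
    rewrite addr0 in d1.
    exact: (@is_derive1_comp _ (fun z => mxflow z l j) (fun z => z + c) _ _ _ (is_derive_mxflow _ _ _)).
  under eq_fun do rewrite mxE.
  have := is_derive_bigsum (fun l => is_deriveM (dn l) (dp l)).
  suff -> : \sum_l (mxflow (- x) i l *: (B *m mxflow (x + c)) l j +
      mxflow (x + c) l j *: - (B *m mxflow (- x)) i l) = 0 by [].
  rewrite big_split /=.
  have -> : \sum_l (mxflow (- x) i l *: (B *m mxflow (x + c)) l j) =
      (mxflow (- x) *m (B *m mxflow (x + c))) i j by rewrite [RHS]mxE.
  have -> : \sum_l (mxflow (x + c) l j *: - (B *m mxflow (- x)) i l) =
      - (B *m mxflow (- x) *m mxflow (x + c)) i j.
    move: (B *m mxflow (- x)) => P; rewrite mxE -sumrN.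
    by apply: eq_bigr => l _; rewrite scalerN [in RHS]mulrC.
  by rewrite (mulmx_mxflow_comm (- x)) -mulmxA subrr.
have inv c d : mxflow (- d) *m mxflow (d + c) = mxflow c.
  apply/matrixP => i j.
  have -> := @is_derive_0_is_cst R (fun z => (mxflow (- z) *m mxflow (z + c)) i j) d 0
    (fun x => der x c i j).
  by rewrite oppr0 mxflow0 mul1mx add0r.
have inv0 d : mxflow d *m mxflow (- d) = 1%:M.
  by have := inv 0 (- d); rewrite opprK addr0 mxflow0.
by have := congr1 (mulmx (mxflow s)) (inv t s); rewrite mulmxA inv0 mul1mx.
Qed.

Lemma mxflowN s : mxflow (- s) *m mxflow s = 1%:M.
Proof. by rewrite -mxflowD addNr mxflow0. Qed.

Lemma mxflowNr s : mxflow s *m mxflow (- s) = 1%:M.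
Proof. by rewrite -mxflowD subrr mxflow0. Qed.

Lemma mxflow_unit s : mxflow s \in unitmx.
Proof. by have /mulmx1_unit[] := mxflowN s. Qed.

Lemma continuous_mxflow i j : continuous (fun s => mxflow s i j).
Proof.
move=> s; apply: differentiable_continuous; apply/derivable1_diffP.
by have [] := is_derive_mxflow s i j.
Qed.

Lemma continuous_sum (T : topologicalType) (f : 'I_n -> T -> R) :
  (forall i, continuous (f i)) -> continuous (fun y => \sum_i f i y).
Proof. by move=> cf y; apply: cvg_bigsum => i; exact: cf. Qed.

Lemma continuous_enorm_mxflow v : continuous (fun s => enorm (mxflow s *m v)).
Proof.
move=> s; rewrite /enorm.
apply: (@continuous_comp _ _ _ (fun s => dot (mxflow s *m v) (mxflow s *m v)) Num.sqrt).
  have c i : continuous (fun s => (mxflow s *m v) i 0).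
    under [X in continuous X]eq_fun do rewrite mxE.
    apply: continuous_sum => j x; apply: cvgM; last exact: cvg_cst.
    exact: continuous_mxflow.
  by apply: continuous_sum => i x; apply: cvgM; exact: c.
exact: sqrt_continuous.
Qed.

(** Bounds the operator norm as [mxbound] does, but involves the entries only through absolute
    values, so continuity and convergence to 0 follow entrywise. *)
Definition mxl1 A : R := \sum_i \sum_j `|A i j|.

Lemma mxl1_ge0 A : 0 <= mxl1 A.
Proof. by apply: sumr_ge0 => i _; apply: sumr_ge0. Qed.

Lemma enorm_mulmx_mxl1 A v : enorm (A *m v) <= mxl1 A * enorm v.
Proof.
rewrite (le_trans (enorm_le_coord _))// mulr_suml; apply: ler_sum => i _.
rewrite mxE mulr_suml (le_trans (ler_norm_sum _ _ _))//; apply: ler_sum => j _.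
by rewrite normrM ler_wpM2l// coord_le_enorm.
Qed.

Lemma continuous_mxl1_mxflow A : continuous (fun s => mxl1 (mxflow s - A)).
Proof.
apply: continuous_sum => i; apply: continuous_sum => j x.
apply: (@continuous_comp _ _ _ (fun s => (mxflow s - A) i j) Num.norm); last first.
  exact: norm_continuous.
have -> : (fun s => (mxflow s - A) i j) = (fun s => mxflow s i j - A i j).
  by apply/funext => s; rewrite !mxE.
by apply: cvgB; [exact: continuous_mxflow|exact: cvg_cst].
Qed.

Lemma mxflow_bounded (l : R) : exists2 C : R, 0 <= C &
  forall s v, `|s| <= l -> enorm (mxflow s *m v) <= C * enorm v.
Proof.
have [l0|l0] := ltP l 0.
  exists 0 => // s v sl; exfalso; move: sl; rewrite leNgt.
  by rewrite (lt_le_trans l0).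
have [||c _ hc] := @EVT_max R (fun s => mxl1 (mxflow s - 0)) (- l) l.
- by rewrite ge0_cp.
- exact/continuous_subspaceT/continuous_mxl1_mxflow.
exists (mxl1 (mxflow c - 0)); first exact: mxl1_ge0.
move=> s v; rewrite ler_norml => sl.
rewrite (le_trans (enorm_mulmx_mxl1 _ _))// ler_wpM2r ?enorm_ge0//.
by have := hc s; rewrite in_itv /= subr0; exact.
Qed.

Lemma mxflow_near1 (e : R) : 0 < e -> exists2 d : R, 0 < d &
  forall s v, `|s| <= d -> enorm (mxflow s *m v - v) <= e * enorm v.
Proof.
move=> e0; have := @continuous_mxl1_mxflow 1%:M 0.
rewrite /continuous_at mxflow0 => /cvgrPdist_lt/(_ e e0)/nbhs_ballP[d /= d0 hd].
exists (d / 2); first by rewrite divr_gt0.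
move=> s v sd; rewrite -[X in _ - X]mul1mx -mulmxBl.
rewrite (le_trans (enorm_mulmx_mxl1 _ _))// ler_wpM2r ?enorm_ge0//.
have : ball (0 : R) d s.
  by rewrite /ball /= sub0r normrN (le_lt_trans sd)// ltr_pdivrMr// mulr_natr mulr2n ltrDl.
move/hd => /=; rewrite subrr.
have -> : mxl1 0 = 0 :> R.
  by rewrite /mxl1 big1// => i _; rewrite big1// => j _; rewrite mxE normr0.
by rewrite sub0r normrN ger0_norm ?mxl1_ge0//; exact: ltW.
Qed.

End matrix_exponential.

(** * Last exit of an orbit from the unit ball *)

Section last_exit.
Context {R : realType} {n : nat}.
Notation V := 'cV[R]_n.
Implicit Types (u v w : V) (r s t x a b : R).
Variable B : 'M[R]_n.
Notation E := (mxflow B).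

Definition outside_after a : set V := [set v | forall r, a < r -> 1 < enorm (E r *m v)].

Lemma outside_after_le a b v : a <= b -> outside_after a v -> outside_after b v.
Proof. by move=> ab h r br; apply: h; exact: le_lt_trans br. Qed.

Lemma outside_after_flow a r v : outside_after a (E r *m v) <-> outside_after (a + r) v.
Proof.
split=> h x.
  by rewrite -ltrBrDr => /h; rewrite mulmxA -mxflowD subrK.
by move=> ax; rewrite mulmxA -mxflowD; apply: h; rewrite ltrD2r.
Qed.

Let clamp a (j : nat) (q : rat) : R := Num.max (a + j.+1%:R^-1) (Num.min (a + j.+1%:R) (ratr q)).

(** A countable description, for measurability. On a compact interval of times after [a] the norm
    attains its minimum, so staying above 1 means staying above some 1 + 1/i; by continuity rational
    times suffice, and [clamp] moves a rational into the interval. *)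
Let outside_afterE a : outside_after a =
  \bigcap_j \bigcup_i ~` (\bigcup_q ~` [set v | 1 + i.+1%:R^-1 <= enorm (E (clamp a j q) *m v)]).
Proof.
have j1 (j : nat) : j.+1%:R^-1 <= j.+1%:R :> R.
  by rewrite (@le_trans _ _ 1)// ?invf_le1// ler1n.
apply/seteqP; split=> v /= h.
  move=> j _.
  have [||c cI hc] := @EVT_min R (fun s => enorm (E s *m v)) (a + j.+1%:R^-1) (a + j.+1%:R).
  - by rewrite lerD2l.
  - exact/continuous_subspaceT/continuous_enorm_mxflow.
  have c1 : 1 < enorm (E c *m v).
    apply: h; move: cI; rewrite in_itv /= => /andP[+ _].
    by apply: lt_le_trans; rewrite ltrDl invr_gt0.
  have [i hi] := ltr_add_invr c1.
  exists i => // -[q _]; apply => /=.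
  apply: (le_trans (ltW hi)); apply: (hc (clamp a j q)).
  by rewrite in_itv /= /clamp le_max lexx /= ge_max lerD2l j1 ge_min lexx.
move=> r ar.
have [j1' hj1] := ltr_add_invr ar.
(* With this [j] the time [r] lies inside the interval, with room on the right for a nearby
   rational. *)
pose j2 := Num.bound (r - a); pose j := maxn j1' j2.
have [i _ hi] := h j I.
rewrite (@lt_le_trans _ _ (1 + i.+1%:R^-1))// ?ltrDl ?invr_gt0// leNgt; apply/negP => rlt.
have /cvgrPdist_lt := @continuous_enorm_mxflow _ _ B v r.
move/(_ _ (eq_ind_r is_true rlt (subr_gt0 _ _))) => /nbhs_ballP[d /= d0 hd].
have rj : r < Num.min (r + d) (a + j.+1%:R).
  rewrite lt_min ltrDl d0 /= -ltrBlDl (lt_le_trans (unstable.ltr_bound _))//.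
  by rewrite ler_nat -/j2 (leq_trans (leq_maxr j1' j2)).
have [q] := rat_in_itvoo rj.
rewrite in_itv /= lt_min => /and3P[rq qd qj].
apply: hi; exists q => //=; apply/negP; rewrite -ltNge.
have -> : clamp a j q = ratr q.
  rewrite /clamp min_r ?(ltW qj)// max_r//.
  rewrite (le_trans _ (ltW rq))// (le_trans _ (ltW hj1))// lerD2l lef_pV2 ?posrE//.
  by rewrite ler_nat ltnS leq_maxl.
have : ball r d (ratr q) by rewrite /ball /= distrC gtr0_norm ?subr_gt0// ltrBlDl.
move=> /hd /=; rewrite ltr_distlC => /andP[_].
by rewrite addrC subrK.
Qed.

Lemma measurable_enorm_mxflow (S : set R) r : measurable S ->
  measurable [set v | S (enorm (E r *m v))].
Proof.
move=> mS; rewrite -[X in measurable X]setTI.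
have mf : measurable_fun setT (fun v => enorm (E r *m v)).
  exact: (measurable_fun_mulmx _ measurable_enorm).
exact: mf.
Qed.

Lemma measurable_outside_after a : measurable (outside_after a).
Proof.
rewrite outside_afterE; apply: bigcapT_measurable => j.
apply: bigcupT_measurable => i; apply: measurableC.
apply: bigcupT_measurable_rat => q; apply: measurableC.
rewrite (_ : [set v | _] = [set v | [set` `[1 + i.+1%:R^-1, +oo[] (enorm (E (clamp a j q) *m v))]).
  exact: measurable_enorm_mxflow (measurable_itv _).
by apply/seteqP; split=> v /=; rewrite in_itv /= andbT.
Qed.

(** The upward closed set of admissible times is neither empty nor the whole line, so its infimum is
    finite. Elsewhere [last_exit] takes the placeholder value 0. *)
Definition exits v : Prop := (exists a, outside_after a v) /\ (exists a, ~ outside_after a v).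

Definition last_exit v : R :=
  if `[< exits v >] then inf [set a | outside_after a v] else 0.

Lemma exits_flow r v : exits (E r *m v) <-> exits v.
Proof.
split=> -[[a ha] [b hb]].
  by split; [exists (a + r); apply/outside_after_flow|
             exists (b + r) => /outside_after_flow].
by split; [exists (a - r); apply/outside_after_flow; rewrite subrK|
           exists (b - r) => /outside_after_flow; rewrite subrK].
Qed.

(** The infimum is attained, because [outside_after] constrains only the times strictly after
    [a]. *)
Lemma last_exitP a v : exits v -> outside_after a v <-> last_exit v <= a.
Proof.
move=> ev; rewrite /last_exit (asboolT ev); have [[c hc] [b hb]] := ev.
have hl : has_lbound [set a | outside_after a v].
  exists b => x /= hx; rewrite leNgt; apply/negP => /ltW xb.
  exact: hb (outside_after_le xb hx).
have hi : has_inf [set a | outside_after a v] by split => //; exists c.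
split=> [h|h r ar]; first exact: (ge_inf hl).
have [x hx xr] := inf_adherent (eq_ind_r is_true (le_lt_trans h ar) (subr_gt0 _ _)) hi.
by apply: hx; move: xr; rewrite addrC subrK.
Qed.

Lemma last_exit_flow r v : exits v -> last_exit (E r *m v) = last_exit v - r.
Proof.
move=> ev; have ev' := (exits_flow r v).2 ev.
apply/le_anti/andP; split.
  by apply/(last_exitP _ ev')/outside_after_flow; rewrite subrK; apply/last_exitP.
rewrite lerBlDr; apply/(last_exitP _ ev)/outside_after_flow.
by apply/last_exitP.
Qed.

Definition exit_point v : V := E (last_exit v) *m v.

(** By continuity, a norm above 1 at the last exit would persist a little earlier and lower the
    infimum; a norm below 1 would persist a little later, against [outside_after]. *)
Lemma enorm_exit_point v : exits v -> enorm (exit_point v) = 1.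
Proof.
move=> ev; have ho := (last_exitP (last_exit v) ev).2 (lexx _).
have cv := @continuous_enorm_mxflow _ _ B v (last_exit v).
apply/eqP; move: cv => /cvgrPdist_lt cv; rewrite eq_le; apply/andP; split; rewrite leNgt; apply/negP => h.
  have := cv _ (eq_ind_r is_true h (subr_gt0 _ _)) => /nbhs_ballP[d /= d0 hd].
  have : outside_after (last_exit v - d / 2) v.
    move=> r hr; have [rx|rx] := ltP (last_exit v) r; first exact: ho.
    have : ball (last_exit v) d r.
      rewrite /ball /= ger0_norm ?subr_ge0// ltrBlDl -ltrBlDr.
      by rewrite (lt_trans _ hr)// ltrD2l ltrN2 ltr_pdivrMr// mulr_natr mulr2n ltrDl.
    move=> /hd /=; rewrite -/(exit_point v) ltr_distlC => /andP[+ _].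
    by rewrite opprB addrC subrK.
  by move/last_exitP => /(_ ev); rewrite leNgt ltrBlDr ltrDl divr_gt0.
have := cv _ (eq_ind_r is_true h (subr_gt0 _ _)) => /nbhs_ballP[d /= d0 hd].
have := ho (last_exit v + d / 2); rewrite ltrDl divr_gt0// => /(_ isT).
have : ball (last_exit v) d (last_exit v + d / 2).
  rewrite /ball /= opprD addrA subrr sub0r normrN gtr0_norm ?divr_gt0//.
  by rewrite ltr_pdivrMr// mulr_natr mulr2n ltrDl.
move=> /hd /=; rewrite -/(exit_point v) ltr_distlC => /andP[_].
by rewrite addrCA subrr addr0 => /lt_trans/[apply]; rewrite ltxx.
Qed.

Lemma exit_pointK v : v = E (- last_exit v) *m exit_point v.
Proof. by rewrite /exit_point mulmxA mxflowN mul1mx. Qed.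

Lemma exit_point_flow r v : exits v -> exit_point (E r *m v) = exit_point v.
Proof.
by move=> ev; rewrite /exit_point last_exit_flow// mulmxA -mxflowD subrK.
Qed.

Lemma L_setE v : L_set B v <-> enorm v = 1 /\ outside_after 0 v.
Proof.
split=> -[v1 h]; split => // t t0.
  by have := h (expR t); rewrite expR_gt1 /powmx expRK; exact.
by apply: h; rewrite ln_gt0.
Qed.

Lemma L_set_exits v : L_set B v -> exits v /\ last_exit v = 0.
Proof.
move=> /L_setE[v1 h].
have hn a : a < 0 -> ~ outside_after a v.
  by move=> a0 /(_ 0 a0); rewrite mxflow0 mul1mx v1 ltxx.
have ev : exits v by split; [exists 0|exists (-1); apply: hn; rewrite ltrN10].
split => //; apply/le_anti/andP; split; first exact/last_exitP.
rewrite leNgt; apply/negP => /hn; apply; exact/last_exitP.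
Qed.

Lemma exit_point_L_set v : exits v -> L_set B (exit_point v).
Proof.
move=> ev; apply/L_setE; split; first exact: enorm_exit_point.
by apply/outside_after_flow; rewrite add0r; apply/last_exitP.
Qed.

(** An exiting orbit meets [L_set B] only in its exit point, so the rays in [K_meas] consist of the
    vectors past their last exit whose exit point lies in [S]. Hence [K_meas] is the pushforward of
    a restriction of [M]. *)
Lemma L_set_raysE (S : set V) :
  [set x | exists v t, [/\ (S `&` L_set B) v, 1 <= t & x = powmx t B *m v]] =
  [set x | exits x] `&` outside_after 0 `&` exit_point @^-1` S.
Proof.
apply/seteqP; split=> x /=.
  move=> [v [t [[Sv /L_set_exits[ev sv]] t1 ->]]]; rewrite /powmx.
  have et := (exits_flow (ln t) v).2 ev.
  rewrite /exit_point; split; first split => //.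
    by apply/(last_exitP _ et); rewrite last_exit_flow// sv sub0r oppr_le0 ln_ge0.
  rewrite -/(exit_point _) -/(mxflow _ _) (exit_point_flow _ ev).
  by rewrite /exit_point sv mxflow0 mul1mx.
move=> [[ex /(last_exitP _ ex) hx] Sx].
exists (exit_point x), (expR (- last_exit x)); split.
- by split => //; exact: exit_point_L_set.
- by rewrite -expR0 ler_expR oppr_ge0.
- by rewrite /powmx expRK -/(mxflow _ _) -exit_pointK.
Qed.

Lemma measurable_exits : measurable [set v | exits v].
Proof.
have -> : [set v | exits v] = (\bigcup_(k : nat) outside_after k%:R) `&`
    ~` (\bigcap_(k : nat) outside_after (- k%:R)).
  apply/seteqP; split=> v /= [].
    move=> [a ha] [b hb]; split.
      exists (Num.bound a) => //; apply: outside_after_le ha.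
      exact/ltW/unstable.ltr_bound.
    move=> h; apply: hb; apply: outside_after_le (h (Num.bound (- b)) I).
    by rewrite lerNl; exact/ltW/unstable.ltr_bound.
  move=> [k _ hk] h; split; first by exists k%:R.
  by apply: contrapT => hn; apply: h => j _; apply: contrapT => hj; apply: hn; exists (- j%:R).
apply: measurableI.
  by apply: bigcupT_measurable => k; exact: measurable_outside_after.
by apply: measurableC; apply: bigcapT_measurable => k; exact: measurable_outside_after.
Qed.

Lemma measurable_last_exit : measurable_fun setT last_exit.
Proof.
apply: (measurability _ (RGenOInfty.measurableE R)) => _ [_ [x ->] <-].
rewrite setTI (_ : _ @^-1` _ = ([set v | exits v] `&` ~` outside_after x) `|`
    (~` [set v | exits v] `&` [set v : V | x < 0])).
  apply: measurableU; apply: measurableI.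
  - exact: measurable_exits.
  - by apply: measurableC; exact: measurable_outside_after.
  - by apply: measurableC; exact: measurable_exits.
  - by case: (x < 0); [rewrite (_ : [set v | _] = setT)|rewrite (_ : [set v | _] = set0)];
      rewrite //; apply/seteqP; split.
apply/seteqP; split=> v /=; rewrite in_itv /= andbT.
  move=> xl; have [ev|nev] := pselect (exits v).
    by left; split => // /(last_exitP _ ev); rewrite leNgt xl.
  by right; split => //; move: xl; rewrite /last_exit (asboolF nev).
move=> [[ev h]|[nev x0]]; last by rewrite /last_exit (asboolF nev).
by rewrite ltNge; apply/negP => /(last_exitP _ ev).
Qed.

Lemma measurable_exit_point : measurable_fun setT exit_point.
Proof.
apply: measurable_mxP => i j.
rewrite (_ : (fun _ => _) = (fun v : V => \sum_k E (last_exit v) i k * v k j)).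
  apply: measurable_sum => k; apply: measurable_funM; last exact: measurable_coord.
  apply: (@measurableT_comp _ _ _ _ _ _ (fun s => E s i k)); last exact: measurable_last_exit.
  by apply: continuous_measurable_fun; exact: continuous_mxflow.
by apply/funext => v; rewrite mxE.
Qed.

End last_exit.

(** * The continuous case *)

Section backward_decay.
Context {R : realType} {n : nat}.
Notation V := 'cV[R]_n.
Implicit Types (u v w x y : V) (r s t a b : R).
Variable B : 'M[R]_n.
Notation E := (mxflow B).

(** Backward time runs through the integers only; [decays_flow_bound] passes to real times. *)
Definition decays v : Prop := (fun k : nat => enorm (E (- k%:R) *m v)) @ \oo --> 0.

Lemma decays_le v (c : R) (f : nat -> R) : f @ \oo --> 0 ->
  (forall k, enorm (E (- k%:R) *m v) <= c * f k) -> decays v.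
Proof.
move=> f0 h; apply: (@squeeze_cvgr _ _ _ _ (fun=> 0) (fun k => c * f k)).
- by apply: nearW => k; rewrite enorm_ge0 h.
- exact: cvg_cst.
- by rewrite -(mulr0 c); apply: cvgM => //; exact: cvg_cst.
Qed.

Lemma decays0 : decays 0.
Proof.
apply: (@decays_le 0 0 (fun=> 0)); first exact: cvg_cst.
by move=> k; rewrite mulmx0 enorm0 mulr0.
Qed.

Lemma decaysD x y : decays x -> decays y -> decays (x + y).
Proof.
move=> dx dy; apply: (@decays_le _ 1 (fun k => enorm (E (- k%:R) *m x) + enorm (E (- k%:R) *m y))).
  by rewrite -(addr0 0); exact: cvgD.
by move=> k; rewrite mul1r mulmxDr enormD.
Qed.

Lemma decaysZ a x : decays x -> decays (a *: x).
Proof.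
move=> dx; apply: (decays_le (c := `|a|) dx) => k.
by rewrite -scalemxAr enormZ.
Qed.

Lemma decays_flow r x : decays x -> decays (E r *m x).
Proof.
move=> dx; apply: (decays_le (c := mxbound (E r)) dx) => k.
by rewrite mulmxA -mxflowD addrC mxflowD -mulmxA enorm_mulmx.
Qed.

(** The decaying vectors form a subspace. With [P] a projection onto it, the columns of [P] decay,
    so E(-k) P tends to 0 entrywise and its size is a rate valid for all decaying vectors. *)
Lemma decays_uniform : exists2 c : nat -> R, c @ \oo --> 0 &
  forall k x, decays x -> enorm (E (- k%:R) *m x) <= c k * enorm x.
Proof.
have [W [FW WF]] := subspace_basis decays0 decaysD decaysZ.
pose P := W *m (pinvmx W^T)^T.
have PW x : decays x -> P *m x = x.
  move=> /WF[y ->]; rewrite mulmxA; congr (_ *m _).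
  by apply: trmx_inj; rewrite /P 2!trmx_mul trmxK mulmxA; apply: mulmxKpV.
exists (fun k => mxl1 (E (- k%:R) *m P)); last first.
  by move=> k x dx; rewrite -{1}(PW x dx) mulmxA enorm_mulmx_mxl1.
rewrite -(_ : \sum_(i < n) \sum_(j < n) `|0 : R| = 0); last first.
  by rewrite big1// => i _; rewrite big1// => j _; rewrite normr0.
apply: cvg_bigsum => i; apply: cvg_bigsum => j.
apply: (@squeeze_cvgr _ _ _ _ (fun=> 0) (fun k => enorm (E (- k%:R) *m (P *m delta_mx j 0 : V)))).
- apply: nearW => k; rewrite normr_ge0 /= (le_trans _ (coord_le_enorm _ i))//.
  by rewrite mulmxA -colE [X in _ <= `|X|]mxE.
- by rewrite normr0; exact: cvg_cst.
- by rewrite normr0 /P -mulmxA; exact: FW.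
Qed.

Lemma decays_flow_bound : exists2 c : nat -> R, c @ \oo --> 0 &
  forall s x, 0 <= s -> decays x -> enorm (E (- s) *m x) <= c (Num.trunc s) * enorm x.
Proof.
have [c c0 hc] := decays_uniform; have [C C0 hC] := mxflow_bounded B 1.
exists (fun k => C * c k).
  by rewrite -(mulr0 C); apply: cvgM => //; exact: cvg_cst.
move=> s x s0 dx; have /andP[s1 s2] := truncn_itv s0.
have -> : - s = - (s - (Num.trunc s)%:R) + - (Num.trunc s)%:R by rewrite opprB addrAC subrr add0r.
rewrite mxflowD -mulmxA (le_trans (hC _ _ _))//.
  rewrite normrN ger0_norm ?subr_ge0// lerBlDl.
  by rewrite natr1 ltW.
by rewrite -mulrA ler_wpM2l// hc.
Qed.

Lemma decays_bounded : exists C : R,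
  forall s x, 0 <= s -> decays x -> enorm (E (- s) *m x) <= C * enorm x.
Proof.
have [c c0 hc] := decays_flow_bound.
have /cvg_seq_bounded[C [_ hC]] : cvgn c by apply/cvg_ex; exists 0.
exists (C + 1) => s x s0 dx; rewrite (le_trans (hc _ _ s0 dx))// ler_wpM2r ?enorm_ge0//.
rewrite (le_trans (ler_norm _))//; apply: (hC (C + 1)) => //.
by rewrite ltrDl.
Qed.

(** From |x| <= c |E r x|, where [c] drops below |x| for large [r], follows |E r x| > 1. Backward
    decay gives a time at which the orbit is inside the ball. *)
Lemma decays_exits x : decays x -> x != 0 -> exits B x.
Proof.
move=> dx x0; have [c c0 hc] := decays_flow_bound.
have ex : 0 < enorm x by rewrite enorm_gt0.
split.
  move: (c0) => /cvgrPdist_lt/(_ _ ex)[K _ hK].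
  exists K%:R => r Kr; rewrite ltNge; apply/negP => h.
  have r0 : 0 <= r by rewrite (le_trans _ (ltW Kr)).
  have := hc r (E r *m x) r0 (decays_flow r dx).
  rewrite mulmxA mxflowN mul1mx leNgt => /negP; apply.
  have Kt : (K <= Num.trunc r)%N.
    by rewrite -ltnS -(ltr_nat R) (lt_trans Kr)//; have /andP[] := truncn_itv r0.
  have := hK _ Kt; rewrite /= sub0r normrN => cK.
  apply: le_lt_trans cK.
  apply: (le_trans (y := `|c (Num.trunc r)| * enorm (E r *m x))).
    by rewrite ler_wpM2r ?enorm_ge0// ler_norm.
  by rewrite ler_piMr.
move: (dx) => /cvgrPdist_lt/(_ _ ltr01)[K _ hK].
exists (- K%:R - 1) => /(_ (- K%:R)); rewrite gtrDl ltrN10 => /(_ isT).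
have := hK K (leqnn K); rewrite /= sub0r normrN ger0_norm ?enorm_ge0//.
by move=> /lt_trans/[apply]; rewrite ltxx.
Qed.

Variables (D : 'M[R]_n) (M : {measure set V -> \bar R}).
Hypothesis lM : levy_measure M.

(** Markov's inequality for [lkern], which increases with the norm. *)
Lemma levy_tail_fin (e : R) : 0 < e -> (M [set v | (e <= enorm v)%R] < +oo)%E.
Proof.
move=> e0; pose d := e ^+ 2 / (1 + e ^+ 2).
have d0 : 0 < d by rewrite divr_gt0 ?exprn_gt0// ltr_pwDl// sqr_ge0.
have [_ il] := (levy_measureP M).1 lM.
have ml := measurable_int _ il.
have := le_integral_abse M measurableT ml d0.
have dE v : (d <= lkern v) = (e <= enorm v).
  have p1 : 0 < 1 + e ^+ 2 by rewrite ltr_pwDl// sqr_ge0.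
  have p2 : 0 < 1 + enorm v ^+ 2 by rewrite ltr_pwDl// sqr_ge0.
  rewrite ler_pdivrMr// mulrAC ler_pdivlMr// !mulrDr !mulr1 [X in _ <= _ + X]mulrC lerD2r.
  by rewrite ler_pXn2r ?nnegrE ?enorm_ge0// ltW.
have -> : [set: V] `&` [set x | (d%:E <= `|(EFin \o @lkern R n) x|)%E] = [set v | e <= enorm v].
  by rewrite setTI; apply/seteqP; split=> v /=; rewrite lee_fin ger0_norm ?lkern_ge0// dE.
move=> /le_lt_trans h; have {h} := h _ (integrableP _ _ _ il).2.
rewrite -[X in (_ < X)%E -> _](gt0_mulye (x := d%:E)) ?lte_fin// muleC.
by rewrite lte_pmul2r ?lte_fin.
Qed.

Hypothesis GE : forall s, Gmx (expR s) D M (E s).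

Let far (j k : nat) : set V := [set v | j.+1%:R^-1 < enorm (E (- k%:R) *m v)].

Let mfar j k : measurable (far j k).
Proof.
rewrite (_ : far j k = [set v | [set` `]j.+1%:R^-1, +oo[] (enorm (E (- k%:R) *m v))]).
  exact: (measurable_enorm_mxflow B _ (measurable_itv _)).
by apply/seteqP; split=> v /=; rewrite in_itv /= andbT.
Qed.

Let not_decaysE : ~` [set v | decays v] = \bigcup_j lim_sup_set (far j).
Proof.
apply/seteqP; split=> v /=.
  move=> nd; apply: contrapT => h; apply: nd.
  apply/cvgrPdist_lt => e e0.
  have [j hj] := ltr_add_invr e0; rewrite add0r in hj.
  have : ~ lim_sup_set (far j) v by move=> hl; apply: h; exists j.
  move=> /existsNP[K /not_implyP[_ hK]].
  exists K => // k Kk; rewrite /= sub0r normrN ger0_norm ?enorm_ge0//.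
  apply: le_lt_trans hj; rewrite leNgt; apply/negP => hf.
  by apply: hK; exists k.
move=> [j _ hl] /cvgrPdist_lt /(_ j.+1%:R^-1).
rewrite invr_gt0 ltr0n => /(_ isT) [K _ hK].
have [k Kk] := hl K I; have := hK k Kk.
rewrite /= sub0r normrN ger0_norm ?enorm_ge0// /far /=.
by move=> /lt_trans/[apply]; rewrite ltxx.
Qed.

Lemma measurable_decays : measurable [set v | decays v].
Proof.
rewrite -[X in measurable X]setCK not_decaysE; apply: measurableC.
apply: bigcupT_measurable => j; apply: bigcapT_measurable => k.
by apply: bigcup_measurable => i _; exact: mfar.
Qed.

(** By the scaling of [M] along the flow, the [k]-th set has [expR (- k)] times the measure of the
    zeroth, which is contained in a tail of [M] and so finite; the series is geometric. *)
Lemma decays_conull : M (~` [set v | decays v]) = 0%E.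
Proof.
rewrite not_decaysE; apply: null_bigcup => j.
  apply: bigcapT_measurable => k.
  by apply: bigcup_measurable => i _; exact: mfar.
apply: lim_sup_set_cvg0; first exact: mfar.
pose S : set V := [set v | j.+1%:R^-1 < enorm v].
have mS : measurable S.
  by have := mfar j 0; rewrite /far oppr0 mxflow0; under eq_set do rewrite mul1mx.
have Sfin : (M S < +oo)%E.
  apply: (@le_lt_trans _ _ (M [set v | j.+1%:R^-1 <= enorm v])); last first.
    by apply: levy_tail_fin; rewrite invr_gt0.
  apply: le_measure; rewrite ?inE//; last by move=> v; exact: ltW.
  exact: measurable_enorm_ge.
have MS : M S = (fine (M S))%:E by rewrite fineK// ge0_fin_numE.
have MF k : M (far j k) = (fine (M S) * expR (-1) ^+ k)%:E.
  have [_ _ hE] := GE (- k%:R).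
  have := hE S mS; rewrite -[mulmx _ @^-1` _]/(far j k) => ->.
  by rewrite MS -EFinM mulrC -expRM_natl mulrN1.
apply: (@le_lt_trans _ _ (fine (M S) / (1 - expR (-1)))%:E); last exact: ltry.
apply: lime_le; first exact: is_cvg_nneseries.
apply: nearW => N; under eq_bigr do rewrite MF.
rewrite sumEFin lee_fin.
apply: (@geometric_le_lim R N (fine (M S)) (expR (-1))).
- by rewrite fine_ge0.
- exact: expR_gt0.
- by rewrite gtr0_norm ?expR_gt0// expR_lt1 ltrN10.
Qed.

End backward_decay.

Section set_function_integral.
Import HBNNSimple.

(** [K_meas] is a bare set function; the integral evaluates it only on level sets of simple
    functions, which are measurable. *)
Lemma eq_set_function_integral d (T : measurableType d) (R : realType)
    (m1 m2 : set T -> \bar R) (A : set T) (f : T -> \bar R) :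
  (forall S, measurable S -> m1 S = m2 S) ->
  (\int[m1]_(x in A) f x = \int[m2]_(x in A) f x)%E.
Proof.
move=> m12; rewrite /integral.
have e (h : {nnsfun T >-> R}) : sintegral m1 h = sintegral m2 h.
  by rewrite /sintegral; apply: eq_fsbigr => x _; rewrite m12//; exact: measurable_sfunP.
by congr (_ - _)%E; congr ereal_sup; apply/seteqP; split=> _ [h hf <-]; exists h.
Qed.

End set_function_integral.

(** * The drift cocycle of the flow and its derivative *)

Section continuous_case.
Context {R : realType} {n : nat}.
Notation V := 'cV[R]_n.
Implicit Types (u v w x y : V) (r s t h : R).
Variables (B D : 'M[R]_n) (M : {measure set V -> \bar R}).
Hypothesis lM : levy_measure M.
Notation E := (mxflow B).
Hypothesis GE : forall s, Gmx (expR s) D M (E s).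

(** The vectors whose last exit is at time 0 or earlier. They have norm at least 1, so [M] is finite
    on them. *)
Definition exited : set V := [set v | exits B v] `&` outside_after B 0.

Lemma measurable_exited : measurable exited.
Proof.
by apply: measurableI; [exact: measurable_exits|exact: measurable_outside_after].
Qed.

Definition iN v : R := \1_exited v.

Lemma iN_in v : exited v -> iN v = 1. Proof. by move=> h; rewrite /iN indicE mem_set. Qed.
Lemma iN_out v : ~ exited v -> iN v = 0. Proof. by move=> h; rewrite /iN indicE memNset. Qed.

Lemma measurable_iN : measurable_fun setT iN.
Proof. by apply: measurable_indic; exact: measurable_exited. Qed.

Lemma exited_flowE r v : exits B v -> exited (E r *m v) <-> last_exit B v <= r.
Proof.
move=> ev; split=> [[_ /outside_after_flow]|h].
  by rewrite add0r => /last_exitP; exact.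
split; first exact/exits_flow.
by apply/outside_after_flow; rewrite add0r; apply/last_exitP.
Qed.

Lemma exitedE v : exits B v -> exited v <-> last_exit B v <= 0.
Proof. by move=> ev; have := exited_flowE 0 ev; rewrite mxflow0 mul1mx. Qed.

Lemma exited_enorm v : exited v -> 1 <= enorm v.
Proof.
move=> hv; have [ev _] := hv; move: hv => /(exitedE ev); rewrite le_eqVlt => /orP[/eqP s0|s0].
  by have := enorm_exit_point ev; rewrite /exit_point s0 mxflow0 mul1mx => ->.
have /(_ 0 s0) := (last_exitP (last_exit B v) ev).2 (lexx _).
by rewrite mxflow0 mul1mx => /ltW.
Qed.

Lemma exited_fin : (M exited < +oo)%E.
Proof.
apply: le_lt_trans (levy_tail_fin lM ltr01); apply: le_measure; rewrite ?inE.
- exact: measurable_exited.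
- exact: measurable_enorm_ge.
- by move=> v; exact: exited_enorm.
Qed.

Lemma iN01 v : 0 <= iN v <= 1.
Proof. by rewrite /iN indicE; case: (_ \in _); rewrite /= lexx ler01. Qed.

Lemma integrable_iN : M.-integrable setT (EFin \o iN).
Proof.
apply/integrableP; split; first by apply/measurable_EFinP; exact: measurable_iN.
under eq_integral => v _ do rewrite /= ger0_norm ?(andP (iN01 v)).1//.
rewrite integral_indic//; last exact: measurable_exited.
by rewrite setIT; exact: exited_fin.
Qed.

(* Off the conull set of decaying orbits the default truncation [lphi] avoids any
   integrability condition. *)
Definition psi_flow v : R := if `[< decays B v >] then 1 - iN v else lphi v.

(** Before its last exit a nonzero decaying vector is E(-s) of a unit vector with s >= 0, hence
    bounded, and 1 - [lphi] = [lkern] does the rest. Afterwards |v| >= 1 and only [lphi] remains in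
    the difference. *)
Lemma truncation_psi_flow : truncation M psi_flow.
Proof.
have [C hC] := decays_bounded B.
apply: (@truncation_le _ _ _ lM _ (1 + `|C|)).
  apply: measurable_fun_ifT; last exact: measurable_lphi.
    apply: (measurable_fun_bool true); rewrite setTI.
    rewrite (_ : _ @^-1` _ = [set v | decays B v]); last first.
      by apply/seteqP; split=> v /= /asboolP.
    exact: (measurable_decays B).
  by apply: measurable_funB => //; exact: measurable_iN.
move=> v; have h1 : lkern v <= (1 + `|C|) * lkern v.
  by rewrite ler_peMl ?lkern_ge0// lerDl.
rewrite /psi_flow; case: asboolP => dv; last first.
  by rewrite subrr normr0 mul0r mulr_ge0 ?lkern_ge0// addr_ge0.
have [Nv|Nv] := pselect (exited v).
  rewrite (iN_in Nv) subrr subr0 gtr0_norm ?lphi_gt0// mulrC.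
  exact: le_trans (enorm_lphi_big (exited_enorm Nv)) h1.
rewrite (iN_out Nv) subr0 distrC -lkernE ger0_norm ?lkern_ge0//.
have [->|v0] := eqVneq v 0; first by rewrite lkern0 mulr0 mul0r.
have ev := decays_exits dv v0.
rewrite mulrC ler_wpM2r ?lkern_ge0//.
have s0 : 0 <= last_exit B v.
  by rewrite leNgt; apply/negP => /ltW/(exitedE ev).
rewrite [X in enorm X](exit_pointK B v) (le_trans (hC _ _ s0 _))//; last first.
  by rewrite (enorm_exit_point ev) mulr1 (le_trans (ler_norm _))// lerDr.
exact: decays_flow.
Qed.

(** For h > 0 the indicator of a last exit in ]-h, 0], for h < 0 minus the indicator of a last exit
    in ]0, -h]. *)
Definition slab h v : R := iN v - iN (E (- h) *m v).

Lemma measurable_slab h : measurable_fun setT (slab h).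
Proof.
apply: measurable_funB; first exact: measurable_iN.
exact: measurable_fun_mulmx measurable_iN.
Qed.

Lemma slab_support h v : slab h v != 0 -> exits B v /\ `|last_exit B v| <= `|h|.
Proof.
have [ev|nev] := pselect (exits B v); last first.
  have n1 : ~ exited v by case.
  have n2 : ~ exited (E (- h) *m v) by case=> /exits_flow.
  by rewrite /slab (iN_out n1) (iN_out n2) subrr eqxx.
move=> sl; split => //; move: sl; rewrite /slab.
have [N1|N1] := pselect (exited v); have [N2|N2] := pselect (exited (E (- h) *m v)).
- by rewrite (iN_in N1) (iN_in N2) subrr eqxx.
- move/(exitedE ev): (N1) => s0 _; rewrite ler0_norm//.
  have : - h < last_exit B v by rewrite ltNge; apply/negP => /(exited_flowE _ ev).
  by rewrite ltrNl => /ltW/le_trans; apply; exact: ler_norm.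
- move/(exited_flowE _ ev): (N2) => s1 _.
  have s0 : 0 <= last_exit B v by rewrite leNgt; apply/negP => /ltW/(exitedE ev).
  by rewrite ger0_norm// (le_trans s1)// -normrN ler_norm.
- by rewrite (iN_out N1) (iN_out N2) subrr eqxx.
Qed.

(** The sign depends on [h] only, so the absolute value can be integrated exactly by [slab_mass]. *)
Lemma slab_sign h v : `|slab h v| = Num.sg h * slab h v.
Proof.
have [ev|nev] := pselect (exits B v); last first.
  have n1 : ~ exited v by case.
  have n2 : ~ exited (E (- h) *m v) by case=> /exits_flow.
  by rewrite /slab (iN_out n1) (iN_out n2) subrr mulr0 normr0.
rewrite /slab.
have [N1|N1] := pselect (exited v); have [N2|N2] := pselect (exited (E (- h) *m v)).
- by rewrite (iN_in N1) (iN_in N2) subrr mulr0 normr0.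
- rewrite (iN_in N1) (iN_out N2) subr0 normr1 mulr1 gtr0_sg//.
  rewrite ltNge; apply/negP => h0; apply: N2; apply/(exited_flowE _ ev).
  by move/(exitedE ev): N1 => /le_trans; apply; rewrite oppr_ge0.
- rewrite (iN_out N1) (iN_in N2) sub0r normrN1 mulrN1 ltr0_sg ?opprK//.
  rewrite ltNge; apply/negP => h0; apply: N1; apply/(exitedE ev).
  by move/(exited_flowE _ ev): N2 => /le_trans; apply; rewrite oppr_le0.
- by rewrite (iN_out N1) (iN_out N2) subrr mulr0 normr0.
Qed.

Lemma integrable_slab h : M.-integrable setT (EFin \o slab h).
Proof.
apply: integrableRB => //; first exact: integrable_iN.
exact: (Gmx_integrable (expR_gt0 _) (GE (- h)) integrable_iN).
Qed.

Lemma vintegrable_slab h (F : V -> V) (C : R) :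
  (forall i, measurable_fun setT (fun v => F v i 0)) ->
  (forall v, slab h v != 0 -> enorm (F v) <= C) ->
  vintegrable M (fun v => slab h v *: F v).
Proof.
move=> mF FC; apply: (@le_vintegrable _ _ _ _ (fun v => C * (Num.sg h * slab h v))).
- move=> i; under eq_fun do rewrite mxE; apply: measurable_funM => //.
  exact: measurable_slab.
- move=> v; rewrite enormZ -slab_sign mulrC; have [->|s0] := eqVneq (slab h v) 0.
    by rewrite normr0 !mulr0.
  by rewrite ler_wpM2r// FC.
- by apply: integrableRZ => //; apply: integrableRZ => //; exact: integrable_slab.
Qed.

(** This is E(h) applied to [beta] at E(-h); see [beta_flow]. *)
Definition drift h : V := vint M (fun v => slab h v *: v).

Lemma vintegrable_drift h : vintegrable M (fun v => slab h v *: v).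
Proof.
have [C C0 hC] := mxflow_bounded B `|h|.
apply: (@vintegrable_slab _ _ C) => [i|v /slab_support[ev sv]]; first exact: measurable_coord.
by rewrite [X in enorm X](exit_pointK B v) (le_trans (hC _ _ _))// ?normrN//
  (enorm_exit_point ev) mulr1.
Qed.

Definition exit_mean : V := vint M (fun v => iN v *: exit_point B v).

Lemma vintegrable_exit_mean : vintegrable M (fun v => iN v *: exit_point B v).
Proof.
apply: (@le_vintegrable _ _ _ _ iN).
- move=> i; under eq_fun do rewrite mxE; apply: measurable_funM; first exact: measurable_iN.
  apply: (@measurableT_comp _ _ _ _ _ _ (fun v : V => v i 0)); first exact: measurable_coord.
  exact: measurable_exit_point.
- move=> v; rewrite enormZ; have [Nv|Nv] := pselect (exited v).
    by rewrite (iN_in Nv) normr1 mul1r (enorm_exit_point Nv.1).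
  by rewrite (iN_out Nv) normr0 mul0r.
- exact: integrable_iN.
Qed.

(** Unlike [v] itself, the exit point is constant along orbits, so the scaling of [M] alone gives an
    exact value. *)
Lemma slab_exit_mean h :
  vint M (fun v => slab h v *: exit_point B v) = (1 - expR (- h)) *: exit_mean.
Proof.
have -> : vint M (fun v => slab h v *: exit_point B v) = vint M (fun v =>
    iN v *: exit_point B v - iN (E (- h) *m v) *: exit_point B (E (- h) *m v)).
  apply: eq_vint => v; rewrite /slab scalerBl; congr (_ - _).
  have [ev|nev] := pselect (exits B v); first by rewrite exit_point_flow.
  have n2 : ~ exited (E (- h) *m v) by case=> /exits_flow.
  by rewrite (iN_out n2) !scale0r.
have ik := vintegrable_exit_mean.
rewrite vintB//; last exact: (Gmx_vintegrable (expR_gt0 _) (GE (- h)) ik).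
by rewrite (Gmx_vint (expR_gt0 _) (GE (- h)) ik) scalerBl scale1r.
Qed.

Definition exited_mass : R := \int[M]_v iN v.

Lemma slab_mass h : \int[M]_v slab h v = (1 - expR (- h)) * exited_mass.
Proof.
have ii := integrable_iN.
rewrite /slab RintegralB//; last exact: (Gmx_integrable (expR_gt0 _) (GE (- h)) ii).
by rewrite (Gmx_Rintegral (expR_gt0 _) (GE (- h)) ii) mulrBl mul1r.
Qed.

Lemma exited_mass_ge0 : 0 <= exited_mass.
Proof. by apply: Rintegral_ge0 => v _; case/andP: (iN01 v). Qed.

(** On the slab a vector differs from its exit point by a flow of time at most |h|, hence by at most
    [e] in norm, and the slab has mass |1 - expR (- h)| times [exited_mass]. *)
Lemma drift_estimate (e : R) : 0 < e -> exists2 d : R, 0 < d & forall h i, `|h| <= d ->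
  `|(drift h - (1 - expR (- h)) *: exit_mean) i 0| <= e * `|1 - expR (- h)| * exited_mass.
Proof.
move=> e0; have [d d0 hd] := mxflow_near1 B e0.
exists d => // h i hh; rewrite -slab_exit_mean.
have mp k : measurable_fun setT (fun v => exit_point B v k 0).
  apply: (@measurableT_comp _ _ _ _ _ _ (fun v : V => v k 0)); first exact: measurable_coord.
  exact: measurable_exit_point.
have ie : vintegrable M (fun v => slab h v *: exit_point B v).
  by apply: (@vintegrable_slab _ _ 1) => // v /slab_support[ev _]; rewrite enorm_exit_point.
have id := vintegrable_drift h.
rewrite /drift -vintB// mxE.
have ij := vintegrableB id ie i.
rewrite (le_trans (le_normr_Rintegral measurableT ij))//.
have is_ := integrable_slab h.
apply: (@le_trans _ _ (\int[M]_v (e * (Num.sg h * slab h v)))).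
  apply: le_Rintegral => //.
  - by have := integrable_norm ij.
  - by apply: integrableRZ => //; apply: integrableRZ.
  - move=> v _; rewrite -slab_sign -scalerBr mxE normrM mulrC.
    have [->|s0] := eqVneq (slab h v) 0; first by rewrite normr0 !mulr0.
    rewrite ler_wpM2r// (le_trans (coord_le_enorm _ _))//.
    have [ev sv] := slab_support s0.
    rewrite [X in enorm (X - _)](exit_pointK B v).
    rewrite (le_trans (hd _ _ _))//; first by rewrite normrN (le_trans sv).
    by rewrite enorm_exit_point ?mulr1.
rewrite RintegralZl//; last by apply: integrableRZ.
rewrite RintegralZl// slab_mass -mulrA ler_wpM2l ?(ltW e0)// mulrA.
rewrite ler_wpM2r ?exited_mass_ge0// (le_trans (ler_norm _))//.
by rewrite normrM ler_piMl// normr_sg; case: (h != 0).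
Qed.

Lemma drift0 : drift 0 = 0.
Proof.
apply/colP => i; rewrite !mxE (_ : (fun v : V => _) = fun=> 0).
  exact: (congr1 fine (integral0 _ _)).
by apply/funext => v; rewrite /slab oppr0 mxflow0 mul1mx subrr scale0r mxE.
Qed.

(** Splits the slab of l + h at [l] and substitutes along the flow: a cocycle twisted by
    [expR (- l)] times E(l). *)
Lemma driftD l h : drift (l + h) = drift l + expR (- l) *: (E l *m drift h).
Proof.
have il := vintegrable_drift l.
have ih : vintegrable M (fun v => E l *m (slab h v *: v)).
  by apply: vintegrable_mulmx; exact: vintegrable_drift.
have ih' := Gmx_vintegrable (expR_gt0 _) (GE (- l)) ih.
rewrite -[X in _ + _ *: X](vint_mulmx (E l) (vintegrable_drift h)).
rewrite -(Gmx_vint (expR_gt0 _) (GE (- l)) ih) -vintD//.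
apply: eq_vint => v.
rewrite -scalemxAr mulmxA mxflowNr mul1mx -scalerDl; congr (_ *: _).
by rewrite /slab mulmxA -mxflowD opprD [- l - h]addrC addrA subrK.
Qed.

Lemma is_derive_drift0 i :
  is_derive (0 : R) (1 : R) (fun h => drift h i 0) (exit_mean i 0).
Proof.
pose q h : R := h^-1 * (1 - expR (- h)).
have q1 : q h @[h --> 0^'] --> (1 : R).
  have de : is_derive (0 : R) (1 : R) (fun t : R => expR (- t)) (- expR (- 0)).
    rewrite -[X in is_derive _ _ _ X]mulrN1.
    exact: (@is_derive1_comp _ expR -%R).
  have d1 := is_deriveB (is_derive_cst (1 : R) (0 : R) (1 : R)) de.
  rewrite sub0r opprK oppr0 expR0 in d1.
  rewrite -[X in _ --> X](derive_val (is_derive := d1)).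
  move: (ex_derive (is_derive := d1)); rewrite /derivable /derive /=.
  pose f : R -> R := cst 1 - (fun t => expR (- t)).
  have -> : q = (fun h => h^-1 *: (f (h%:A + 0) - f 0)).
    apply/funext => h; rewrite /f /q /GRing.scale /= addr0 mulr1.
    by rewrite !fctE /= oppr0 expR0 subrr subr0.
  exact.
have cv : h^-1 *: (drift (h%:A + 0) i 0 - drift 0 i 0) @[h --> 0^'] --> exit_mean i 0.
  rewrite -[X in _ --> X]mul1r.
  have c1 : q h * exit_mean i 0 @[h --> 0^'] --> 1 * exit_mean i 0.
    by apply: cvgM => //; exact: cvg_cst.
  have c2 : h^-1 * (drift h i 0) - q h * exit_mean i 0 @[h --> 0^'] --> (0 : R).
    apply/cvgr0Pnorm_lt => e e0.
    have m0 := exited_mass_ge0.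
    (* The 2 bounds |q h| near 0, and the 1 keeps the denominator positive. *)
    have e'0 : 0 < e / (2 * exited_mass + 1).
      by rewrite divr_gt0// ltr_wpDl// mulr_ge0.
    have [d d0 hd] := drift_estimate e'0.
    move: q1 => /cvgrPdist_lt/(_ 1 ltr01) q1.
    near=> h.
    have hle : `|h| <= d by near: h; exact: dnbhs0_le.
    have q2 : `|q h| <= 2.
      have : `|1 - q h| < 1 by near: h; exact: q1.
      rewrite ltr_distlC => /andP[a1 a2]; rewrite ler_norml; apply/andP; split; lra.
    have -> : h^-1 * drift h i 0 - q h * exit_mean i 0 =
        h^-1 * (drift h - (1 - expR (- h)) *: exit_mean) i 0.
      by rewrite !mxE mulrBr /q mulrA.
    rewrite normrM (@le_lt_trans _ _ (`|h^-1| * (e / (2 * exited_mass + 1) * `|1 - expR (- h)| * exited_mass)))//.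
      by rewrite ler_wpM2l// hd.
    have -> : `|h^-1| * (e / (2 * exited_mass + 1) * `|1 - expR (- h)| * exited_mass) =
        e / (2 * exited_mass + 1) * (`|q h| * exited_mass) by rewrite /q normrM; ring.
    rewrite mulrAC ltr_pdivrMr; last by rewrite ltr_wpDl// mulr_ge0.
    rewrite ltr_pM2l//.
    by rewrite (@le_lt_trans _ _ (2 * exited_mass)) ?ltrDl// ler_wpM2r.
  rewrite -[X in _ --> X]add0r.
  have -> : (fun h : R => h^-1 *: (drift (h%:A + 0) i 0 - drift 0 i 0)) =
      (fun h => (h^-1 * drift h i 0 - q h * exit_mean i 0) + q h * exit_mean i 0).
    apply/funext => h.
    have d00 : drift 0 i 0 = 0 by rewrite drift0 mxE.
    have h0 : h *: 1 + 0 = h :> R by rewrite addr0 /GRing.scale /= mulr1.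
    by rewrite subrK [X in drift X]h0 [X in _ - X]d00 subr0.
  exact: cvgD.
by apply: DeriveDef; [apply/cvg_ex; eexists; exact: cv|exact: cvg_lim cv].
Unshelve. all: by end_near. Qed.

Let scaled_entry (A : 'M[R]_n) (a : R) y i :
  (a *: (A *m y)) i 0 = a * \sum_j A i j * y j 0.
Proof. by rewrite mxE [X in _ * X]mxE. Qed.

(** The cocycle rule transports the derivative at 0 to every [l]. *)
Lemma is_derive_drift l i :
  is_derive (l : R) (1 : R) (fun t => drift t i 0) ((expR (- l) *: (E l *m exit_mean)) i 0).
Proof.
have e : (fun t => drift t i 0) =
    (fun h => drift l i 0 + expR (- l) * \sum_j E l i j * drift h j 0) \o (fun t => t - l).
  apply/funext => t /=; transitivity (drift (l + (t - l)) i 0).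
    by congr (drift _ i 0); rewrite addrC subrK.
  by rewrite (driftD l (t - l)) [LHS]mxE scaled_entry.
rewrite e scaled_entry -[X in is_derive _ _ _ X]mulr1.
apply: is_derive1_comp.
  rewrite subrr -[X in is_derive _ _ _ X]add0r; apply: is_deriveD.
  apply: is_deriveZ; apply: is_derive_bigsum => j; apply: is_deriveZ.
  exact: is_derive_drift0.
by rewrite -[X in is_derive _ _ _ X]subr0; exact: is_deriveB.
Qed.

Definition cobound y t : V := expR (- t) *: (E t *m y) - y.

Lemma is_derive_cobound y l i :
  is_derive (l : R) (1 : R) (fun t => cobound y t i 0)
    ((expR (- l) *: (E l *m ((B - 1%:M) *m y))) i 0).
Proof.
have d1 : is_derive l 1 (fun t : R => expR (- t)) (- expR (- l)).
  rewrite -[X in is_derive _ _ _ X]mulrN1.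
  exact: (@is_derive1_comp _ expR -%R).
have d2 : is_derive l 1 (fun t => \sum_j y j 0 * E t i j) (\sum_j y j 0 * (B *m E l) i j).
  apply: is_derive_bigsum => j; apply: is_deriveZ; exact: is_derive_mxflow.
have -> : (fun t => cobound y t i 0) =
    (fun t => expR (- t) * (\sum_j y j 0 * E t i j) - y i 0).
  apply/funext => t; rewrite /cobound [LHS]mxE scaled_entry [X in _ + X]mxE; congr (_ * _ - _).
  by apply: eq_bigr => j _; rewrite mulrC.
have := is_deriveB (is_deriveM d1 d2) (is_derive_cst (y i 0) l 1).
set z := (X in is_derive _ _ _ X -> _); suff -> : z = (expR (- l) *: (E l *m ((B - 1%:M) *m y))) i 0 by [].
rewrite /z subr0 /= mulmxA mulmxBr mulmx1 -mulmx_mxflow_comm scaled_entry.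
rewrite /GRing.scale /= mulrN [X in _ - X]mulrC -mulrBr -sumrB; congr (_ * _).
by apply: eq_bigr => j _; rewrite [X in _ = X * _]mxE [X in _ = (_ + X) * _]mxE; ring.
Qed.

(** Both functions vanish at 0, and their derivatives are the same twisted flow applied to
    [exit_mean] and to (B - 1) y. *)
Lemma drift_coboundP y :
  (forall l, drift l = cobound y l) <-> (B - 1%:M) *m y = exit_mean.
Proof.
split=> [h|h l]; apply/colP => i.
  have := is_derive_cobound y 0 i; have := is_derive_drift0 i.
  have -> : (fun h => drift h i 0) = (fun t => cobound y t i 0).
    by apply/funext => t; rewrite h.
  rewrite oppr0 expR0 scale1r mxflow0 mul1mx.
  by move=> [_ <-] [_ <-].
have der (x : R) : is_derive x (1 : R) (fun t => drift t i 0 - cobound y t i 0) 0.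
  rewrite -(subrr ((expR (- x) *: (E x *m exit_mean)) i 0)).
  apply: is_deriveB; first exact: is_derive_drift.
  by rewrite -h; exact: is_derive_cobound.
have := is_derive_0_is_cst l 0 der.
rewrite drift0 /cobound oppr0 expR0 scale1r mxflow0 mul1mx subrr subrr.
by move/eqP; rewrite subr_eq0 => /eqP.
Qed.

Lemma eq_vint_conull (F G : V -> V) (N : set V) : vintegrable M F -> vintegrable M G ->
  measurable N -> M N = 0%E -> (forall v, ~ N v -> F v = G v) -> vint M F = vint M G.
Proof.
move=> iF iG mN N0 FG; apply/eqP; rewrite -subr_eq0 -vintB//; apply/eqP/colP => i.
rewrite !mxE; apply: (Rintegral_null _ mN N0); first exact: vintegrableB.
by move=> v /FG ->; rewrite subrr mxE.
Qed.

(** Along decaying orbits the difference of the truncations is the slab function for time -s; the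
    other orbits form a null set. *)
Lemma beta_flow s : beta M psi_flow (E s) = E s *m drift (- s).
Proof.
rewrite -vint_mulmx; last exact: vintegrable_drift.
apply: (eq_vint_conull (N := ~` [set v | decays B v])).
- exact: (vintegrable_beta lM (expR_gt0 s) (GE s) truncation_psi_flow).
- by apply: vintegrable_mulmx; exact: vintegrable_drift.
- by apply: measurableC; exact: measurable_decays.
- exact: (decays_conull lM GE).
move=> v /contrapT dv; rewrite -scalemxAr; congr (_ *: _).
rewrite /psi_flow (asboolT dv) (asboolT (decays_flow s dv)) /slab opprK.
by rewrite opprB addrC addrA subrK.
Qed.

Lemma centering_flowP x s :
  E s *m x + beta M psi_flow (E s) = expR s *: x <-> drift (- s) = cobound x (- s).
Proof.
rewrite beta_flow -mulmxDr /cobound opprK; split=> [e|->].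
  have := congr1 (mulmx (E (- s))) e; rewrite mulmxA mxflowN mul1mx -scalemxAr => <-.
  by rewrite addrAC subrr add0r.
by rewrite addrCA subrr addr0 -scalemxAr mulmxA mxflowNr mul1mx.
Qed.

Lemma measurable_L_set : measurable (L_set B).
Proof.
rewrite (_ : L_set B = [set v : V | [set 1] (enorm v)] `&` outside_after B 0).
  apply: measurableI; last exact: measurable_outside_after.
  by rewrite -[X in measurable X]setTI; exact: (measurable_enorm measurableT (measurable_set1 _)).
by apply/seteqP; split=> v /L_setE.
Qed.

Let iN0 v : 0 <= iN v. Proof. by case/andP: (iN01 v). Qed.

Let exited_measure : {measure set V -> \bar R} := density_measure M measurable_iN iN0.

(** [K_meas] comes without a measure structure; it agrees on measurable sets with this measure, for
    which change of variables is available. *)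
Let exit_measure : {measure set V -> \bar R} :=
  measure_function_pushforward__canonical__measure_function_Measure exited_measure
    (@measurable_exit_point R n B).

Let exited_measureE (S : set V) : measurable S -> exited_measure S = M (S `&` exited).
Proof.
move=> mS; rewrite /exited_measure /= /density_measure.
by rewrite /iN integral_indic// 1?setIC//; exact: measurable_exited.
Qed.

Let K_measE (S : set V) : measurable S -> K_meas M B S = exit_measure S.
Proof.
move=> mS; rewrite /K_meas L_set_raysE /exit_measure /= /pushforward.
rewrite exited_measureE; first by rewrite setIC.
by rewrite -[X in measurable X]setTI; exact: measurable_exit_point.
Qed.

Let exited_measure_fin : (exited_measure setT < +oo)%E.
Proof. by rewrite exited_measureE// setTI exited_fin. Qed.

Lemma integral_K_meas w :
  (\int[K_meas M B]_(u in L_set B) (dot u w)%:E = (dot exit_mean w)%:E)%E.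
Proof.
rewrite (eq_set_function_integral _ _ K_measE).
pose g u : R := \1_(L_set B) u * dot u w.
have mg : measurable_fun setT g.
  apply: measurable_funM; last exact: measurable_dot.
  by apply: measurable_indic; exact: measurable_L_set.
have gw u : `|g u| <= enorm w.
  rewrite /g indicE; have [Lu|Lu] := pselect (L_set B u).
    rewrite mem_set// mul1r (le_trans (cauchy_schwarz _ _))//.
    by have [-> _] := Lu; rewrite mul1r.
  by rewrite memNset// mul0r normr0 enorm_ge0.
rewrite integral_mkcond.
have -> : (fun u => (dot u w)%:E) \_ (L_set B) = EFin \o g.
  apply/funext => u; rewrite /patch /= /g indicE.
  by case: ifP; rewrite ?mul1r ?mul0r.
have mgp : measurable_fun setT (g \o exit_point B).
  by apply: measurableT_comp => //; exact: measurable_exit_point.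
have ig : exited_measure.-integrable setT (EFin \o (g \o exit_point B)).
  by apply: (integrable_bounded (B := enorm w)) => // v _; exact: gw.
rewrite (integral_pushforward (@measurable_exit_point R n B))//; last first.
  exact/measurable_EFinP.
rewrite preimage_setT -[LHS]fineK; last exact: (integrable_fin_num measurableT ig).
congr EFin.
rewrite (vint_dot _ vintegrable_exit_mean).
rewrite -[LHS]/(\int[exited_measure]_v (g \o exit_point B) v) Rintegral_density//.
apply: eq_Rintegral => v _; rewrite dotZl /= mulrC.
have [Nv|Nv] := pselect (exited v); last by rewrite (iN_out Nv) !mul0r.
(* Exit points lie in [L_set B], so the indicator in [g] is 1 here. *)
by rewrite /g indicE mem_set ?mul1r//; apply: exit_point_L_set; exact: Nv.1.
Qed.

Lemma balanced_continuousP :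
  (forall w, nullspace (B^T - 1%:M) w ->
     (\int[K_meas M B]_(u in L_set B) (dot u w)%:E = 0)%E) <->
  (exists x, forall s, E s *m x + beta M psi_flow (E s) = expR s *: x).
Proof.
transitivity (exists x, (B - 1%:M) *m x = exit_mean); last first.
  split=> -[x e]; exists x.
    by move=> s; apply/centering_flowP; exact: (drift_coboundP x).2.
  apply/drift_coboundP => l; rewrite -(opprK l); exact/centering_flowP.
rewrite range_orthP linearB /= trmx1; split=> h w hw.
  by have := h w hw; rewrite integral_K_meas => -[].
by rewrite integral_K_meas h.
Qed.

End continuous_case.

(** * Back to universal centerings *)

Section centering_transfer.
Context {R : realType} {n : nat}.
Notation V := 'cV[R]_n.
Implicit Types (x y h : V) (a : R) (A : 'M[R]_n).
Variables (mu : probability V R) (m : V) (D : 'M[R]_n) (M : {measure set V -> \bar R}).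
Hypothesis lmu : levy_khintchine mu m D M.

Let lM : levy_measure M. Proof. by have /levy_khintchineE[_] := lmu. Qed.

Lemma universal_centering_fixed (psi : V -> R) a A h : 0 < a -> Gmx a D M A ->
  truncation M psi -> universal_centering mu h ->
  A *m (m + h - tshift M psi) + beta M psi A = a *: (m + h - tshift M psi).
Proof.
move=> a0 GA tpsi uh; apply/(centering_beta lM _ _ a0 GA tpsi).
apply/(centering_eqP _ a0 lmu GA); apply: uh => //.
by have [uA _ _] := GA; apply/(GsetP a0 lmu uA).
Qed.

Lemma fixed_corr (psi : V -> R) a A x : 0 < a -> Gmx a D M A -> truncation M psi ->
  A *m x + beta M psi A = a *: x ->
  A *m (x + tshift M psi) + corr A M = a *: (x + tshift M psi).
Proof. by move=> a0 GA tpsi e; apply/(centering_beta lM _ _ a0 GA tpsi); rewrite addrK. Qed.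

(** Fullness makes every [A] in [Gset] invertible, so the description by [Gmx] reaches all operators
    in the definition of a centering. *)
Lemma common_centering_universal z : full mu ->
  (forall a A, 0 < a -> Gmx a D M A -> A *m z + corr A M = a *: z) ->
  universal_centering mu (z - m).
Proof.
move=> fmu hz a A a0 GA; have uA := full_Gset_unitmx fmu a0 GA.
have gA := (GsetP a0 lmu uA).1 GA.
by apply/(centering_eqP _ a0 lmu gA); rewrite [m + _]addrC subrK; exact: hz.
Qed.

End centering_transfer.

Theorem theorem13 (R : realType) (n : nat) (mu : probability 'cV[R]_n R)
    (m : 'cV[R]_n) (D : 'M[R]_n) (M : {measure set 'cV[R]_n -> \bar R}) :
  quasi_decomposable mu -> levy_khintchine mu m D M ->
  (forall (c a : R) (A : 'M[R]_n),
     0 < c < 1 ->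
     [set b : R | 0 < b /\ Gset b mu !=set0] = [set c ^ k | k in [set: int]] ->
     0 < a < 1 -> Gset a mu A -> A \in unitmx -> opnorm A < 1 ->
     let centered := exists h, universal_centering mu h in
     let balanced := forall w, nullspace (A^T - a%:M) w ->
       (\int[M]_(u in Z_set A) (dot u w)%:E = 0)%E in
     (full mu -> (centered <-> balanced)) /\ (centered -> balanced))
  /\
  (forall B : 'M[R]_n,
     (forall a : R, 0 < a -> Gset a mu !=set0) ->
     (forall t : R, 0 < t -> Gset t mu (powmx t B)) ->
     let centered := exists h, universal_centering mu h in
     let balanced := forall w, nullspace (B^T - 1%:M) w ->
       (\int[K_meas M B]_(u in L_set B) (dot u w)%:E = 0)%E in
     (full mu -> (centered <-> balanced)) /\ (centered -> balanced)).
Proof.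
move=> _ lmu; have lM : levy_measure M by have /levy_khintchineE[_] := lmu.
split=> [c a A c01 degrees a01 GA uA A1|B _ GB] centered balanced.
  have a0 : 0 < a by case/andP: a01.
  have gA := (GsetP a0 lmu uA).1 GA.
  have balancedP := balanced_discreteP lM a0 gA A1.
  have tb := truncation_ball1 lM.
  have centered_balanced : centered -> balanced.
    (* The drift of the translated measure, relative to the ball truncation. *)
    move=> [h uh]; apply/balancedP; exists (m + h - tshift M (@ball1 R n)).
    exact: (universal_centering_fixed lmu a0 gA tb uh).
  split => // fmu; split => // /balancedP[x /(fixed_corr lmu a0 gA tb) ey].
  have [b b0|z hz] := common_centering_discrete fmu lmu c01 a01 _ gA ey.
    (* The degrees are given through [Gset], while the averaging argument uses [Gmx]; for a full
       measure every operator involved is invertible and the two agree. *)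
    have -> : (exists k : int, b = c ^ k) <-> [set c ^ k | k in [set: int]] b.
      by split=> [[k ->]|[k _ <-]]; [exists k|exists k].
    rewrite -degrees; split=> [[S gS]|[_ [S GS]]].
      split => //; exists S; apply/(GsetP b0 lmu) => //.
      by have [] := gS.
    by exists S; apply/(GsetP b0 lmu) => //; exact: full_Gset_unitmx GS.
  by exists (z - m); exact: (common_centering_universal lmu fmu hz).
have GE s : Gmx (expR s) D M (mxflow B s).
  apply/(GsetP (expR_gt0 s) lmu (mxflow_unit B s)).
  by have := GB _ (expR_gt0 s); rewrite /powmx expRK.
have balancedP := balanced_continuousP lM GE.
have tp := truncation_psi_flow B lM.
have centered_balanced : centered -> balanced.
  move=> [h uh]; apply/balancedP; exists (m + h - tshift M (psi_flow B)) => s.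
  exact: (universal_centering_fixed lmu (expR_gt0 s) (GE s) tp uh).
split => // fmu; split => // /balancedP[x hx].
have GT t : 0 < t -> Gmx t D M (mxflow B (ln t)).
  by move=> t0; rewrite -{1}(lnK t0).
(* Every degree occurs in the flow, so each remaining operator lies in the coset of a flow
   operator. *)
have [||z hz] := @common_centering_flow _ _ _ _ _ _ fmu lmu
    (fun t => mxflow B (ln t)) (x + tshift M (psi_flow B)) => //.
  move=> t t0; apply: (fixed_corr lmu t0 (GT t t0) tp).
  by rewrite hx lnK.
by exists (z - m); exact: (common_centering_universal lmu fmu hz).
Qed.
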